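(* Assume $p\neq2$ and $l\ge2$. Let $\pi$ be a simple supercuspidal representation of the split group $\mathrm{SO}_{2l}(F)$ attached to a uniformizer $\varpi$, $\alpha\in\mathfrak o^\times$, a central character $\omega$ and a sign $\chi(g_\chi)\in\{\pm1\}$. Let $\tau_1$ (unramified) and $\tau_2$ (tamely ramified, not unramified) be the two quadratic tamely ramified characters $\tau$ of $F^*$ for which $\gamma(s,\pi\times\tau,\psi)$ has a pole at $s=1$; explicitly $\tau_1(\varpi)=\chi(g_\chi)$, and $\tau_2(\varpi)=\chi(g_\chi)\tau_2(\gamma)$ with $\gamma=-4\alpha$. Assume that the Langlands parameter of $\pi$ decomposes as $\varphi=\varphi_1\oplus\varphi_2\oplus\varphi_3$ with $\varphi_1=\tau_1$, $\varphi_2=\tau_2$, and $\varphi_3$ of dimension $2l-2$ corresponding under the local Langlands correspondence to a simple supercuspidal representation $\Pi'$ of $\mathrm{GL}_{2l-2}(F)$. Let $\delta$ be the coefficient of $q^{1/2-s}$ in $\gamma(s,\Pi',\psi)$. Then $$\delta=\pi(-I_{2l})\,\chi(g_\chi)\,\epsilon(s,\tau_2,\psi)^{-1}.$$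
   Context: $F$ is a $p$-adic field of characteristic $0$ with ring of integers $\mathfrak o$, maximal ideal $\mathfrak p$, residue field $\kappa$, $q=|\kappa|$, $|\varpi|=q^{-1}$. $\psi$ is an additive character of $F$ of level $1$ (trivial on $\mathfrak p$, nontrivial on $\mathfrak o$), and the Haar measure on $F$ is self-dual for $\psi$. A character $\tau$ of $F^*$ is quadratic if $\tau^2=1$, and tamely ramified if trivial on $1+\mathfrak p$; characters of $F^*$ are identified with $1$-dimensional representations of the Weil group by class field theory. $J_r$ is the $r\times r$ permutation matrix with ones on the anti-diagonal. $\mathrm{SO}_{2l}=\{g\in\mathrm{SL}_{2l}(F):{}^tgJ_{2l}g=J_{2l}\}$, with center $Z$ and upper triangular unipotent subgroup $U$. $\epsilon(s,\tau_2,\psi)$ is Tate's $\epsilon$-factor (independent of $s$ here, since $\psi$ has level $1$ and $\tau_2$ is tamely ramified and ramified). $\gamma(s,\Pi',\psi)$ is the Godement–Jacquet $\gamma$-factor; a simple supercuspidal representation of $\mathrm{GL}_n(F)$ is a supercuspidal representation of depth $1/n$, and for these $\gamma(s,\Pi',\psi)$ is a constant multiple of $q^{1/2-s}$. The Langlands parameter of $\pi$ is viewed as a $2l$-dimensional representation (via the standard representation of $\mathrm{SO}_{2l}(\mathbb C)$), and satisfies $\gamma(s,\pi,\psi)=\gamma(s,\varphi,\psi)$, where $\gamma(s,\pi,\psi)=\gamma(s,\pi\times1,\psi)$. Simple supercuspidal representations of $\mathrm{SO}_{2l}$. Let $I$ be the standard Iwahori subgroup (upper triangular mod $\mathfrak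 p$; generated by the maximal compact subgroup of the diagonal torus and the positive affine root groups) and $I^+$ its pro-unipotent radical. For a uniformizer $\varpi$ and $\alpha\in\mathfrak o^\times$ (representing a class in $\kappa^\times/(\kappa^\times)^2$), let $\chi$ be the character of $I^+$ $$\chi(h)=\psi\Big(\sum_{i=1}^{l-1}h_{i,i+1}+\alpha h_{l-1,l+1}+\varpi^{-1}h_{2l-1,1}\Big).$$ Let $g_\chi\in\mathrm{SO}_{2l}$ be the matrix whose only nonzero entries are: $-\varpi^{-1}$ at $(1,2l)$, $-\varpi$ at $(2l,1)$, $1$ at $(i,i)$ for $2\le i\le l-1$ and $l+2\le i\le 2l-1$, $\alpha^{-1}$ at $(l,l+1)$, $\alpha$ at $(l+1,l)$. Then $g_\chi^2=1$ and $g_\chi$ stabilizes $\chi$. Extend $\chi$ to $Z\langle g_\chi\rangle I^+$ by a character $\omega$ of $Z$ and by a choice of $\chi(g_\chi)\in\{\pm1\}$. The representation $\pi$ compactly induced from this character of $Z\langle g_\chi\rangle I^+$ to $\mathrm{SO}_{2l}$ is irreducible supercuspidal; it is called simple supercuspidal. Put $\gamma=-4\alpha$; $\pi(-I_{2l})=\omega(-I_{2l})$. The $\gamma$-factor. Let $\mathrm{SO}_3=\{g\in\mathrm{SL}_3(F):{}^tgJ_{3,\gamma}g=J_{3,\gamma}\}$, $J_{3,\gamma}=\left(\begin{smallmatrix}&&1\\ &\gamma/2&\\ 1&&\end{smallmatrix}\right)$, $U_{\mathrm{SO}_3}$ its upper triangular unipotent subgroup. $V(\tau,s)$ is the space of smooth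 functions $f_s$ on $\mathrm{SO}_3\times F^*$ with $f_s(\mathrm{diag}(m,1,m^{-1})ug,a)=|m|^s\tau(am)f_s(g,1)$ for $m,a\in F^*$, $u\in U_{\mathrm{SO}_3}$; a section is holomorphic if its restriction to $\mathrm{SO}_3(\mathfrak o)$ is polynomial in $q^{\pm s}$. $\mathrm{SO}_3$ is embedded in $\mathrm{SO}_{2l}$ by $x=(x_{ij})\mapsto\mathrm{diag}(I_{l-2},A\,x^{\sharp}A^{-1},I_{l-2})$, where $$A=\left(\begin{smallmatrix}1&&&\\ &\frac14&\frac14&\\ &-\gamma&\gamma&\\ &&&1\end{smallmatrix}\right),\qquad x^\sharp=\left(\begin{smallmatrix}x_{11}&&x_{12}&x_{13}\\ &1&&\\ x_{21}&&x_{22}&x_{23}\\ x_{31}&&x_{32}&x_{33}\end{smallmatrix}\right).$$ The character of $U$ is $\psi(u)=\psi(\sum_{i=1}^{l-2}u_{i,i+1}+\frac14u_{l-1,l}-\gamma u_{l-1,l+1})$; $\pi$ is generic with respect to its inverse, with Whittaker model $\mathcal W(\pi,\psi^{-1})$. $R^{l,1}$ is the group of elements of $\mathrm{SO}_{2l}$ of the form $\mathrm{diag}\big(\left(\begin{smallmatrix}1&\\ r&I_{l-2}\end{smallmatrix}\right),I_2,\left(\begin{smallmatrix}I_{l-2}&\\ r'&1\end{smallmatrix}\right)\big)$ with $r\in F^{l-2}$ a column, and $w^{l,1}=\mathrm{diag}\big(\left(\begin{smallmatrix}&1\\ I_{l-2}&\end{smallmatrix}\right),I_2,\left(\begin{smallmatrix}&I_{l-2}\\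 1&\end{smallmatrix}\right)\big)$. For $W\in\mathcal W(\pi,\psi^{-1})$ and a holomorphic section $f_s$, $$\Psi(W,f_s)=\int_{U_{\mathrm{SO}_3}\backslash\mathrm{SO}_3}\int_{R^{l,1}}W(rw^{l,1}h)f_s(h,1)\,dr\,dh$$ (by meromorphic continuation from $\mathrm{Re}(s)\gg0$). $M(\tau,s):V(\tau,s)\to V(\tau^{-1},1-s)$ is the meromorphic continuation of $M(\tau,s)f_s(h,a)=\int_{U_{\mathrm{SO}_3}}f_s(w_1uh,-a^{-1})\,du$, $w_1=\left(\begin{smallmatrix}&&1\\ &-1&\\ 1&&\end{smallmatrix}\right)$. $M^*(\tau,s)=C(s,\tau,\psi)M(\tau,s)$, where $\int_{U_{\mathrm{SO}_3}} f_s(w_1u,1)\psi^{-1}(u_{1,2})du=C(s,\tau,\psi)\int_{U_{\mathrm{SO}_3}} M(\tau,s)f_s(w_1u,1)\psi^{-1}(u_{1,2})du$, and $\Psi^*(W,f_s)=\Psi(W,M^*(\tau,s)f_s)$. The factor $\gamma(s,\pi\times\tau,\psi)$ is the rational function of $q^{-s}$ such that for all $W$, $f_s$ $$\gamma(s,\pi\times\tau,\psi)\Psi(W,f_s)=\pi(-I_{2l})\tau(-1)^l\,\tau^2(2)|2|^{2s-1}\tau^{-2}(\gamma)|\gamma|^{-2s+1}\,\Psi^*(W,f_s).$$ *)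

(* Defs.v *)
From HB Require Import structures.
From mathcomp Require Import all_boot all_order all_algebra.
From mathcomp Require Import boolp classical_sets reals.
From mathcomp Require Import complex.

Set Implicit Arguments.
Unset Strict Implicit.
Unset Printing Implicit Defensive.

Import Order.TTheory GRing.Theory Num.Theory.
Local Open Scope classical_set_scope.
Local Open Scope ring_scope.

(** * p-adic fields of characteristic 0 *)

(* [in_pow v k x] : x lies in the k-th power of the maximal ideal; the value
   of [v] at 0 is irrelevant. *)
Definition in_pow (F : fieldType) (v : F -> int) (k : int) (x : F) : Prop :=
  x = 0 \/ (k <= v x)%R.

(* A field of characteristic 0, complete for a normalised discrete valuation,
   with residue field of cardinality [pf_q] and of characteristic [pf_p]; the
   normalised absolute value is |x| = q^(- v x). *)
Record padic_field := PadicField {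
  pf_field :> fieldType;
  pf_val : pf_field -> int;
  pf_p : nat;
  pf_q : nat;
  pf_valM : forall x y, x != 0 -> y != 0 -> pf_val (x * y) = pf_val x + pf_val y;
  pf_valD : forall k x y,
    in_pow pf_val k x -> in_pow pf_val k y -> in_pow pf_val k (x + y);
  pf_valn : exists2 w, w != 0 & pf_val w = 1;
  pf_residue : exists d : 'I_pf_q -> pf_field,
    (forall i, in_pow pf_val 0 (d i)) /\
    (forall x, in_pow pf_val 0 x -> exists! i, in_pow pf_val 1 (x - d i));
  pf_complete : forall u : nat -> pf_field,
    (forall k : int, exists N : nat, forall m n : nat,
       (N <= m)%N -> (N <= n)%N -> in_pow pf_val k (u m - u n)) ->
    exists x, forall k : int, exists N : nat, forall n : nat,
       (N <= n)%N -> in_pow pf_val k (u n - x);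
  pf_char0 : forall n : nat, (0 < n)%N -> n%:R != 0 :> pf_field;
  pf_prime : prime pf_p;
  pf_residue_char : in_pow pf_val 1 (pf_p%:R)
}.

Section Local.
Variables (F : padic_field) (R : realType).
Local Notation C := R[i].
Local Notation v := (@pf_val F).
Local Notation q := (pf_q F).

Definition inp (k : int) (x : F) : Prop := in_pow v k x.

(** ** Rational functions of q^(-s) *)

(* The complex variable s enters only through z = q^(-s), which ranges over
   all nonzero complex numbers; so |x|^s = z^(v x), the point 1 - s is
   (q z)^(-1), Re(s) >> 0 means that |z| is small, and Re(1 - s) >> 0 that |z|
   is large.  The class of 'X stands for q^(-s). *)
Definition ratfun := {fraction {poly C}}.
Definition cst (c : C) : ratfun := FracField.tofrac c%:P.
Definition Xs : ratfun := FracField.tofrac 'X.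

Definition rf_at (g : ratfun) (z w : C) : Prop :=
  exists P Q : {poly C}, [/\ Q.[z] != 0,
    g = FracField.tofrac P / FracField.tofrac Q & w = P.[z] / Q.[z]].
Definition has_pole (g : ratfun) (z : C) : Prop := ~ exists w, rf_at g z w.
Definition rval (g : ratfun) (z : C) : C := xget 0 [set w | rf_at g z w].

Definition near0 (P : C -> Prop) : Prop :=
  exists2 r : C, 0 < r & forall z, 0 < `|z| < r -> P z.
Definition nearoo (P : C -> Prop) : Prop :=
  exists2 r : C, 0 < r & forall z, r < `|z| -> P z.

(** ** Integration *)

(* Unconditional (equivalently, absolutely convergent) sum of f over D. *)
Definition has_sum (T : eqType) (D : set T) (f : T -> C) (S : C) : Prop :=
  forall e : C, 0 < e -> exists s0 : seq T,
    (forall x, x \in s0 -> D x) /\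
    forall s : seq T, uniq s -> (forall x, x \in s0 -> x \in s) ->
      (forall x, x \in s -> D x) -> `|\sum_(x <- s) f x - S| < e.

Definition mx_inp m n (k : int) (x : 'M[F]_(m, n)) : Prop :=
  forall i j, inp k (x i j).

(* [is_int f S] : f is invariant under translation by a lattice, is
   integrable, and S is its integral for the self-dual measure.  As psi is
   trivial on p and not on o, the dual of o is p, so that vol(o)^2 / q = 1. *)
Definition is_int m n (f : 'M[F]_(m, n) -> C) (S : C) : Prop :=
  exists (k : int) (D : set 'M[F]_(m, n)) (S0 : C),
    [/\ forall x y, mx_inp k y -> f (x + y) = f x,
        forall x, exists! d, D d /\ mx_inp k (x - d),
        has_sum D f S0
      & S = (sqrtC q%:R / q%:R ^ k) ^+ (m * n) * S0].

Definition congr_subgroup n (m : nat) : set 'M[F]_n :=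
  [set g | g \in unitmx /\ mx_inp m%:Z (g - 1%:M)].

Definition left_transversal n (G K D : set 'M[F]_n) : Prop :=
  D `<=` G /\ forall g, G g -> exists! d, D d /\ K (invmx d *m g).

(* Integral over G of a right K-invariant function, for the Haar measure that
   gives volume 1 to the compact open subgroup K. *)
Definition is_haar_int n (G K : set 'M[F]_n) (f : 'M[F]_n -> C) (S : C) : Prop :=
  (forall g k, G g -> K k -> f (g *m k) = f g) /\
  exists2 D, left_transversal G K D & has_sum D f S.

(** ** Characters *)

(* Additive character of level 1. *)
Definition level1_character (psi : F -> C) : Prop :=
  [/\ forall x y, psi (x + y) = psi x * psi y,
      forall x, inp 1 x -> psi x = 1
    & exists2 x, inp 0 x & psi x != 1].

(* Multiplicative characters of F^* are functions on F whose value at 0 is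
   irrelevant. *)
Definition mult_char (tau : F -> C) : Prop :=
  [/\ tau 1 = 1,
      forall x y, x != 0 -> y != 0 -> tau (x * y) = tau x * tau y
    & exists m : nat, forall x, inp m.+1%:Z (x - 1) -> tau x = 1].
Definition quadratic (tau : F -> C) : Prop :=
  mult_char tau /\ forall x, x != 0 -> tau x ^+ 2 = 1.
Definition tamely_ramified (tau : F -> C) : Prop :=
  forall x, inp 1 (x - 1) -> tau x = 1.
Definition unramified (tau : F -> C) : Prop :=
  forall x, x != 0 -> v x = 0 -> tau x = 1.

(** ** Smooth representations of subgroups of GL_n(F) *)

Record grep (n : nat) := GRep {
  grep_space : lmodType C;
  gact : 'M[F]_n -> grep_space -> grep_space
}.

Definition is_linear (V W : lmodType C) (f : V -> W) : Prop :=
  forall (c : C) x y, f (c *: x + y) = c *: f x + f y.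

Definition GL n : set 'M[F]_n := [set g | g \in unitmx].

Definition smooth_rep n (G : set 'M[F]_n) (Pi : grep n) : Prop :=
  [/\ forall g, G g -> is_linear (gact (g := Pi) g),
      forall x : grep_space Pi, gact 1%:M x = x,
      forall g h (x : grep_space Pi), G g -> G h ->
        gact (g *m h) x = gact g (gact h x)
    & forall x : grep_space Pi, exists m : nat, forall k,
        G k -> congr_subgroup m.+1 k -> gact k x = x].

Definition irreducible_rep n (G : set 'M[F]_n) (Pi : grep n) : Prop :=
  (exists x : grep_space Pi, x != 0) /\
  forall x y : grep_space Pi, x != 0 -> exists s : seq (C * 'M[F]_n),
    (forall cg, cg \in s -> G cg.2) /\ y = \sum_(cg <- s) cg.1 *: gact cg.2 x.

(* Elements of the smooth dual. *)
Definition smooth_form n (G : set 'M[F]_n) (Pi : grep n)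
    (lam : grep_space Pi -> C^o) : Prop :=
  is_linear lam /\ exists m : nat, forall k x,
    G k -> congr_subgroup m.+1 k -> lam (gact k x) = lam x.

(* Irreducible, with matrix coefficients compactly supported modulo the
   centre. *)
Definition supercuspidal_GL n (Pi : grep n) : Prop :=
  [/\ smooth_rep (GL (n := n)) Pi, irreducible_rep (GL (n := n)) Pi
    & forall (x : grep_space Pi) lam, smooth_form (GL (n := n)) lam ->
      exists k : int, forall g, GL g -> lam (gact g x) != 0 ->
        exists a : F, [/\ a != 0, mx_inp k (a *: g)
                        & mx_inp k (invmx (a *: g))]].

(* The group G_(x, r+) of Moy and Prasad, for r >= 0 and a point x of the
   standard apartment of the building of GL_n. *)
Definition moy_prasad_plus n (x : 'I_n -> R) (r : R) : set 'M[F]_n :=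
  [set g | g \in unitmx /\ forall i j,
     (g - 1%:M) i j = 0 \/ r < (v ((g - 1%:M) i j))%:~R + x i - x j].

Definition has_fixed_vector n (Pi : grep n) (K : set 'M[F]_n) : Prop :=
  exists2 x : grep_space Pi, x != 0 & forall k, K k -> gact k x = x.

(* Every point of the building is a translate of a point of the standard
   apartment, so it is enough to consider the latter. *)
Definition has_depth n (Pi : grep n) (r : R) : Prop :=
  (exists x, has_fixed_vector Pi (moy_prasad_plus x r)) /\
  forall x r', 0 <= r' < r -> ~ has_fixed_vector Pi (moy_prasad_plus x r').

Definition simple_supercuspidal_GL n (Pi : grep n) : Prop :=
  supercuspidal_GL Pi /\ has_depth Pi (n%:R^-1).

Definition grep_iso n (G : set 'M[F]_n) (P1 P2 : grep n) : Prop :=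
  exists f : grep_space P1 -> grep_space P2,
    [/\ is_linear f, bijective f
      & forall g x, G g -> f (gact g x) = gact g (f x)].

(** ** Godement-Jacquet and Tate factors *)

Section GodementJacquet.
Variable psi : F -> C.

Definition schwartz n (Phi : 'M[F]_n -> C) : Prop :=
  exists k : int, (forall x y, mx_inp k y -> Phi (x + y) = Phi x) /\
                  (forall x, Phi x != 0 -> mx_inp (- k) x).

Definition is_fourier n (Phi Phi' : 'M[F]_n -> C) : Prop :=
  forall x, is_int (fun y => Phi y * psi (\tr (x *m y))) (Phi' x).

(* int_(GL_n) Phi(g) f(g) |det g|^(s + (n-1)/2) dg for q^(-s) = z *)
Definition is_gj_zeta n (m : nat) (Phi f : 'M[F]_n -> C) (z S : C) : Prop :=
  is_haar_int (GL (n := n)) (congr_subgroup m)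
    (fun g => Phi g * f g * (z / sqrtC q%:R ^+ n.-1) ^ v (\det g)) S.

(* Z(Phi^, 1 - s, f^v) = g(s) Z(Phi, s, f) for all Phi, with f^v(x) = f(x^-1) *)
Definition gj_equation n (f : 'M[F]_n -> C) (g : ratfun) : Prop :=
  forall Phi, schwartz Phi ->
  exists (Phi' : 'M[F]_n -> C) (m : nat) (Z Z' : ratfun),
    [/\ is_fourier Phi Phi',
        near0 (fun z => is_gj_zeta m.+1 Phi f z (rval Z z)),
        nearoo (fun z => is_gj_zeta m.+1 Phi' (fun x => f (invmx x))
                           (q%:R * z)^-1 (rval Z' z))
      & Z' = g * Z].

Definition gj_gamma n (Pi : grep n) (g : ratfun) : Prop :=
  forall (x : grep_space Pi) lam, smooth_form (GL (n := n)) lam ->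
    gj_equation (fun h => lam (gact h x)) g.

Definition tate_gamma (tau : F -> C) (g : ratfun) : Prop :=
  gj_equation (fun x : 'M[F]_1 => tau (x 0 0)) g.

(* [L] is L(s, tau) and [L'] is L(1 - s, tau^-1). *)
Definition tate_L (tau : F -> C) (L L' : ratfun) : Prop :=
  (unramified tau -> forall w, w != 0 -> v w = 1 ->
     L = (1 - cst (tau w) * Xs)^-1 /\
     L' = (1 - cst (tau w)^-1 * (cst q%:R * Xs)^-1)^-1) /\
  (~ unramified tau -> L = 1 /\ L' = 1).

Definition tate_epsilon (tau : F -> C) (e : ratfun) : Prop :=
  exists g L L', [/\ tate_gamma tau g, tate_L tau L L' & g = e * L' / L].

End GodementJacquet.

(** ** Matrices given by their entries, numbered from 1 *)

Definition ent m n (g : 'M[F]_(m, n)) (i j : nat) : F :=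
  match insub i.-1, insub j.-1 with
  | Some a, Some b => g a b
  | _, _ => 0
  end.
Definition mx1 n (f : nat -> nat -> F) : 'M[F]_n :=
  \matrix_(i < n, j < n) f i.+1 j.+1.
Definition mxs n (s : seq (seq F)) : 'M[F]_n :=
  \matrix_(i < n, j < n) nth 0 (nth [::] s i) j.

(** ** The group SO_(2l) and its simple supercuspidal representations *)

Section EvenOrthogonal.
Variable l : nat.

Definition Jmx n : 'M[F]_n := \matrix_(i < n, j < n) (i + j == n.-1)%N%:R.

Definition SOeven : set 'M[F]_(2 * l) :=
  [set g | \det g = 1 /\ g^T *m Jmx (2 * l) *m g = Jmx (2 * l)].
Definition Ueven : set 'M[F]_(2 * l) :=
  [set u | SOeven u /\ forall i j : 'I_(2 * l), (j <= i)%N -> u i j = (i == j)%:R].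
Definition iwahori_plus : set 'M[F]_(2 * l) :=
  [set g | SOeven g /\ forall i j : 'I_(2 * l),
     inp (j <= i)%N%:Z (g i j - (i == j)%:R)].

(* Uniformizer, unit, psi, omega(-I) and chi(g_chi). *)
Variables (w a : F) (psi : F -> C) (om sg : C).

Definition affine_generic (h : 'M[F]_(2 * l)) : C :=
  psi (\sum_(1 <= i < l) ent h i i.+1 + a * ent h l.-1 l.+1
       + w^-1 * ent h (2 * l).-1 1).

Definition g_chi : 'M[F]_(2 * l) := mx1 (2 * l) (fun i j =>
  if (i == 1)%N && (j == 2 * l)%N then - w^-1
  else if (i == 2 * l)%N && (j == 1)%N then - w
  else if (i == l) && (j == l.+1) then a^-1
  else if (i == l.+1) && (j == l) then a
  else if (i == j) && (i \notin [:: 1; l; l.+1; 2 * l]%N) then 1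
  else 0).

(* Compact induction from Z <g_chi> I^+: the functions on SO_(2l) (extended by
   0) that transform by chi on the left, are smooth on the right and have
   bounded, i.e. compact, support; Z = {I, -I} is finite. *)
Definition cind_space (f : 'M[F]_(2 * l) -> C) : Prop :=
  [/\ forall x, ~ SOeven x -> f x = 0,
      forall h x, iwahori_plus h -> SOeven x -> f (h *m x) = affine_generic h * f x,
      forall x, SOeven x -> f (g_chi *m x) = sg * f x /\ f (- x) = om * f x,
      exists m : nat, forall x k, SOeven x -> SOeven k ->
        congr_subgroup m.+1 k -> f (x *m k) = f x
    & exists k : int, forall x, f x != 0 -> mx_inp k x].

Definition simple_supercuspidal_SO (pi : grep (2 * l)) : Prop :=
  smooth_rep SOeven pi /\
  exists T : grep_space pi -> 'M[F]_(2 * l) -> C,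
    [/\ forall c x y h, T (c *: x + y) h = c * T x h + T y h,
        injective T,
        forall f, cind_space f <-> exists x, T x = f
      & forall g x h, SOeven g -> SOeven h -> T (gact g x) h = T x (h *m g)].

(** ** The gamma factors of SO_(2l) x GL_1 *)

Variable gam : F.

Definition psiU (u : 'M[F]_(2 * l)) : C :=
  psi (\sum_(1 <= i < l.-1) ent u i i.+1 + 4%:R^-1 * ent u l.-1 l
       - gam * ent u l.-1 l.+1).

(* The Whittaker model W(pi, psi^-1). *)
Definition whittaker (pi : grep (2 * l)) (W : 'M[F]_(2 * l) -> C) : Prop :=
  exists (Lam : grep_space pi -> C^o) (x : grep_space pi),
    [/\ is_linear Lam,
        forall u y, Ueven u -> Lam (gact u y) = (psiU u)^-1 * Lam y
      & forall g, W g = Lam (gact g x)].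

Definition J3 : 'M[F]_3 :=
  mxs 3 [:: [:: 0; 0; 1]; [:: 0; gam / 2%:R; 0]; [:: 1; 0; 0]].
Definition SO3 : set 'M[F]_3 := [set g | \det g = 1 /\ g^T *m J3 *m g = J3].
Definition SO3o : set 'M[F]_3 := [set g | SO3 g /\ mx_inp 0 g].
(* The upper triangular unipotent element of SO_3 with (1,2) entry x. *)
Definition u3 (x : F) : 'M[F]_3 :=
  mxs 3 [:: [:: 1; x; - x ^+ 2 / gam]; [:: 0; 1; - (2%:R * x) / gam]; [:: 0; 0; 1]].
Definition t3 (m : F) : 'M[F]_3 :=
  mxs 3 [:: [:: m; 0; 0]; [:: 0; 1; 0]; [:: 0; 0; m^-1]].
Definition w1 : 'M[F]_3 :=
  mxs 3 [:: [:: 0; 0; 1]; [:: 0; -1; 0]; [:: 1; 0; 0]].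

Definition Amx : 'M[F]_4 :=
  mxs 4 [:: [:: 1; 0; 0; 0]; [:: 0; 4%:R^-1; 4%:R^-1; 0];
            [:: 0; - gam; gam; 0]; [:: 0; 0; 0; 1]].
Definition sharp (x : 'M[F]_3) : 'M[F]_4 :=
  mxs 4 [:: [:: ent x 1 1; 0; ent x 1 2; ent x 1 3];
            [:: 0; 1; 0; 0];
            [:: ent x 2 1; 0; ent x 2 2; ent x 2 3];
            [:: ent x 3 1; 0; ent x 3 2; ent x 3 3]].
Definition embed (x : 'M[F]_3) : 'M[F]_(2 * l) :=
  let B := Amx *m sharp x *m invmx Amx in
  mx1 (2 * l) (fun i j =>
    if (l.-1 <= i <= l.+2)%N && (l.-1 <= j <= l.+2)%N
    then ent B (i - (l - 2)) (j - (l - 2)) else (i == j)%:R).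

(* The element of R^(l,1) with column r; r' is determined by r. *)
Definition Rl1 (r : 'cV[F]_(l - 2)) : 'M[F]_(2 * l) := mx1 (2 * l) (fun i j =>
  if i == j then 1
  else if (j == 1)%N && (2 <= i <= l.-1)%N then ent r i.-1 1
  else if (i == 2 * l)%N && (l.+2 <= j <= (2 * l).-1)%N
       then - ent r ((2 * l).+1 - j).-1 1
  else 0).
Definition wl1 : 'M[F]_(2 * l) := mx1 (2 * l) (fun i j =>
  ([|| (i == 1) && (j == l.-1), (2 <= i <= l.-1) && (j == i.-1),
       (l <= i <= l.+1) && (j == i), (l.+2 <= i <= (2 * l).-1) && (j == i.+1)
     | (i == 2 * l) && (j == l.+2)])%N%:R).

(* Sections f_s(h, a), as rational functions of q^(-s). *)
Definition sec := 'M[F]_3 -> F -> ratfun.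

(* Holomorphic sections of V(tau, s). *)
Definition holo_section (tau : F -> C) (f : sec) : Prop :=
  [/\ forall m b x g, m != 0 -> b != 0 -> SO3 g ->
        f (t3 m *m u3 x *m g) b = Xs ^ v m * cst (tau (b * m)) * f g 1,
      exists N : nat, forall g k b, b != 0 -> SO3 g -> SO3 k ->
        congr_subgroup N.+1 k -> f (g *m k) b = f g b
    & forall k, SO3o k -> exists (P : {poly C}) (N : nat),
        f k 1 = FracField.tofrac P / Xs ^+ N].

Definition is_M (f Mf : sec) : Prop :=
  near0 (fun z => forall h b, SO3 h -> b != 0 ->
    is_int (fun x : 'M[F]_1 => rval (f (w1 *m u3 (x 0 0) *m h) (- b^-1)) z)
           (rval (Mf h b) z)).

Definition is_jacquet (f : sec) (z S : C) : Prop :=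
  is_int (fun x : 'M[F]_1 =>
            rval (f (w1 *m u3 (x 0 0)) 1) z * (psi (x 0 0))^-1) S.

Definition is_C (tau : F -> C) (c : ratfun) : Prop :=
  forall f, holo_section tau f -> exists Mf J J',
    [/\ is_M f Mf,
        near0 (fun z => is_jacquet f z (rval J z)),
        nearoo (fun z => is_jacquet Mf z (rval J' z))
      & J = c * J'].

(* Invariant integral over U \ SO_3 in Iwasawa coordinates h = u t k, where the
   measure is |m|^-1 dm dk at t = diag(m, 1, m^-1); the Haar measure on SO_3
   gives volume 1 to its m-th congruence subgroup. *)
Definition is_int_quot (m : nat) (phi : 'M[F]_3 -> C) (S : C) : Prop :=
  [/\ forall x h, SO3 h -> phi (u3 x *m h) = phi h,
      forall h k, SO3 h -> SO3 k -> congr_subgroup m k -> phi (h *m k) = phi h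
    & exists (w : F) (D : set 'M[F]_3),
      [/\ w != 0 /\ v w = 1,
          left_transversal SO3o (SO3 `&` congr_subgroup (n := 3) m) D
        & has_sum [set x : int * 'M[F]_3 | D x.2]
            (fun x => phi (t3 (w ^ x.1) *m x.2) * q%:R ^ x.1) S]].

Definition is_Psi (m : nat) (W : 'M[F]_(2 * l) -> C) (f : sec) (z S : C) : Prop :=
  exists2 J : 'M[F]_3 -> C,
    forall h, SO3 h -> is_int (fun r => W (Rl1 r *m wl1 *m embed h)) (J h)
  & is_int_quot m (fun h => J h * rval (f h 1) z) S.

(* |x|^(2s-1) *)
Definition abs2s1 (x : F) : ratfun := (Xs ^+ 2 * cst q%:R) ^ v x.

(* [g] is gamma(s, pi x tau, psi). *)
Definition so_gamma (pi : grep (2 * l)) (tau : F -> C) (g : ratfun) : Prop :=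
  exists (c0 : C) (c : ratfun),
  [/\ forall x : grep_space pi, gact (- 1%:M) x = c0 *: x,
      is_C tau c
    & forall W f, whittaker pi W -> holo_section tau f ->
      exists (Mf : sec) (m : nat) (P P' : ratfun),
        [/\ is_M f Mf,
            near0 (fun z => is_Psi m.+1 W f z (rval P z)),
            nearoo (fun z => is_Psi m.+1 W (fun h b => c * Mf h b) z (rval P' z))
          & g * P = cst c0 * cst (tau (-1)) ^+ l * cst (tau 2%:R ^+ 2) * abs2s1 2%:R
                    * cst (tau gam ^- 2) * (abs2s1 gam)^-1 * P']].

End EvenOrthogonal.

(** ** The Weil group and the local Langlands correspondence *)

Section Weil.
Variables (Fb : closedFieldType) (iota : {rmorphism F -> Fb}).

(* sigma acts on the prime-to-p roots of unity, i.e. on the residue field of an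
   algebraic closure, as the (b - a)-th power of the Frobenius. *)
Definition frobenius_power (sigma : Fb -> Fb) (a b : nat) : Prop :=
  forall (m : nat) (x : Fb), (0 < m)%N -> coprime m (pf_p F) -> x ^+ m = 1 ->
    sigma x ^+ (q ^ a) = x ^+ (q ^ b).

Definition weil_group (sigma : Fb -> Fb) : Prop :=
  [/\ bijective sigma,
      (forall x y, sigma (x + y) = sigma x + sigma y),
      (forall x y, sigma (x * y) = sigma x * sigma y),
      (forall x, sigma (iota x) = iota x)
    & exists a b, frobenius_power sigma a b].

Definition wrep (n : nat) := (Fb -> Fb) -> 'M[C]_n.

(* The open subgroups of the Weil group are those containing the elements of
   inertia that fix some finite extension. *)
Definition weil_rep n (rho : wrep n) : Prop :=
  [/\ rho id = 1%:M,
      forall s t, weil_group s -> weil_group t -> rho (s \o t) = rho s *m rho t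
    & exists e : seq Fb, forall s, weil_group s -> frobenius_power s 0 0 ->
        (forall x, x \in e -> s x = x) -> rho s = 1%:M].

Definition irreducible_wrep n (rho : wrep n) : Prop :=
  (0 < n)%N /\ forall V : 'M[C]_n,
    (forall s, weil_group s -> (V *m rho s <= V)%MS) -> V = 0 \/ row_full V.

(* Stated for possibly different (hence provably equal) dimensions. *)
Definition wrep_iso m n (r1 : wrep m) (r2 : wrep n) : Prop :=
  exists (P : 'M[C]_(m, n)) (Q : 'M[C]_(n, m)),
    [/\ P *m Q = 1%:M, Q *m P = 1%:M
      & forall s, weil_group s -> r1 s *m P = P *m r2 s].

Definition wrep_sum m n (r1 : wrep m) (r2 : wrep n) : wrep (m + n) :=
  fun s => block_mx (r1 s) 0 0 (r2 s).

(* The character of the Weil group attached to a quadratic character tau of F^*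
   by class field theory: it cuts out the extension F(sqrt d) whose norm group
   is the kernel of tau. *)
Definition quadratic_cft (tau : F -> C) (eta : wrep 1) : Prop :=
  exists (d : F) (e : Fb),
    [/\ d != 0, e ^+ 2 = iota d,
        forall b, b != 0 ->
          (tau b = 1 <-> exists x y, b = x ^+ 2 - d * y ^+ 2)
      & forall s, weil_group s -> eta s = (if s e == e then 1 else -1)%:M].

(* The local Langlands correspondences, given with the gamma factors of the
   Weil group representations (Langlands, Deligne).  Only Langlands parameters
   that are trivial on SL_2 are involved. *)
Record local_langlands (psi : F -> C) := LocalLanglands {
  galois_gamma : forall n, wrep n -> ratfun;
  galois_gamma_iso : forall m n (r1 : wrep m) (r2 : wrep n),
    weil_rep r1 -> weil_rep r2 -> wrep_iso r1 r2 ->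
    galois_gamma r1 = galois_gamma r2;
  galois_gamma_sum : forall m n (r1 : wrep m) (r2 : wrep n),
    weil_rep r1 -> weil_rep r2 ->
    galois_gamma (wrep_sum r1 r2) = galois_gamma r1 * galois_gamma r2;
  galois_gamma_cft : forall tau (eta : wrep 1), quadratic tau ->
    quadratic_cft tau eta -> tate_gamma psi tau (galois_gamma eta);

  llc_GL : forall n, wrep n -> grep n -> Prop;
  llc_GL_dom : forall n (rho : wrep n) (Pi : grep n), llc_GL rho Pi ->
    [/\ weil_rep rho, irreducible_wrep rho & supercuspidal_GL Pi];
  llc_GL_total : forall n (rho : wrep n), weil_rep rho -> irreducible_wrep rho ->
    exists Pi, llc_GL rho Pi;
  llc_GL_onto : forall n (Pi : grep n), (0 < n)%N -> supercuspidal_GL Pi ->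
    exists rho, llc_GL rho Pi;
  llc_GL_bij : forall n (r1 r2 : wrep n) (P1 P2 : grep n),
    llc_GL r1 P1 -> llc_GL r2 P2 ->
    (wrep_iso r1 r2 <-> grep_iso (GL (n := n)) P1 P2);
  llc_GL_gamma : forall n (rho : wrep n) (Pi : grep n), llc_GL rho Pi ->
    gj_gamma psi Pi (galois_gamma rho);

  llc_SO : forall l, grep (2 * l) -> wrep (2 * l) -> Prop;
  llc_SO_orthogonal : forall l (pi : grep (2 * l)) (phi : wrep (2 * l)),
    llc_SO pi phi -> weil_rep phi /\
    exists2 S : 'M[C]_(2 * l), S^T = S /\ S \in unitmx &
      forall s, weil_group s ->
        \det (phi s) = 1 /\ (phi s)^T *m S *m phi s = S;
  llc_SO_gamma : forall l (w a : F) (om sg : C) (pi : grep (2 * l)) phi,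
    pf_p F != 2%N -> (2 <= l)%N -> w != 0 -> v w = 1 -> a != 0 -> v a = 0 ->
    om ^+ 2 = 1 -> sg ^+ 2 = 1 ->
    simple_supercuspidal_SO w a psi om sg pi -> llc_SO pi phi ->
    so_gamma psi (- (4%:R * a)) pi (fun=> 1) (galois_gamma phi)
}.

End Weil.
End Local.

Arguments Xs {R}.
Arguments cst {R} c.

(* Main.v *)
(** The equation defining gamma(s, pi x 1, psi) is evaluated on one pair (W, f_s).
    The compactly induced representation contains a function f0 supported on
    Z <g_chi> I^+; conjugation by a diagonal element turns chi into the inverse of
    the Whittaker character on integral unipotent matrices, so the Jacquet integral
    of a translate of f0 is a Whittaker function W.  Seen on SO_3, W is invariant
    under the pro-unipotent Iwahori subgroup, it is multiplied by chi(g_chi) under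
    the element of SO_3 conjugate to g_chi, and it vanishes on the torus outside
    1 + p.  For the spherical section f_s the integral Psi(W, f_s) is therefore a
    nonzero multiple of 1 + chi(g_chi) q^s, and M^* f_s is the spherical section at
    1 - s times a factor found by comparing Jacquet integrals of a translate of f_s.
    With sg = chi(g_chi) and om = pi(-1) this gives

      gamma(s, pi, psi) (1 + sg q^s) (q^(1-s) - q^(s-1))
        = om (q^s - q^(-s)) (1 + sg q^(1-s)),

    while gamma(s, phi, psi) = gamma(s, tau_1, psi) eps delta q^(1/2-s), where
    gamma(s, tau_1, psi) is the explicit Tate factor of an unramified character;
    comparing the two yields eps delta = om sg.

    For l = 2 the element g_chi does not stabilise chi, so the induced space is 0
    and every rational function is a factor gamma(s, pi x tau, psi); this contradicts
    the hypothesis on poles for the unramified tau with tau(varpi) = - sg. *)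

Require Import Defs.
From HB Require Import structures.
From mathcomp Require Import all_boot all_order all_algebra.
From mathcomp Require Import boolp classical_sets reals.
From mathcomp Require Import complex perm.
From mathcomp Require Import zify ring.

Set Implicit Arguments.
Unset Strict Implicit.
Unset Printing Implicit Defensive.

Import Order.TTheory GRing.Theory Num.Theory.
Local Open Scope ring_scope.

(** * Unconditional sums *)

Section Sums.
Variable R : realType.
Local Notation C := R[i].

(** Convergence and continuation of the nontrivial zeta integrals and integrals Psi are never
    proved: the equations that define the factors supply them, so each integral only has to be
    evaluated. Values are pinned down by uniqueness of unconditional sums, by translation
    invariance, and because a rational function is determined near z = 0 or near infinity. One
    obstacle is that [galois_gamma] is known only through the fields of [local_langlands]. Comparing
    it with the given [delta] and [eps] requires uniqueness of Godement-Jacquet factors, hence a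
    smooth linear form that does not vanish at a given vector of the abstract representation [Pi'];
    Zorn's lemma provides it. On the orthogonal side everything is read in the filtration at the
    barycentre of the alcove: I^+ is its first step, chi is trivial on the second, and for l >= 3
    the pro-unipotent Iwahori subgroup of SO_3 lands in the second step, whence the invariance of W.
    A translate of the spherical section is used for the local coefficient because psi has level 1:
    the spherical section itself has Jacquet integral 0. *)

Lemma has_sum_unique (T : eqType) (D : set T) (f : T -> C) (S S' : C) :
  has_sum D f S -> has_sum D f S' -> S = S'.
Proof.
move=> h1 h2; apply/eqP; rewrite -subr_eq0 -normr_eq0; apply/negPn/negP => hne.
have e0 : 0 < `|S - S'| / 2%:R :> C.
  by rewrite divr_gt0 ?ltr0n // lt_neqAle eq_sym hne normr_ge0.
have [s0 [D0 H0]] := h1 _ e0; have [s1 [D1 H1]] := h2 _ e0.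
pose s := undup (s0 ++ s1).
have us : uniq s by apply: undup_uniq.
have Ds x : x \in s -> D x.
  by rewrite mem_undup mem_cat => /orP[/D0|/D1].
have a0 : `|\sum_(x <- s) f x - S| < `|S - S'| / 2%:R.
  by apply: H0 => // x xs; rewrite mem_undup mem_cat xs.
have a1 : `|\sum_(x <- s) f x - S'| < `|S - S'| / 2%:R.
  by apply: H1 => // x xs; rewrite mem_undup mem_cat xs orbT.
have : `|S - S'| < `|S - S'| :> C.
  have -> : S - S' = - (\sum_(x <- s) f x - S) + (\sum_(x <- s) f x - S') by ring.
  apply: le_lt_trans (ler_normD _ _) _; rewrite normrN.
  have -> : `|- (\sum_(x <- s) f x - S) + (\sum_(x <- s) f x - S')| =
     `|S - S'| / 2%:R + `|S - S'| / 2%:R :> C.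
    have -> : - (\sum_(x <- s) f x - S) + (\sum_(x <- s) f x - S') = S - S' by ring.
    by field.
  exact: ltrD.
by rewrite ltxx.
Qed.

Lemma has_sum_ext (T : eqType) (D : set T) (f g : T -> C) (S : C) :
  (forall x, D x -> f x = g x) -> has_sum D f S -> has_sum D g S.
Proof.
move=> fg hS e e0; have [s0 [D0 H0]] := hS e e0; exists s0; split=> // s us ss Ds.
rewrite (_ : \sum_(x <- s) g x = \sum_(x <- s) f x); first exact: H0.
by rewrite big_seq [RHS]big_seq; apply: eq_bigr => x /Ds /fg.
Qed.

Lemma has_sumD (T : eqType) (D : set T) (f g : T -> C) (S S' : C) :
  has_sum D f S -> has_sum D g S' -> has_sum D (fun x => f x + g x) (S + S').
Proof.
move=> h1 h2 e e0; have e2 : 0 < e / 2%:R by rewrite divr_gt0 ?ltr0n.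
have [s0 [D0 H0]] := h1 _ e2; have [s1 [D1 H1]] := h2 _ e2.
exists (s0 ++ s1); split=> [x|s us ss Ds]; first by rewrite mem_cat => /orP[/D0|/D1].
have a0 : `|\sum_(x <- s) f x - S| < e / 2%:R.
  by apply: H0 => // x xs; rewrite ss // mem_cat xs.
have a1 : `|\sum_(x <- s) g x - S'| < e / 2%:R.
  by apply: H1 => // x xs; rewrite ss // mem_cat xs orbT.
rewrite big_split /=.
have -> : \sum_(x <- s) f x + \sum_(x <- s) g x - (S + S') =
  (\sum_(x <- s) f x - S) + (\sum_(x <- s) g x - S') by ring.
apply: le_lt_trans (ler_normD _ _) _.
by rewrite (_ : e = e / 2%:R + e / 2%:R); [exact: ltrD | field].
Qed.

Lemma has_sum0 (T : eqType) (D : set T) : has_sum D (fun=> 0 : C) 0.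
Proof.
move=> e e0; exists [::]; split=> // s _ _ _.
by rewrite big1 // subrr normr0.
Qed.

Lemma has_sumZ (T : eqType) (D : set T) (f : T -> C) (a S : C) :
  has_sum D f S -> has_sum D (fun x => a * f x) (a * S).
Proof.
have [->|a0] := eqVneq a 0.
  move=> _; rewrite mul0r; apply: has_sum_ext (@has_sum0 T D) => x _.
  by rewrite mul0r.
move=> hS e e0; have ea : 0 < e / `|a| by rewrite divr_gt0 // normr_gt0.
have [s0 [D0 H0]] := hS _ ea; exists s0; split=> // s us ss Ds.
have := H0 s us ss Ds.
by rewrite -mulr_sumr -mulrBr normrM ltr_pdivlMr ?normr_gt0 // mulrC.
Qed.

Lemma has_sum_fin (T : eqType) (D : set T) (f : T -> C) (s : seq T) :
  uniq s -> (forall x, x \in s -> D x) ->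
  (forall x, D x -> x \notin s -> f x = 0) ->
  has_sum D f (\sum_(x <- s) f x).
Proof.
move=> us sD f0 e e0; exists s; split=> // s' us' ss' Ds'.
suff -> : \sum_(x <- s') f x = \sum_(x <- s) f x by rewrite subrr normr0.
rewrite (bigID (mem s)) /= [X in _ + X]big_seq_cond [X in _ + X]big1 ?addr0.
  rewrite -big_filter; apply: perm_big.
  apply: uniq_perm; rewrite ?filter_uniq // => x; rewrite mem_filter /=.
  by apply/andP/idP => [[]//|xs]; split=> //; apply: ss'.
by move=> x /andP[/Ds' Dx xs]; apply: f0.
Qed.

(* Sort the terms over D' by their rank in the fibre: a finite subset of D' is
   then a disjoint union of N finite subsets of D. *)
Lemma has_sum_fiber (T T' : eqType) (D : set T) (D' : set T') (f : T -> C)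
    (f' : T' -> C) (N : nat) (p : T' -> T) (fib : T -> seq T') (S : C) :
  (forall x, D' x -> [/\ D (p x), x \in fib (p x) & f' x = f (p x)]) ->
  (forall d, D d -> [/\ uniq (fib d), size (fib d) = N
     & forall x, x \in fib d -> D' x /\ p x = d]) ->
  has_sum D f S -> has_sum D' f' (N%:R * S).
Proof.
move=> hp hfib hS e e0.
have [N0|N0] := posnP N.
  exists [::]; split=> // s us ss Ds; have -> : s = [::].
    case: s {us ss} Ds => [//|x s] Ds; have [/hfib[_ s0 _] xin _] := hp _ (Ds x (mem_head _ _)); move: xin.
    by rewrite (size0nil (etrans s0 N0)).
  by rewrite big_nil N0 mul0r subr0 normr0.
have Npos : 0 < N%:R :> C by rewrite ltr0n.
have eN : 0 < e / N%:R by rewrite divr_gt0.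
have [s0 [D0 H0]] := hS _ eN.
exists (flatten [seq fib d | d <- s0]); split=> [x /flatten_mapP[d ds xd]|s us ss Ds].
  by have [_ _ /(_ _ xd)[]] := hfib d (D0 _ ds).
pose j x := index x (fib (p x)).
have jN x : x \in s -> (j x < N)%N.
  by move=> /Ds /hp[dx xin _]; have [_ <- _] := hfib _ dx; rewrite index_mem.
have part : \sum_(x <- s) f' x =
    \sum_(i < N) \sum_(d <- [seq p x | x <- s & j x == i]) f d.
  transitivity (\sum_(x <- s) \sum_(i < N | j x == i) f' x).
    rewrite big_seq [RHS]big_seq; apply: eq_bigr => x xs.
    by rewrite (big_pred1 (Ordinal (jN x xs))).
  rewrite (exchange_big_dep predT) //=; apply: eq_bigr => i _.
  rewrite big_map big_filter big_seq_cond [RHS]big_seq_cond.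
  by apply: eq_bigr => x /andP[/Ds /hp[]].
have each (i : 'I_N) :
   `|\sum_(d <- [seq p x | x <- s & j x == i]) f d - S| < e / N%:R.
  apply: H0.
  - rewrite map_inj_in_uniq ?filter_uniq // => x y.
    rewrite !mem_filter => /andP[/eqP jx xs] /andP[/eqP jy ys] pxy.
    have [_ xin _] := hp _ (Ds _ xs); have [_ yin _] := hp _ (Ds _ ys).
    by rewrite -(nth_index x xin) -/(j x) jx -jy /j -pxy nth_index // pxy.
  - move=> d ds; have [uf sf hf] := hfib d (D0 _ ds).
    have isz : (i < size (fib d))%N by rewrite sf.
    case E : (fib d) isz => [//|x0 fd] isz; rewrite -E in isz.
    pose x := nth x0 (fib d) i.
    have xin : x \in fib d by apply: mem_nth.
    have [_ pxd] := hf _ xin.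
    apply/mapP; exists x => //; rewrite mem_filter; apply/andP; split.
      by rewrite /j pxd /x index_uniq.
    by apply: ss; apply/flatten_mapP; exists d.
  - by move=> _ /mapP[x xs ->]; move: xs; rewrite mem_filter => /andP[_ /Ds /hp[]].
rewrite part (_ : N%:R * S = \sum_(i < N) S); last first.
  by rewrite sumr_const card_ord mulr_natl.
rewrite -sumrB; apply: le_lt_trans (ler_norm_sum _ _ _) _.
rewrite (_ : e = \sum_(i < N) e / N%:R); last first.
  by rewrite sumr_const card_ord -[RHS]mulr_natr divfK // lt0r_neq0.
apply: ltr_sum => //; apply/hasP; exists (Ordinal N0) => //.
Qed.

Lemma has_sum_bij (T T' : eqType) (D : set T) (D' : set T') (f : T -> C)
    (f' : T' -> C) (p : T' -> T) (r : T -> T') (S : C) :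
  (forall x, D' x -> [/\ D (p x), r (p x) = x & f' x = f (p x)]) ->
  (forall d, D d -> D' (r d) /\ p (r d) = d) ->
  has_sum D f S -> has_sum D' f' S.
Proof.
move=> h1 h2 hS; rewrite -[S]mul1r -[1]/1%:R.
apply: (has_sum_fiber (p := p) (fib := fun d => [:: r d])) hS.
  by move=> x /h1[? rx ?]; split=> //; rewrite rx inE.
by move=> d /h2[? ?]; split=> // x; rewrite inE => /eqP ->.
Qed.

(** A finite partial sum that contains [x0] is at least 1, so it cannot come within 1 of 0. This is
    how volumes are seen to be nonzero. *)
Lemma has_sum_ind_neq0 (T : eqType) (D : set T) (f : T -> C) (S : C) (x0 : T) :
  has_sum D f S -> (forall x, D x -> f x = 0 \/ f x = 1) -> D x0 -> f x0 = 1 ->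
  S != 0.
Proof.
move=> hS f01 Dx0 fx0; apply/eqP => S0.
have [s0 [D0 H0]] := hS 1 ltr01.
pose s := undup (x0 :: s0).
have Ds x : x \in s -> D x by rewrite mem_undup inE => /orP[/eqP ->|/D0].
have : `|\sum_(x <- s) f x - S| < 1.
  by apply: H0 => [|x xs|//]; rewrite ?undup_uniq // mem_undup inE xs orbT.
rewrite S0 subr0.
have fge x : x \in s -> 0 <= f x by move=> /Ds /f01[] ->.
have x0s : x0 \in s by rewrite mem_undup inE eqxx.
rewrite ger0_norm; last by rewrite big_seq; apply: sumr_ge0 => x; exact: fge.
rewrite (bigD1_seq x0) ?undup_uniq //= fx0 => h.
have : 1 < 1 :> C.
  apply: le_lt_trans h; rewrite lerDl big_seq_cond sumr_ge0 // => x /andP[/fge//].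
by rewrite ltxx.
Qed.

End Sums.

(** * Valuations, lattices and integrals over spaces of matrices *)

Section Valuation.
Variable F : padic_field.
Local Notation v := (@pf_val F).
Local Notation q := (pf_q F).
Implicit Types (x y : F) (j k : int).

Lemma inpE k x : x != 0 -> inp k x <-> k <= v x.
Proof. by move=> x0; split=> [[/eqP|//]|]; [rewrite (negbTE x0)|right]. Qed.

Lemma inp0 k : inp k (0 : F). Proof. by left. Qed.

Lemma inp_le j k x : j <= k -> inp k x -> inp j x.
Proof. by move=> jk [->|kx]; [left|right; apply: le_trans kx]. Qed.

Lemma inpD k x y : inp k x -> inp k y -> inp k (x + y).
Proof. exact: pf_valD. Qed.

Lemma inpM j k x y : inp j x -> inp k y -> inp (j + k) (x * y).
Proof.
have [->|x0] := eqVneq x 0; first by rewrite mul0r => *; exact: inp0.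
have [->|y0] := eqVneq y 0; first by rewrite mulr0 => *; exact: inp0.
move=> /inpE-/(_ x0) jx /inpE-/(_ y0) ky; right.
by rewrite pf_valM // lerD.
Qed.

Lemma val_one : v 1 = 0.
Proof. have := pf_valM (oner_neq0 F) (oner_neq0 F); rewrite mulr1 => /eqP.
by rewrite -[X in X == _]addr0 (inj_eq (addrI _)) eq_sym => /eqP. Qed.

Lemma valN1 : v (-1) = 0.
Proof.
have h : (-1 : F) != 0 by rewrite oppr_eq0 oner_neq0.
by have := pf_valM h h; rewrite mulrNN mulr1 val_one; lia.
Qed.

Lemma valN x : v (- x) = v x.
Proof.
have [->|x0] := eqVneq x 0; first by rewrite oppr0.
have h : (-1 : F) != 0 by rewrite oppr_eq0 oner_neq0.
by rewrite -mulN1r pf_valM // valN1 add0r.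
Qed.

Lemma valV x : x != 0 -> v x^-1 = - v x.
Proof.
move=> x0; have h : x^-1 != 0 by rewrite invr_eq0.
by have := pf_valM x0 h; rewrite divff // val_one; lia.
Qed.

Lemma val_div x y : x != 0 -> y != 0 -> v (x / y) = v x - v y.
Proof. by move=> x0 y0; rewrite pf_valM ?invr_eq0 // valV. Qed.

Lemma valX x n : x != 0 -> v (x ^+ n) = v x *+ n.
Proof.
move=> x0; elim: n => [|n IH]; first by rewrite expr0 val_one.
by rewrite exprS pf_valM ?expf_neq0 // IH mulrS.
Qed.

Lemma valXz x k : x != 0 -> v (x ^ k) = v x * k.
Proof.
move=> x0; case: k => n; first by rewrite -exprnP valX // -mulr_natr natz.
rewrite NegzE -exprnN valV ?expf_neq0 // valX //.
by rewrite -mulr_natr natz mulrN.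
Qed.

Lemma inpN k x : inp k x -> inp k (- x).
Proof. by move=> [->|h]; [rewrite oppr0; left|right; rewrite valN]. Qed.

Lemma inpB k x y : inp k x -> inp k y -> inp k (x - y).
Proof. by move=> hx hy; apply: inpD => //; apply: inpN. Qed.

Lemma inp01 : inp 0 (1 : F). Proof. by right; rewrite val_one. Qed.

Lemma inp_not1 : ~ inp 1 (1 : F).
Proof. by move=> /inpE-/(_ (oner_neq0 _)); rewrite val_one. Qed.

Lemma inp_sum (I : Type) (r : seq I) (P : pred I) (f : I -> F) k :
  (forall i, P i -> inp k (f i)) -> inp k (\sum_(i <- r | P i) f i).
Proof. move=> h; elim/big_ind: _ => //; [exact: inp0|by move=> *; apply: inpD]. Qed.

Lemma inp_nat n : inp 0 (n%:R : F).
Proof.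
elim: n => [|n IH]; first exact: inp0.
by rewrite mulrS; apply: inpD => //; apply: inp01.
Qed.

Lemma inp_pM k x y : inp 0 x -> inp k y -> inp k (x * y).
Proof. by move=> h1 h2; have := inpM h1 h2; rewrite add0r. Qed.

Lemma inp_Mp k x y : inp k x -> inp 0 y -> inp k (x * y).
Proof. by move=> h1 h2; have := inpM h1 h2; rewrite addr0. Qed.

Lemma val_addl x y : x != 0 -> inp (v x + 1) y -> x + y != 0 /\ v (x + y) = v x.
Proof.
move=> x0 hy.
have hx : ~ inp (v x + 1) x by move=> /inpE-/(_ x0); lia.
have hxy : ~ inp (v x + 1) (x + y).
  by move=> h; apply: hx; have := inpB h hy; rewrite addrK.
have xy0 : x + y != 0 by apply/eqP => h; apply: hxy; rewrite h; apply: inp0.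
split=> //; have h1 : v x <= v (x + y).
  apply/(inpE _ xy0)/inpD; first by right.
  by apply: inp_le hy; lia.
by apply/eqP; rewrite eq_le h1 andbT leNgt; apply/negP => h; apply: hxy; right; lia.
Qed.

Lemma val_1p x : inp 1 (x - 1) -> x != 0 /\ v x = 0.
Proof.
move=> h; have := @val_addl 1 (x - 1) (oner_neq0 _).
by rewrite val_one (_ : 1 + (x - 1) = x); [apply|ring].
Qed.

Lemma pf_q_gt0 : (0 < q)%N.
Proof.
have [d [_ /(_ 0 (inp0 0))[i _]]] := pf_residue F.
exact: leq_ltn_trans (ltn_ord i).
Qed.

(** If 2 lay in the maximal ideal, then so would 1 = p - 2 (p - 1)/2, because p is odd and lies in
    that ideal. *)
Lemma val2 : pf_p F != 2%N -> v 2%:R = 0.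
Proof.
move=> p2; have h0 : (2%:R : F) != 0 by exact: pf_char0.
have : 0 <= v 2%:R by apply/(inpE _ h0)/inp_nat.
rewrite le_eqVlt => /orP[/eqP <- //|h].
have h2 : inp 1 (2%:R : F) by right.
have podd : odd (pf_p F).
  by have [/eqP|//] := even_prime (pf_prime F); rewrite (negbTE p2).
exfalso; apply: inp_not1.
have e : (pf_p F)%:R = 1 + 2%:R * (pf_p F)./2%:R :> F.
  by rewrite -[in LHS](odd_double_half (pf_p F)) podd -muln2 natrD natrM mulrC.
have -> : (1 : F) = (pf_p F)%:R - 2%:R * (pf_p F)./2%:R by rewrite e; ring.
apply: inpB; first exact: pf_residue_char.
by apply: inp_Mp => //; apply: inp_nat.
Qed.

Lemma val4 : pf_p F != 2%N -> v 4%:R = 0.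
Proof.
move=> p2; have h0 : (2%:R : F) != 0 by exact: pf_char0.
by rewrite (_ : 4%:R = 2%:R * 2%:R :> F) ?pf_valM ?val2 // -natrM.
Qed.

End Valuation.

(** * Lattices of matrices, their transversals and the self-dual integral *)

Section Lattice.
Variable F : padic_field.
Local Notation v := (@pf_val F).
Local Notation q := (pf_q F).

Lemma mx_inp0 m n k : mx_inp k (0 : 'M[F]_(m, n)).
Proof. by move=> i j; rewrite mxE; apply: inp0. Qed.

Lemma mx_inpD m n k (x y : 'M[F]_(m, n)) : mx_inp k x -> mx_inp k y -> mx_inp k (x + y).
Proof. by move=> hx hy i j; rewrite mxE; apply: inpD. Qed.

Lemma mx_inpN m n k (x : 'M[F]_(m, n)) : mx_inp k x -> mx_inp k (- x).
Proof. by move=> hx i j; rewrite mxE; apply: inpN. Qed.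

Lemma mx_inpB m n k (x y : 'M[F]_(m, n)) : mx_inp k x -> mx_inp k y -> mx_inp k (x - y).
Proof. by move=> hx hy; apply: mx_inpD => //; apply: mx_inpN. Qed.

Lemma mx_inp_le m n j k (x : 'M[F]_(m, n)) : j <= k -> mx_inp k x -> mx_inp j x.
Proof. by move=> jk hx a b; apply: inp_le (hx a b). Qed.

Lemma mx_inpM m n p j k (x : 'M[F]_(m, n)) (y : 'M[F]_(n, p)) :
  mx_inp j x -> mx_inp k y -> mx_inp (j + k) (x *m y).
Proof. by move=> hx hy a b; rewrite mxE; apply: inp_sum => i _; apply: inpM. Qed.

Lemma mx_inpZ m n j k (a : F) (x : 'M[F]_(m, n)) :
  inp j a -> mx_inp k x -> mx_inp (j + k) (a *: x).
Proof. by move=> ha hx i l; rewrite mxE; apply: inpM. Qed.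

Lemma mx_inp_subC m n k (x y : 'M[F]_(m, n)) : mx_inp k (x - y) -> mx_inp k (y - x).
Proof. by move=> /mx_inpN; rewrite opprB. Qed.

Lemma mx_inp_trans m n k (x y z : 'M[F]_(m, n)) :
  mx_inp k (x - y) -> mx_inp k (y - z) -> mx_inp k (x - z).
Proof.
by move=> h1 h2; have := mx_inpD h1 h2; rewrite addrA subrK.
Qed.

Lemma mx_inp1 n : mx_inp 0 (1%:M : 'M[F]_n).
Proof.
move=> i j; rewrite mxE; case: eqP => _; first exact: inp01.
by rewrite mulr0n; apply: inp0.
Qed.

Definition lat_transversal m n k (D : set 'M[F]_(m, n)) :=
  forall x, exists! d, D d /\ mx_inp k (x - d).

Definition lat_inv (T : Type) m n k (f : 'M[F]_(m, n) -> T) :=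
  forall x y, mx_inp k y -> f (x + y) = f x.

Lemma lat_inv_eq T m n k (f : 'M[F]_(m, n) -> T) x y :
  lat_inv k f -> mx_inp k (x - y) -> f x = f y.
Proof. by move=> hf h; rewrite -(hf y _ h) addrC subrK. Qed.

(* The representative [xget x] of a coset depends only on the coset. *)
Lemma lat_transversal_exists m n k : exists D, @lat_transversal m n k D.
Proof.
pose r (x : 'M[F]_(m, n)) := xget x [set d | mx_inp k (x - d)]%classic.
have hr x : mx_inp k (x - r x).
  by rewrite /r; apply: (@xgetPex _ x [set d | mx_inp k (x - d)]%classic); exists x; rewrite /= subrr; apply: mx_inp0.
have re x y : mx_inp k (x - y) -> r x = r y.
  move=> h; rewrite /r; set A := [set d | mx_inp k (x - d)]%classic.
  have -> : [set d | mx_inp k (y - d)]%classic = A.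
    apply/seteqP; split=> d /=; apply: mx_inp_trans => //; exact: mx_inp_subC.
  have [z Az] : exists z, A z by exists x; rewrite /A /= subrr; apply: mx_inp0.
  by rewrite /xget; case: pselect => //= h'; exfalso; apply: h'; exists z; apply/asboolP.
exists [set d | r d = d]%classic => x; exists (r x); split=> [|y [/= ry xy]].
  by split=> //=; apply: esym; apply: re.
by rewrite -ry; apply: re.
Qed.

Lemma lat_transversal_rep m n k (D : set 'M[F]_(m, n)) : lat_transversal k D ->
  exists r : 'M[F]_(m, n) -> 'M[F]_(m, n),
    [/\ forall x, D (r x), forall x, mx_inp k (x - r x)
      & forall x d, D d -> mx_inp k (x - d) -> r x = d].
Proof.
move=> h; have /boolp.choice[r hr] : forall x, exists d, D d /\ mx_inp k (x - d).
  by move=> x; have [d [? _]] := h x; exists d.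
exists r; split=> [x|x|x d Dd xd]; try by have [] := hr x.
by have [d' [_ u]] := h x; rewrite -(u _ (hr x)); apply: u.
Qed.

(** Residue digits multiplied by the k-th power of a uniformizer, entry by entry. Indexing the
    representatives by matrices over ['I_q] makes the index q^(m n) of consecutive lattices a
    cardinality of a finite type. *)
Lemma lat_digits m n k : exists s : 'M['I_q]_(m, n) -> 'M[F]_(m, n),
  [/\ forall t, mx_inp k (s t),
      forall x, mx_inp k x -> exists t, mx_inp (k + 1) (x - s t)
    & forall t u, mx_inp (k + 1) (s t - s u) -> t = u].
Proof.
have [w w0 vw] := pf_valn F.
have [dl [dl0 dlu]] := pf_residue F.
have wk0 : w ^ k != 0 by rewrite expfz_neq0.
have vwk : v (w ^ k) = k by rewrite valXz // vw mul1r.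
pose s (t : 'M['I_q]_(m, n)) : 'M[F]_(m, n) := \matrix_(i, j) (w ^ k * dl (t i j)).
have sk t : mx_inp k (s t).
  by move=> i j; rewrite mxE; apply: inp_Mp; [right; rewrite vwk|exact: dl0].
exists s; split=> // [x xk|t u h].
  have ex i j : exists a, inp (k + 1) (x i j - w ^ k * dl a).
    have h : inp 0 ((w ^ k)^-1 * x i j).
      have -> : (0 : int) = - k + k by lia.
      by apply: inpM; [right; rewrite valV // vwk|exact: xk].
    have [a [ha _]] := dlu _ h; exists a.
    have -> : x i j - w ^ k * dl a = w ^ k * ((w ^ k)^-1 * x i j - dl a) by field.
    by apply: inpM => //; right; rewrite vwk.
  have /boolp.choice[t0 ht0] : forall ij : 'I_m * 'I_n, exists a,
      inp (k + 1) (x ij.1 ij.2 - w ^ k * dl a) by move=> [i j]; exact: ex.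
  exists (\matrix_(i, j) t0 (i, j)) => i j.
  by have := ht0 (i, j); rewrite !mxE.
apply/matrixP => i j.
have h1 : inp 1 (dl (t i j) - dl (u i j)).
  have -> : dl (t i j) - dl (u i j) = (w ^ k)^-1 * ((s t - s u) i j).
    by rewrite !mxE; field.
  have -> : (1 : int) = - k + (k + 1) by lia.
  by apply: inpM; [right; rewrite valV // vwk|exact: h].
have [a [_ hu]] := dlu _ (dl0 (t i j)).
by rewrite -(hu (t i j)) ?subrr; [apply: hu|apply: inp0].
Qed.

Lemma bounded_reps m n k (N : nat) : exists E : seq 'M[F]_(m, n),
  forall x, mx_inp k x -> exists2 e, e \in E & mx_inp (k + N%:Z) (x - e).
Proof.
elim: N => [|N [E IH]].
  exists [:: 0] => x xk; exists 0; first exact: mem_head.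
  by move=> i j; rewrite !mxE oppr0 !addr0.
have [s [_ s2 _]] := @lat_digits m n (k + N%:Z).
exists [seq e + s t | e <- E, t <- enum 'M['I_q]_(m, n)] => x /IH[e eE /s2[t ht]].
exists (e + s t); first by apply: allpairs_f; rewrite ?mem_enum.
by rewrite opprD addrA (_ : k + N.+1%:Z = k + N%:Z + 1) //; lia.
Qed.

(** This is the form in which compactness enters: a bounded set meets only finitely many cosets of
    any lattice, so a function that is constant on these cosets takes finitely many values. *)
Lemma finite_image (T : eqType) m n k M (A : set 'M[F]_(m, n)) (r : 'M[F]_(m, n) -> T) :
  (forall x, A x -> mx_inp k x) ->
  (forall x y, A x -> A y -> mx_inp M (x - y) -> r x = r y) ->
  exists2 Q : seq T, uniq Q & forall y, y \in Q <-> exists2 x, A x & r x = y.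
Proof.
move=> Ak rM; pose N := `|M - k|%N.
have MN : M <= k + N%:Z by rewrite /N; lia.
have [E hE] := @bounded_reps m n k N.
pose B e : set 'M[F]_(m, n) := [set x | A x /\ mx_inp (k + N%:Z) (x - e)]%classic.
pose pk e := xget 0 (B e).
exists (undup [seq r (pk e) | e <- E & `[< exists x, B e x >]]); first exact: undup_uniq.
move=> y; rewrite mem_undup; split.
  move=> /mapP[e]; rewrite mem_filter => /andP[/asboolP ex _] ->.
  by exists (pk e) => //; have [] := xgetPex 0 ex.
move=> [x Ax <-]; have [e eE xe] := hE x (Ak x Ax).
have Bx : B e x by [].
have [Ap pe] : B e (pk e) by apply: xgetPex; exists x.
apply/mapP; exists e.
  by rewrite mem_filter eE andbT; apply/asboolP; exists x.
apply: rM => //; apply: mx_inp_le MN _; apply: mx_inp_trans xe _; exact: mx_inp_subC.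
Qed.

Variable R : realType.
Local Notation C := R[i].

Definition vol m n (k : int) : C := (sqrtC q%:R / q%:R ^ k) ^+ (m * n).

Lemma q_neq0 : q%:R != 0 :> C.
Proof. by rewrite pnatr_eq0 -lt0n pf_q_gt0. Qed.

Lemma sqrtq_neq0 : sqrtC q%:R != 0 :> C.
Proof. by rewrite sqrtC_eq0 q_neq0. Qed.

Lemma vol_neq0 m n k : vol m n k != 0.
Proof. by rewrite expf_neq0 // mulf_neq0 ?sqrtq_neq0 // invr_eq0 expfz_neq0 ?q_neq0. Qed.

Lemma volS m n k : vol m n k = q%:R ^+ (m * n) * vol m n (k + 1).
Proof.
rewrite /vol -exprMn; congr (_ ^+ _); rewrite expfzDr ?q_neq0 // expr1z.
by rewrite invfM; field; rewrite q_neq0 /= expfz_neq0 ?q_neq0.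
Qed.

(** Each coset of the larger lattice splits into q^(m n) cosets of the smaller one, on all of which
    f has the same value. *)
Lemma int_step m n k (D D' : set 'M[F]_(m, n)) (f : 'M[F]_(m, n) -> C) S :
  lat_transversal k D -> lat_transversal (k + 1) D' -> lat_inv k f ->
  has_sum D f S -> has_sum D' f (q%:R ^+ (m * n) * S).
Proof.
move=> /lat_transversal_rep[r [rD rk ru]] /lat_transversal_rep[r' [rD' rk' ru']] fk.
have [s [sk s2 s3]] := @lat_digits m n k.
have kk1 : k <= k + 1 by lia.
have rk'k x : mx_inp k (x - r' x) by apply: mx_inp_le (rk' x).
rewrite -natrX.
apply: (has_sum_fiber (p := r) (fib := fun d => [seq r' (d + s t) | t <- enum 'M['I_q]_(m, n)])).
- move=> x D'x; split=> //; last exact: (lat_inv_eq fk).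
  have [t ht] := s2 _ (rk x).
  apply/mapP; exists t; first by rewrite mem_enum.
  by apply: esym; apply: ru' => //; apply: mx_inp_subC; rewrite opprD addrA.
- move=> d Dd; split; last 2 first.
  + by rewrite size_map -cardE card_mx card_ord.
  + move=> _ /mapP[t _ ->]; split=> //; apply: ru => //.
    have := mx_inpD (sk t) (mx_inpN (rk'k (d + s t))).
    by congr (mx_inp _ _); apply/matrixP => i j; rewrite !mxE; ring.
  rewrite map_inj_uniq ?enum_uniq // => t u e; apply: s3.
  have := mx_inpB (rk' (d + s t)) (rk' (d + s u)); rewrite e.
  by congr (mx_inp _ _); apply/matrixP => i j; rewrite !mxE; ring.
Qed.

(** [is_int] exhibits a single lattice and a single transversal. Freeing the choice allows two
    integrals to be compared, or added, over a common lattice. *)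
Lemma int_refine m n (f : 'M[F]_(m, n) -> C) S : is_int f S ->
  exists k0, forall k, k0 <= k -> lat_inv k f /\
    forall D, lat_transversal k D -> has_sum D f (S / vol m n k).
Proof.
move=> [k0 [D0 [S0 [fk tD hS ->]]]]; exists k0.
suff H (N : nat) : lat_inv (k0 + N%:Z) f /\ forall D, lat_transversal (k0 + N%:Z) D ->
    has_sum D f ((sqrtC q%:R / q%:R ^ k0) ^+ (m * n) * S0 / vol m n (k0 + N%:Z)).
  move=> k kk0; have -> : k = k0 + (`|k - k0|%N)%:Z by lia.
  exact: H.
have inv N' : lat_inv (k0 + N'%:Z) f.
  by move=> x y hy; apply: fk; apply: mx_inp_le hy; lia.
split=> //.
elim: N => [|N IH] D tDn.
  rewrite addr0 in tDn *; rewrite -/(vol m n k0) mulrC mulKf ?vol_neq0 //.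
  have [r [rD rk ru]] := lat_transversal_rep tDn.
  have [r' [rD' rk' ru']] := lat_transversal_rep tD.
  apply: (has_sum_bij (p := r') (r := r)) hS => [x Dx|d Dd].
    split=> //; last exact: (lat_inv_eq fk).
    by apply: ru => //; apply: mx_inp_subC.
  by split=> //; apply: ru' => //; apply: mx_inp_subC.
have [D1 tD1] := @lat_transversal_exists m n (k0 + N%:Z).
have e1 : k0 + N.+1%:Z = k0 + N%:Z + 1 by lia.
rewrite e1 in tDn *.
have := int_step tD1 tDn (inv N) (IH _ tD1).
congr has_sum; rewrite (volS m n (k0 + N%:Z)).
set A := _ * S0; rewrite invfM mulrCA mulrA -mulrA mulVKf //.
by rewrite expf_neq0 // q_neq0.
Qed.

Lemma is_int_intro m n (f : 'M[F]_(m, n) -> C) S k D : lat_inv k f ->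
  lat_transversal k D -> has_sum D f (S / vol m n k) -> is_int f S.
Proof.
move=> fk tD hS; exists k, D, (S / vol m n k); split=> //.
by rewrite -/(vol m n k) mulrCA divff ?mulr1 // vol_neq0.
Qed.

Lemma is_int_unique m n (f : 'M[F]_(m, n) -> C) S S' :
  is_int f S -> is_int f S' -> S = S'.
Proof.
move=> /int_refine[k0 h0] /int_refine[k1 h1]; pose k := Num.max k0 k1.
have [D tD] := @lat_transversal_exists m n k.
have [|_ /(_ _ tD) a] := h0 k; first by rewrite /k le_max lexx.
have [|_ /(_ _ tD) b] := h1 k; first by rewrite /k le_max lexx orbT.
have := has_sum_unique a b; apply: mulIf.
by rewrite invr_eq0 vol_neq0.
Qed.

Lemma is_int_ext m n (f g : 'M[F]_(m, n) -> C) S :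
  (forall x, f x = g x) -> is_int f S -> is_int g S.
Proof. by move=> fg; rewrite (_ : g = f) //; apply: funext => x; rewrite fg. Qed.

Lemma is_intD m n (f g : 'M[F]_(m, n) -> C) S S' :
  is_int f S -> is_int g S' -> is_int (fun x => f x + g x) (S + S').
Proof.
move=> /int_refine[k0 h0] /int_refine[k1 h1]; pose k := Num.max k0 k1.
have [D tD] := @lat_transversal_exists m n k.
have [|fk /(_ _ tD) a] := h0 k; first by rewrite /k le_max lexx.
have [|gk /(_ _ tD) b] := h1 k; first by rewrite /k le_max lexx orbT.
apply: (is_int_intro (k := k) _ tD); last by rewrite mulrDl; apply: has_sumD.
by move=> x y hy; rewrite fk // gk.
Qed.

Lemma is_intZ m n (f : 'M[F]_(m, n) -> C) S a :
  is_int f S -> is_int (fun x => a * f x) (a * S).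
Proof.
move=> /int_refine[k h0]; have [fk H] := h0 k (lexx _).
have [D tD] := @lat_transversal_exists m n k.
apply: (is_int_intro (k := k) _ tD); last by rewrite -mulrA; apply: has_sumZ; apply: H.
by move=> x y hy; rewrite fk.
Qed.

Lemma is_intB m n (f g : 'M[F]_(m, n) -> C) S S' :
  is_int f S -> is_int g S' -> is_int (fun x => f x - g x) (S - S').
Proof.
move=> h1 /(is_intZ (-1)) h2; rewrite -mulN1r.
by apply: is_int_ext (is_intD h1 h2) => x; rewrite mulN1r.
Qed.

Lemma is_int_translate m n (f : 'M[F]_(m, n) -> C) S y :
  is_int f S -> is_int (fun x => f (x + y)) S.
Proof.
move=> /int_refine[k h0]; have [fk H] := h0 k (lexx _).
have [D tD] := @lat_transversal_exists m n k.
pose D' := [set x | D (x + y)]%classic.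
apply: (is_int_intro (k := k) (D := D')).
- by move=> x z hz; rewrite /= (addrAC x z y); exact: fk.
- move=> x; have [d [[Dd xd] u]] := tD (x + y); exists (d - y); split=> [|d' [D'd' xd']].
    by split; rewrite /D' /= ?subrK // opprB addrA.
  rewrite (u (d' + y)) ?addrK //; split=> //.
  by rewrite opprD addrACA subrr addr0.
- apply: (has_sum_bij (p := fun x => x + y) (r := fun x => x - y)) (H _ tD).
    by move=> x Dx; rewrite addrK.
  by move=> d Dd; rewrite /D' /= subrK.
Qed.

(** Translation invariance gives S = c S. Oscillating integrals vanish by this argument without any
    estimate. *)
Lemma is_int_eigen m n (f : 'M[F]_(m, n) -> C) S y c :
  (forall x, f (x + y) = c * f x) -> c != 1 -> is_int f S -> S = 0.
Proof.
move=> fc c1 h.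
have /eqP := is_int_unique (is_int_ext fc (is_int_translate y h)) (is_intZ c h).
by rewrite -subr_eq0 -{1}[S]mul1r -mulrBl mulf_eq0 subr_eq0 eq_sym (negbTE c1) => /eqP.
Qed.

(** The substitution x -> a x multiplies the integral by |a|^(-1) for every coordinate, and |a|^(-1)
    = q^(v a). *)
Lemma is_int_dilate m n (f : 'M[F]_(m, n) -> C) S (a : F) : a != 0 ->
  is_int f S -> is_int (fun x => f (a *: x)) ((q%:R ^ v a) ^+ (m * n) * S).
Proof.
move=> a0 /int_refine[k h0]; have [fk H] := h0 k (lexx _).
have [D tD] := @lat_transversal_exists m n k.
pose D' := [set x | D (a *: x)]%classic.
have sc (x : 'M[F]_(m, n)) : mx_inp (k - v a) x <-> mx_inp k (a *: x).
  split=> h.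
    by rewrite [k](_ : _ = v a + (k - v a)); [apply: mx_inpZ => //; right|lia].
  rewrite -[x](scalerK a0) [k - _](_ : _ = - v a + k); last by lia.
  by apply: mx_inpZ => //; right; rewrite valV.
apply: (is_int_intro (k := k - v a) (D := D')).
- by move=> x z /sc hz; rewrite scalerDr fk.
- move=> x; have [d [[Dd xd] u]] := tD (a *: x); exists (a^-1 *: d); split=> [|d' [D'd' xd']].
    by split; rewrite /D' /= ?scalerKV //; apply/sc; rewrite scalerBr scalerKV.
  by rewrite (u (a *: d')) ?scalerK //; split=> //; rewrite -scalerBr; apply/sc.
- have -> : (q%:R ^ v a) ^+ (m * n) * S / vol m n (k - v a) = S / vol m n k.
    rewrite /vol expfzDr ?q_neq0 // -invr_expz.
    rewrite invfM invrK mulrA exprMn invfM mulrACA mulrC -!mulrA; congr (_ * _).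
    rewrite mulKf //.
    by rewrite expf_neq0 // expfz_neq0 ?q_neq0.
  apply: (has_sum_bij (p := fun x => a *: x) (r := fun x => a^-1 *: x)) (H _ tD).
    by move=> x Dx; rewrite scalerK.
  by move=> d Dd; rewrite /D' /= scalerKV.
Qed.

Lemma is_int_lattice m n k :
  is_int (fun x : 'M[F]_(m, n) => if `[< mx_inp k x >] then 1 else 0) (vol m n k).
Proof.
have [D tD] := @lat_transversal_exists m n k.
apply: (is_int_intro (k := k) _ tD).
  move=> x y hy; rewrite (_ : `[< mx_inp k (x + y) >] = `[< mx_inp k x >]) //.
  apply/asbool_equiv_eq; split=> h; last exact: mx_inpD.
  by rewrite -(addrK y x); apply: mx_inpB.
rewrite divff ?vol_neq0 //.
have [d [[Dd]]] := tD 0; rewrite sub0r => /mx_inpN; rewrite opprK => hd u.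
rewrite [X in has_sum _ _ X](_ : 1 = \sum_(x <- [:: d]) (if `[< mx_inp k x >] then 1 else 0)).
  apply: has_sum_fin => // x; first by rewrite inE => /eqP ->.
  move=> Dx; rewrite inE => xd; case: asboolP => // hx.
  by rewrite (u x) ?eqxx // in xd; split=> //; rewrite sub0r; apply: mx_inpN.
by rewrite big_seq1; case: asboolP.
Qed.

End Lattice.

(** * Rational functions of q^(-s) *)

Lemma inv_uniq_r (K : fieldType) (a b : K) : a * b = 1 -> b = a^-1.
Proof.
move=> e; have a0 : a != 0.
  by apply: contra_eq_neq e => ->; rewrite mul0r eq_sym oner_neq0.
by apply: (mulfI a0); rewrite e divff.
Qed.

Lemma frac_eqP (K : fieldType) (a b c d : K) :
  b != 0 -> d != 0 -> a / b = c / d -> a * d = c * b.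
Proof. by move=> b0 d0 /eqP; rewrite eqr_div // => /eqP. Qed.

Lemma eq_fracP (K : fieldType) (a b c d : K) :
  b != 0 -> d != 0 -> a * d = c * b -> a / b = c / d.
Proof. by move=> b0 d0 /eqP e; apply/eqP; rewrite eqr_div. Qed.

Section RationalFunctions.
Variable R : realType.
Local Notation C := R[i].
Local Notation "P %:F" := (FracField.tofrac P).
Implicit Types (g h : ratfun R) (z w : C) (P Q : {poly C}).

(** The only place where the quotient construction of the fraction field is opened; everything else
    goes through a numerator and a denominator. *)
Lemma ratfunP g : exists P Q, Q != 0 /\ g = P%:F / Q%:F.
Proof.
elim/quotW: g => x; exists x.1, x.2; split; first exact: denom_ratioP.
have d0 : x.2%:F != 0 :> ratfun R by rewrite tofrac_eq0 denom_ratioP.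
apply: (mulIf d0); rewrite mulfVK //; unlock FracField.tofrac.
rewrite -[LHS]FracField.pi_mul; apply/eqmodP; rewrite /= FracField.equivfE /FracField.mulf.
by rewrite !numden_Ratio ?oner_neq0 ?mulr1 ?denom_ratioP ?mulf_neq0 ?denom_ratioP ?oner_neq0 // mulrC.
Qed.

Lemma rf_at_frac P Q z : Q.[z] != 0 -> rf_at (P%:F / Q%:F) z (P.[z] / Q.[z]).
Proof. by exists P, Q. Qed.

Lemma poly_neq0 Q z : Q.[z] != 0 -> Q != 0.
Proof. by apply: contraNneq => ->; rewrite horner0. Qed.

Lemma frac_cross P Q P' Q' : Q != 0 -> Q' != 0 ->
  P%:F / Q%:F = P'%:F / Q'%:F :> ratfun R -> P * Q' = P' * Q.
Proof.
move=> Q0 Q0' e; apply/eqP; rewrite -tofrac_eq !rmorphM /=; apply/eqP.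
have q0 : Q%:F != 0 :> ratfun R by rewrite tofrac_eq0.
have q0' : Q'%:F != 0 :> ratfun R by rewrite tofrac_eq0.
exact: (frac_eqP q0 q0' e).
Qed.

Lemma rf_at_unique g z w w' : rf_at g z w -> rf_at g z w' -> w = w'.
Proof.
move=> [P [Q [Q0 -> ->]]] [P' [Q' [Q0' e ->]]].
have := congr1 (horner^~ z) (frac_cross (poly_neq0 Q0) (poly_neq0 Q0') e).
rewrite !hornerM => e'; apply: (mulIf Q0); rewrite divfK //.
by apply: (mulIf Q0'); rewrite e' mulrAC divfK.
Qed.

Lemma rvalE g z w : rf_at g z w -> rval g z = w.
Proof.
by move=> h; apply: xget_unique => // y hy; apply: rf_at_unique hy h.
Qed.

Lemma rf_atD g h z w w' : rf_at g z w -> rf_at h z w' -> rf_at (g + h) z (w + w').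
Proof.
move=> [P [Q [Q0 -> ->]]] [P' [Q' [Q0' -> ->]]].
exists (P * Q' + P' * Q), (Q * Q'); split.
- by rewrite hornerM mulf_neq0.
- by rewrite rmorphD !rmorphM /= addf_div // tofrac_eq0; apply: poly_neq0; eassumption.
- by rewrite hornerD !hornerM addf_div.
Qed.

Lemma rf_atM g h z w w' : rf_at g z w -> rf_at h z w' -> rf_at (g * h) z (w * w').
Proof.
move=> [P [Q [Q0 -> ->]]] [P' [Q' [Q0' -> ->]]].
exists (P * P'), (Q * Q'); split.
- by rewrite hornerM mulf_neq0.
- by rewrite !rmorphM /= mulf_div.
- by rewrite !hornerM mulf_div.
Qed.

Lemma rf_atV g z w : w != 0 -> rf_at g z w -> rf_at g^-1 z w^-1.
Proof.
move=> w0 [P [Q [Q0 -> e]]]; exists Q, P.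
have P0 : P.[z] != 0 by apply: contraNneq w0 => p0; rewrite e p0 mul0r.
by split; rewrite ?invf_div // e invf_div.
Qed.

Lemma rf_at_cst c z : rf_at (cst c) z c.
Proof.
by exists c%:P, 1; rewrite !hornerC oner_neq0 rmorph1 !invr1 !mulr1.
Qed.

Lemma rf_at_X z : rf_at Xs z z.
Proof.
by exists 'X, 1; rewrite hornerC hornerX oner_neq0 rmorph1 !invr1 !mulr1.
Qed.

Lemma rf_at1 z : rf_at 1 z 1.
Proof. by have := rf_at_cst 1 z; rewrite /cst !rmorph1. Qed.

Lemma Xs_neq0 : Xs != 0 :> ratfun R.
Proof. by rewrite tofrac_eq0 polyX_eq0. Qed.

Lemma cst_neq0 c : c != 0 -> cst c != 0 :> ratfun R.
Proof. by move=> c0; rewrite tofrac_eq0 polyC_eq0. Qed.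

Lemma cstM (c d : C) : cst (c * d) = cst c * cst d :> ratfun R.
Proof. by rewrite /cst !rmorphM. Qed.

Lemma cstN (c : C) : cst (- c) = - cst c :> ratfun R.
Proof. by rewrite /cst !rmorphN. Qed.

Lemma cst1 : cst 1 = 1 :> ratfun R.
Proof. by rewrite /cst !rmorph1. Qed.

Lemma cstV (c : C) : cst c^-1 = (cst c)^-1 :> ratfun R.
Proof.
have [->|c0] := eqVneq c 0; first by rewrite invr0 /cst !rmorph0 invr0.
by apply: inv_uniq_r; rewrite -cstM divff // cst1.
Qed.

Lemma cstX (c : C) n : cst (c ^+ n) = cst c ^+ n :> ratfun R.
Proof. by rewrite /cst !rmorphXn. Qed.

Lemma cst_inj : injective (@cst R).
Proof. by move=> c d /eqP; rewrite tofrac_eq => /eqP /polyC_inj. Qed.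

Lemma rf_atN g z w : rf_at g z w -> rf_at (- g) z (- w).
Proof.
move=> h; have := rf_atM (rf_at_cst (-1) z) h.
by rewrite cstN cst1 !mulN1r.
Qed.

Lemma rf_atB g h z w w' : rf_at g z w -> rf_at h z w' -> rf_at (g - h) z (w - w').
Proof. by move=> hg hh; apply: rf_atD => //; apply: rf_atN. Qed.

Lemma rf_atX g z w n : rf_at g z w -> rf_at (g ^+ n) z (w ^+ n).
Proof.
move=> h; elim: n => [|n IH]; first by rewrite !expr0; apply: rf_at1.
by rewrite !exprS; apply: rf_atM.
Qed.

Lemma rf_atXz g z w (n : int) : w != 0 -> rf_at g z w -> rf_at (g ^ n) z (w ^ n).
Proof.
move=> w0 h; case: n => n; first exact: rf_atX.
by rewrite !NegzE -!exprnN; apply: rf_atV; [rewrite expf_neq0|apply: rf_atX].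
Qed.

(** * Values near z = 0 and near infinity *)

Section Near.

Lemma near0_and (A B : C -> Prop) :
  near0 A -> near0 B -> near0 (fun z => A z /\ B z).
Proof.
move=> [r r0 hr] [t t0 ht]; exists (Num.min r t).
  by rewrite /Order.min; case: ifP.
move=> z /andP[z0 zr]; suff /andP[h1 h2] : (`|z| < r) && (`|z| < t).
  by split; [apply: hr|apply: ht]; rewrite z0.
by rewrite -comparable_lt_min ?zr // real_comparable // gtr0_real.
Qed.

Lemma nearoo_and (A B : C -> Prop) :
  nearoo A -> nearoo B -> nearoo (fun z => A z /\ B z).
Proof.
move=> [r r0 hr] [t t0 ht]; exists (Num.max r t).
  by rewrite /Order.max; case: ifP.
move=> z zr; suff /andP[h1 h2] : (r < `|z|) && (t < `|z|).
  by split; [apply: hr|apply: ht].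
by rewrite -comparable_gt_max ?zr // real_comparable // gtr0_real.
Qed.

Lemma near0_mono (A B : C -> Prop) :
  (forall z, z != 0 -> A z -> B z) -> near0 A -> near0 B.
Proof.
move=> AB [r r0 hr]; exists r => // z /andP[z0 zr]; apply: AB.
  by rewrite -normr_gt0.
by apply: hr; rewrite z0.
Qed.

Lemma nearoo_mono (A B : C -> Prop) :
  (forall z, z != 0 -> A z -> B z) -> nearoo A -> nearoo B.
Proof.
move=> AB [r r0 hr]; exists r => // z zr; apply: AB; last exact: hr.
by rewrite -normr_gt0; apply: lt_trans zr.
Qed.

Lemma near0_ex (A : C -> Prop) : near0 A -> exists z, A z.
Proof.
move=> [r r0 hr]; exists (r / 2%:R); apply: hr.
have h : 0 < r / 2%:R by rewrite divr_gt0 // ltr0n.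
rewrite (ger0_norm (ltW h)) h /= ltr_pdivrMr ?ltr0n // mulr_natr.
by rewrite mulr2n ltrDl.
Qed.

Lemma nearoo_ex (A : C -> Prop) : nearoo A -> exists z, A z.
Proof.
move=> [r r0 hr]; exists (r + 1); apply: hr.
have h : 0 < r + 1 by rewrite addr_gt0.
by rewrite (ger0_norm (ltW h)) ltrDl.
Qed.

(** The finitely many roots are avoided both on a small punctured disc around 0 and outside a large
    disc. *)
Lemma poly_near P : P != 0 -> near0 (fun z => P.[z] != 0) /\ nearoo (fun z => P.[z] != 0).
Proof.
have [rs e] := closed_field_poly_normal P => P0.
have {e} -> : near0 (fun z => P.[z] != 0) /\ nearoo (fun z => P.[z] != 0) <->
    near0 (fun z => z \notin rs) /\ nearoo (fun z => z \notin rs).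
  suff h z : (P.[z] != 0) = (z \notin rs).
    rewrite (_ : (fun z => is_true (P.[z] != 0)) = (fun z => is_true (z \notin rs))) //.
    by apply: funext => z; rewrite h.
  rewrite e hornerZ mulf_eq0 lead_coef_eq0 (negbTE P0) /= -/(root _ z).
  by rewrite root_prod_XsubC.
elim: rs => [|r rs [IH1 IH2]]; first by split; [exists 1|exists 1]; rewrite ?ltr01.
split.
  suff h : near0 (fun z => z != r).
    by apply: near0_mono (near0_and h IH1) => z _ [h1 h2]; rewrite inE negb_or h1.
  have [->|r0] := eqVneq r 0.
    by exists 1 => // z /andP[z0 _]; rewrite -normr_gt0.
  exists `|r|; first by rewrite normr_gt0.
  by move=> z /andP[_]; apply: contraTneq => ->; rewrite ltxx.
suff h : nearoo (fun z => z != r).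
  by apply: nearoo_mono (nearoo_and h IH2) => z _ [h1 h2]; rewrite inE negb_or h1.
exists (`|r| + 1); first by rewrite ltr_wpDl.
by move=> z; apply: contraTneq => ->; rewrite -[X in _ < X]addr0 ltrD2l ltr10.
Qed.

Lemma rf_near g : near0 (fun z => rf_at g z (rval g z)) /\
  nearoo (fun z => rf_at g z (rval g z)).
Proof.
have [P [Q [Q0 ->]]] := ratfunP g; have [h1 h2] := poly_near Q0.
by split; [apply: near0_mono h1|apply: nearoo_mono h2] => z _ hz;
  rewrite (rvalE (rf_at_frac P hz)); apply: rf_at_frac.
Qed.

(** The substitute for analytic continuation: integrals at s are known only for small |z|, those at
    1 - s only for large |z|, and either region determines a rational function. *)
Lemma ratfun_eq0_near g :
  near0 (fun z => rf_at g z 0) \/ nearoo (fun z => rf_at g z 0) -> g = 0.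
Proof.
have [P [Q [Q0 ->]]] := ratfunP g; move=> H.
suff P0 : P = 0 by rewrite P0 rmorph0 mul0r.
apply/eqP; apply/negPn/negP => P0.
have [a1 a2] := poly_near P0; have [b1 b2] := poly_near Q0.
suff [z [[hP hQ] hz]] : exists z, (P.[z] != 0 /\ Q.[z] != 0) /\ rf_at (P%:F / Q%:F) z 0.
  have := rf_at_unique hz (rf_at_frac P hQ) => /esym/eqP.
  by rewrite mulf_eq0 invr_eq0 (negbTE hP) (negbTE hQ).
case: H => H.
  exact: near0_ex (near0_and (near0_and a1 b1) H).
exact: nearoo_ex (nearoo_and (nearoo_and a2 b2) H).
Qed.

Lemma ratfun_eq_near g h :
  near0 (fun z => rval g z = rval h z) \/ nearoo (fun z => rval g z = rval h z) ->
  g = h.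
Proof.
move=> H; apply/eqP; rewrite -subr_eq0; apply/eqP/ratfun_eq0_near.
have [g1 g2] := rf_near g; have [h1 h2] := rf_near h.
have key z : rval g z = rval h z -> rf_at g z (rval g z) -> rf_at h z (rval h z) ->
    rf_at (g - h) z 0.
  move=> e a b; rewrite [X in rf_at _ _ X](_ : 0 = rval g z + -1 * rval h z).
    by apply: rf_atD => //; rewrite (_ : - h = cst (-1) * h); [apply: rf_atM => //; apply: rf_at_cst|rewrite cstN cst1 mulN1r].
  by rewrite e mulN1r subrr.
case: H => H; [left|right].
  by apply: near0_mono (near0_and (near0_and g1 h1) H) => z _ [[? ?] ?]; apply: key.
by apply: nearoo_mono (nearoo_and (nearoo_and g2 h2) H) => z _ [[? ?] ?]; apply: key.
Qed.

Lemma ratfun_eq0 g h :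
  near0 (fun z => exists2 w, rf_at g z w & rf_at h z w) -> g = h.
Proof.
move=> H; apply: ratfun_eq_near; left; apply: near0_mono H => z _ [w /rvalE -> /rvalE ->].
by [].
Qed.

Lemma ratfun_eqoo g h :
  nearoo (fun z => exists2 w, rf_at g z w & rf_at h z w) -> g = h.
Proof.
move=> H; apply: ratfun_eq_near; right; apply: nearoo_mono H => z _ [w /rvalE -> /rvalE ->].
by [].
Qed.

End Near.

(** ** The substitution X -> zeta X for zeta = 1 or -1 *)

Section Dilate.
Variable zeta : C.
Hypothesis zeta2 : zeta ^+ 2 = 1.
Local Notation sb P := (P \Po (zeta *: 'X)).

Lemma dilate_polyK P : sb (sb P) = P.
Proof.
by rewrite -comp_polyA comp_polyZ comp_polyX scalerA -expr2 zeta2 scale1r comp_polyXr.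
Qed.

Lemma dilate_poly_neq0 Q : Q != 0 -> sb Q != 0.
Proof. by apply: contraNneq => e; rewrite -(dilate_polyK Q) e comp_poly0. Qed.

(** The automorphism g(X) -> g(zeta X), picked by [xget] among all fractions that represent g. With
    X = q^(-s) and zeta = 1 or -1 it reflects the twist by the unramified character zeta^v. *)
Definition dilate g : ratfun R := xget 0 [set h | exists P Q,
  [/\ Q != 0, g = P%:F / Q%:F & h = (sb P)%:F / (sb Q)%:F]]%classic.

Lemma dilateE P Q : Q != 0 -> dilate (P%:F / Q%:F) = (sb P)%:F / (sb Q)%:F.
Proof.
move=> Q0; apply: xget_unique; first by exists P, Q.
move=> _ [P' [Q' [Q0' e ->]]].
have h : (sb Q)%:F != 0 :> ratfun R by rewrite tofrac_eq0 dilate_poly_neq0.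
have h' : (sb Q')%:F != 0 :> ratfun R by rewrite tofrac_eq0 dilate_poly_neq0.
apply: (eq_fracP h' h); rewrite -!rmorphM /=.
by rewrite (frac_cross Q0 Q0' e).
Qed.

Lemma dilateM g h : dilate (g * h) = dilate g * dilate h.
Proof.
have [P [Q [Q0 ->]]] := ratfunP g; have [P' [Q' [Q0' ->]]] := ratfunP h.
rewrite mulf_div -!rmorphM /= !dilateE ?mulf_neq0 // !comp_polyM !rmorphM /=.
by rewrite mulf_div.
Qed.

Lemma dilateK g : dilate (dilate g) = g.
Proof.
have [P [Q [Q0 ->]]] := ratfunP g.
by rewrite !dilateE ?dilate_poly_neq0 // !dilate_polyK.
Qed.

Lemma dilate_poly P : dilate P%:F = (sb P)%:F.
Proof.
have := dilateE P (oner_neq0 _); rewrite comp_polyC rmorph1 invr1 !mulr1.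
exact.
Qed.

Lemma dilate_cst c : dilate (cst c) = cst c.
Proof. by rewrite /cst dilate_poly comp_polyC. Qed.

Lemma dilate_X : dilate Xs = cst zeta * Xs.
Proof. by rewrite /Xs /cst dilate_poly comp_polyX -mul_polyC rmorphM. Qed.

Lemma dilate1 : dilate 1 = 1.
Proof. by rewrite -cst1 dilate_cst. Qed.

Lemma dilateV g : dilate g^-1 = (dilate g)^-1.
Proof.
have [->|g0] := eqVneq g 0.
  by rewrite invr0 (_ : 0 = cst 0) ?dilate_cst ?/cst ?rmorph0 ?invr0.
have d0 : dilate g != 0.
  apply: contraNneq g0 => e; rewrite -(dilateK g) e.
  by rewrite (_ : 0 = cst 0) ?dilate_cst // /cst !rmorph0.
apply: inv_uniq_r; rewrite -dilateM (divff g0); exact: dilate1.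
Qed.

Lemma dilateX g n : dilate (g ^+ n) = dilate g ^+ n.
Proof.
by elim: n => [|n IH]; rewrite ?expr0 ?dilate1 // !exprS dilateM IH.
Qed.

Lemma dilateXz g (n : int) : dilate (g ^ n) = dilate g ^ n.
Proof.
case: n => n; first exact: dilateX.
by rewrite !NegzE -!exprnN dilateV dilateX.
Qed.

Lemma rf_at_dilate g z w : rf_at g (zeta * z) w -> rf_at (dilate g) z w.
Proof.
move=> [P [Q [Q0 -> ->]]]; rewrite dilateE ?(poly_neq0 Q0) //.
have e S : (sb S).[z] = S.[zeta * z] by rewrite horner_comp hornerZ hornerX.
by exists (sb P), (sb Q); rewrite !e.
Qed.

Lemma rval_dilate g z : rval (dilate g) z = rval g (zeta * z).
Proof.
rewrite /rval; congr xget; apply/seteqP; split=> w /=; last exact: rf_at_dilate.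
move=> h; rewrite -(dilateK g); apply: rf_at_dilate.
by rewrite mulrA -expr2 zeta2 mul1r.
Qed.

Lemma norm_dilate z : `|zeta * z| = `|z|.
Proof.
suff e : `|zeta| = 1 by rewrite normrM e mul1r.
apply/eqP; rewrite -(@eqrXn2 _ 2) // ?normr_ge0 ?ler01 //.
by rewrite -normrX zeta2 normr1 expr1n.
Qed.

Lemma near0_dilate (A : C -> Prop) : near0 A -> near0 (fun z => A (zeta * z)).
Proof. by move=> [r r0 h]; exists r => // z hz; apply: h; rewrite norm_dilate. Qed.

Lemma nearoo_dilate (A : C -> Prop) : nearoo A -> nearoo (fun z => A (zeta * z)).
Proof. by move=> [r r0 h]; exists r => // z hz; apply: h; rewrite norm_dilate. Qed.

End Dilate.
End RationalFunctions.

(** * Haar integrals on matrix groups *)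

Section MatrixGroups.
Variable F : padic_field.
Local Notation v := (@pf_val F).

Record mx_group n (G : set 'M[F]_n) : Prop := MxGroup {
  mxg_unit : forall g, G g -> g \in unitmx;
  mxg_1 : G 1%:M;
  mxg_M : forall g h, G g -> G h -> G (g *m h);
  mxg_V : forall g, G g -> G (invmx g)
}.

Lemma invmxM n (g h : 'M[F]_n) : g \in unitmx -> h \in unitmx ->
  invmx (g *m h) = invmx h *m invmx g.
Proof.
move=> gu hu; have ghu : g *m h \in unitmx by rewrite unitmx_mul gu.
by apply: (can_inj (mulKmx ghu)); rewrite mulmxV // mulmxA mulmxK // mulmxV.
Qed.

Lemma mx_groupI n (G H : set 'M[F]_n) : mx_group G -> mx_group H ->
  mx_group (G `&` H)%classic.
Proof.
move=> gG gH; split=> [g [/(mxg_unit gG)]//||g h [? ?] [? ?]|g [? ?]].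
- by split; exact: mxg_1.
- by split; exact: mxg_M.
- by split; exact: mxg_V.
Qed.

Lemma inp_prod (I : Type) (r : seq I) (P : pred I) (f g : I -> F) :
  (forall i, P i -> [/\ inp 0 (f i), inp 0 (g i) & inp 1 (f i - g i)]) ->
  [/\ inp 0 (\prod_(i <- r | P i) f i), inp 0 (\prod_(i <- r | P i) g i)
    & inp 1 (\prod_(i <- r | P i) f i - \prod_(i <- r | P i) g i)].
Proof.
move=> h; elim/big_ind2: _ => //.
- by split; [exact: inp01|exact: inp01|rewrite subrr; exact: inp0].
- move=> a b c d [a0 b0 ab] [c0 d0 cd]; split; try by apply: inp_pM.
  have -> : b * d - a * c = (b - a) * d + a * (d - c) by ring.
  by apply: inpD; [apply: inp_Mp|apply: inp_pM].
Qed.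

(** The Leibniz formula, one permutation at a time: products of congruent integral factors are
    congruent. *)
Lemma det_congr n (A B : 'M[F]_n) : mx_inp 0 A -> mx_inp 0 B -> mx_inp 1 (A - B) ->
  inp 0 (\det A) /\ inp 1 (\det A - \det B).
Proof.
move=> A0 B0 AB.
have key (s : 'S_n) : [/\ inp 0 (\prod_i A i (s i)), inp 0 (\prod_i B i (s i))
  & inp 1 (\prod_i A i (s i) - \prod_i B i (s i))].
  by apply: inp_prod => i _; split=> //; have := AB i (s i); rewrite !mxE.
have sg (b : bool) : inp 0 ((-1) ^+ b : F).
  by case: b; rewrite ?expr0 ?expr1; [apply: inpN|]; apply: inp01.
split; first by apply: inp_sum => s _; apply: inp_pM => //; have [] := key s.
rewrite -sumrB; apply: inp_sum => s _; rewrite -mulrBr; apply: inp_pM => //.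
by have [] := key s.
Qed.

Lemma inp_det n (A : 'M[F]_n) : mx_inp 0 A -> inp 0 (\det A).
Proof.
by move=> h; have [] := det_congr h h; rewrite ?subrr //; apply: mx_inp0.
Qed.

Lemma mx_inp_inv n (A : 'M[F]_n) : A \in unitmx -> mx_inp 0 A -> v (\det A) = 0 ->
  mx_inp 0 (invmx A).
Proof.
move=> Au A0 dA; have d0 : \det A != 0 by move: Au; rewrite unitmxE unitfE.
rewrite /invmx Au -[0]addr0; apply: mx_inpZ; first by right; rewrite valV // dA.
move=> i j; rewrite mxE /cofactor; apply: inp_pM.
  by rewrite -signr_odd; case: odd; rewrite ?expr0 ?expr1; [apply: inpN|]; apply: inp01.
by apply: inp_det => a b; rewrite !mxE.
Qed.

Definition GLo n : set 'M[F]_n :=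
  [set g | [/\ g \in unitmx, mx_inp 0 g & mx_inp 0 (invmx g)]]%classic.

Lemma congr_GLo n m (g : 'M[F]_n) : congr_subgroup m.+1 g -> GLo g.
Proof.
move=> [gu g1].
have g11 : mx_inp 1 (g - 1%:M) by apply: mx_inp_le g1; lia.
have g0 : mx_inp 0 g.
  have h : mx_inp 0 (g - 1%:M) by apply: mx_inp_le g1; lia.
  by have := mx_inpD h (@mx_inp1 F n); rewrite subrK.
split=> //; apply: mx_inp_inv => //.
have [_] := det_congr g0 (@mx_inp1 F n) g11.
by rewrite det1 => /val_1p[].
Qed.

Lemma congr_sub n m m' (g : 'M[F]_n) : (m <= m')%N ->
  congr_subgroup m' g -> congr_subgroup m g.
Proof. by move=> mm [gu g1]; split=> //; apply: mx_inp_le g1; lia. Qed.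

Lemma congr_group n m : mx_group (@congr_subgroup F n m.+1).
Proof.
have M g h : @congr_subgroup F n m.+1 g -> congr_subgroup m.+1 h -> congr_subgroup m.+1 (g *m h).
  move=> cg ch; have [gu g0 _] := congr_GLo cg; have [_ g1] := cg; have [hu h1] := ch.
  split; first by rewrite unitmx_mul gu.
  have -> : g *m h - 1%:M = g *m (h - 1%:M) + (g - 1%:M).
    by rewrite mulmxBr mulmx1 addrA subrK.
  by apply: mx_inpD => //; have := mx_inpM g0 h1; rewrite add0r.
split=> // [g []//||g cg].
  by split; rewrite ?unitmx1 ?subrr //; apply: mx_inp0.
have [gu g0 gi] := congr_GLo cg; have [_ g1] := cg.
split; first by rewrite unitmx_inv.
have -> : invmx g - 1%:M = invmx g *m (1%:M - g).
  by rewrite mulmxBr mulmx1 mulVmx.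
by have := mx_inpM gi (mx_inp_subC g1); rewrite add0r.
Qed.

Lemma congr_conj n m (g k : 'M[F]_n) : GLo g -> congr_subgroup m k ->
  congr_subgroup m (invmx g *m k *m g).
Proof.
move=> [gu g0 gi] [ku k1]; split; first by rewrite !unitmx_mul unitmx_inv gu ku.
have -> : invmx g *m k *m g - 1%:M = invmx g *m (k - 1%:M) *m g.
  by rewrite mulmxBr mulmxBl mulmx1 mulVmx.
by have := mx_inpM (mx_inpM gi k1) g0; rewrite add0r addr0.
Qed.

Lemma congr_of_diff n m (g h : 'M[F]_n) : GLo g -> h \in unitmx ->
  mx_inp m%:Z (h - g) -> congr_subgroup m (invmx g *m h).
Proof.
move=> [gu g0 gi] hu gh; split; first by rewrite unitmx_mul unitmx_inv gu.
have -> : invmx g *m h - 1%:M = invmx g *m (h - g) by rewrite mulmxBr mulVmx.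
by have := mx_inpM gi gh; rewrite add0r.
Qed.

Lemma GL_group n : mx_group (@GL F n).
Proof.
by split=> [//||g h|g]; rewrite /GL /= ?unitmx1 ?unitmx_inv // unitmx_mul => -> ->.
Qed.

(** * Coset representatives in matrix groups *)

Section Transversals.
Variables (n : nat) (G K : set 'M[F]_n).
Hypotheses (gG : mx_group G) (gK : mx_group K) (KG : (K `<=` G)%classic).

Lemma coset_refl g : G g -> K (invmx g *m g).
Proof. by move=> Gg; rewrite mulVmx ?(mxg_unit gG) //; apply: mxg_1. Qed.

Lemma coset_sym g h : G g -> G h -> K (invmx g *m h) -> K (invmx h *m g).
Proof.
move=> Gg Gh /(mxg_V gK); have gu := mxg_unit gG Gg; have hu := mxg_unit gG Gh.
by rewrite invmxM ?unitmx_inv // invmxK.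
Qed.

Lemma coset_trans g h k : G h -> K (invmx g *m h) -> K (invmx h *m k) -> K (invmx g *m k).
Proof.
move=> Gh h1 h2; have := mxg_M gK h1 h2.
by rewrite -mulmxA mulKVmx // (mxg_unit gG).
Qed.

Lemma ltrans_rep D : left_transversal G K D ->
  exists r : 'M[F]_n -> 'M[F]_n, [/\ forall g, G g -> D (r g),
    forall g, G g -> K (invmx (r g) *m g)
  & forall g d, G g -> D d -> K (invmx d *m g) -> r g = d].
Proof.
move=> [DG h].
have /boolp.choice[r hr] : forall g, exists d, G g -> D d /\ K (invmx d *m g).
  move=> g; have [Gg|nG] := pselect (G g); last by exists 0.
  by have [d [? _]] := h g Gg; exists d.
exists r; split=> [g /hr[]//|g /hr[]//|g d Gg Dd gd].
by have [d' [_ u]] := h g Gg; rewrite -(u _ (hr g Gg)); apply: u.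
Qed.

Lemma ltrans_exists : exists D, left_transversal G K D.
Proof.
pose B g : set 'M[F]_n := [set d | G d /\ K (invmx d *m g)]%classic.
pose r g := xget g (B g).
have ex g : G g -> exists x, B g x by move=> Gg; exists g; split=> //; apply: coset_refl.
have hr g : G g -> G (r g) /\ K (invmx (r g) *m g) by move=> /ex/(xgetPex g).
have re g h : G g -> G h -> K (invmx g *m h) -> r g = r h.
  move=> Gg Gh gh; rewrite /r.
  have -> : B h = B g.
    apply/seteqP; split=> d [Gd dg]; split=> //; last exact: coset_trans dg gh.
    by apply: coset_trans dg _ => //; apply: coset_sym.
  have [z Bz] := ex g Gg.
  by rewrite /xget; case: pselect => //= h'; exfalso; apply: h'; exists z; apply/asboolP.
exists [set d | G d /\ r d = d]%classic; split=> [g []//|g Gg].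
have [Grg rg] := hr g Gg.
exists (r g); split=> [|d [[Gd rd] dg]]; last by rewrite -rd; apply: esym; apply: re.
by split=> //; split=> //; apply: re.
Qed.

Lemma ltrans_finite k M D : left_transversal G K D ->
  (forall g, G g -> mx_inp k g) ->
  (forall g h, G g -> G h -> mx_inp M (g - h) -> K (invmx g *m h)) ->
  exists2 E : seq 'M[F]_n, uniq E & forall x, x \in E <-> D x.
Proof.
move=> tD Gk GM; have DG := tD.1; have [r [rD rk ru]] := ltrans_rep tD.
have [g h Gg Gh gh|Q uQ hQ] := @finite_image F _ n n k M G r Gk.
  apply: ru => //; first exact: rD.
  have Grh : G (r h) by apply: DG; apply: rD.
  apply: coset_trans (rk h Gh) _ => //; apply: coset_sym => //; exact: GM.
exists Q => // x; split=> [/hQ[g Gg <-]|Dx]; first exact: rD.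
by apply/hQ; exists x; [exact: DG|exact: (ru _ _ (DG _ Dx) Dx (coset_refl (DG _ Dx)))].
Qed.

End Transversals.

Section Haar.
Variable R : realType.
Local Notation C := R[i].
Variables (n : nat) (G : set 'M[F]_n).
Hypothesis gG : mx_group G.
Section OneSubgroup.
Variable K : set 'M[F]_n.
Hypotheses (gK : mx_group K) (KG : (K `<=` G)%classic).
Implicit Type f : 'M[F]_n -> C.

Lemma rinv_eq f : (forall g k, G g -> K k -> f (g *m k) = f g) ->
  forall g h, G g -> G h -> K (invmx g *m h) -> f h = f g.
Proof. by move=> fK g h Gg Gh gh; rewrite -(fK g _ Gg gh) mulKVmx // (mxg_unit gG). Qed.

(** Right K-invariance of f lets the sum be transported from one system of coset representatives to
    any other. *)
Lemma haar_indep f S D : is_haar_int G K f S -> left_transversal G K D -> has_sum D f S.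
Proof.
move=> [fK [D0 tD0 hS]] tD; have DG := tD.1; have D0G := tD0.1.
have [r [rD rk ru]] := ltrans_rep tD; have [r0 [rD0 rk0 ru0]] := ltrans_rep tD0.
apply: (has_sum_bij (p := r0) (r := r)) hS => [x Dx|d Dd].
  have Gx := DG _ Dx; split; first exact: rD0.
    apply: ru => //; first exact/D0G/rD0.
    exact: (coset_sym gG gK (D0G _ (rD0 _ Gx)) Gx (rk0 _ Gx)).
  exact: (rinv_eq fK (D0G _ (rD0 _ Gx)) Gx (rk0 _ Gx)).
have Gd := D0G _ Dd; split; first exact: rD.
apply: ru0 => //; first exact: DG (rD _ Gd).
exact: (coset_sym gG gK (DG _ (rD _ Gd)) Gd (rk _ Gd)).
Qed.

Lemma haar_unique f S S' : is_haar_int G K f S -> is_haar_int G K f S' -> S = S'.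
Proof.
by move=> h [_ [D tD hS']]; apply: has_sum_unique hS'; apply: haar_indep h tD.
Qed.

Lemma haar_ext f f' S : (forall g, G g -> f g = f' g) ->
  is_haar_int G K f S -> is_haar_int G K f' S.
Proof.
move=> e [fK [D tD hS]]; split=> [g k Gg Kk|].
  by rewrite -!e ?fK //; apply: mxg_M => //; apply: KG.
by exists D => //; apply: has_sum_ext hS => x /tD.1 Gx; apply: e.
Qed.

Lemma haarD f f' S S' : is_haar_int G K f S -> is_haar_int G K f' S' ->
  is_haar_int G K (fun g => f g + f' g) (S + S').
Proof.
move=> h [f'K [D tD hS']]; split=> [g k Gg Kk|]; first by rewrite h.1 // f'K.
by exists D => //; apply: has_sumD hS'; apply: haar_indep h tD.
Qed.

Lemma haarZ f S a : is_haar_int G K f S -> is_haar_int G K (fun g => a * f g) (a * S).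
Proof.
move=> [fK [D tD hS]]; split=> [g k Gg Kk|]; first by rewrite fK.
by exists D => //; apply: has_sumZ.
Qed.

Lemma haarB f f' S S' : is_haar_int G K f S -> is_haar_int G K f' S' ->
  is_haar_int G K (fun g => f g - f' g) (S - S').
Proof.
move=> h /(haarZ (-1)) h'; rewrite -mulN1r.
by apply: haar_ext (haarD h h') => g _; rewrite mulN1r.
Qed.

Lemma haar_translate f S g0 : G g0 -> is_haar_int G K f S ->
  is_haar_int G K (fun g => f (g0 *m g)) S.
Proof.
move=> Gg0 [fK [D tD hS]]; have DG := tD.1; have [r [rD rk ru]] := ltrans_rep tD.
have u0 := mxg_unit gG Gg0; have Vg0 := mxg_V gG Gg0.
split=> [g k Gg Kk|]; first by rewrite mulmxA fK //; apply: mxg_M.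
exists [set x | D (g0 *m x)]%classic.
  split=> [x Dx|g Gg].
    by rewrite -(mulKmx u0 x); apply: mxg_M => //; apply: DG.
  have Ggg : G (g0 *m g) by apply: mxg_M.
  exists (invmx g0 *m r (g0 *m g)); split.
    have Gr := DG _ (rD _ Ggg).
    split; first by rewrite /= mulKVmx //; exact: rD.
    rewrite invmxM ?unitmx_inv ?(mxg_unit gG Gr) // invmxK -mulmxA.
    exact: rk.
  move=> x [/= Dx xg]; rewrite (ru _ _ Ggg Dx) ?mulKmx //.
  have Gx : G x by rewrite -(mulKmx u0 x); apply: mxg_M => //; apply: DG.
  by rewrite invmxM ?(mxg_unit gG Gx) // -mulmxA mulKmx.
apply: (has_sum_bij (p := fun x => g0 *m x) (r := fun x => invmx g0 *m x)) hS.
  by move=> x Dx; rewrite mulKmx.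
by move=> d Dd /=; rewrite mulKVmx.
Qed.

(** The support meets finitely many cosets, so the integral is a finite sum; M is a scale at which
    two elements of G bounded by k fall into the same coset of K. *)
Lemma haar_fin f k M : (forall g h, G g -> K h -> f (g *m h) = f g) ->
  (forall g, G g -> f g != 0 -> mx_inp k g) ->
  (forall g h, G g -> G h -> mx_inp k g -> mx_inp k h -> mx_inp M (g - h) ->
     K (invmx g *m h)) ->
  exists S, is_haar_int G K f S.
Proof.
move=> fK fk fM; have [D tD] := ltrans_exists gG gK.
have DG := tD.1; have [r [rD rk ru]] := ltrans_rep tD.
pose A : set 'M[F]_n := [set g | G g /\ mx_inp k g]%classic.
have [g []//|g h [Gg gk] [Gh hk] gh|Q uQ hQ] := @finite_image F _ n n k M A r.
  apply: ru => //; first exact: rD.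
  have Grh : G (r h) by apply: DG; apply: rD.
  apply: (coset_trans gG gK Gh (rk h Gh)); apply: (coset_sym gG gK) => //; exact: fM.
exists (\sum_(x <- Q) f x); split=> //; exists D => //; apply: has_sum_fin => //.
  by move=> x /hQ[g [Gg _] <-]; apply: rD.
move=> x Dx xQ; apply/eqP; apply/negPn/negP => fx; move/negP: xQ; apply.
have Gx := DG _ Dx.
apply/hQ; exists x; first by split=> //; apply: fk.
exact: (ru _ _ Gx Dx (coset_refl gG gK Gx)).
Qed.

Lemma haar_ind_neq0 f S g0 : is_haar_int G K f S ->
  (forall g, G g -> f g = 0 \/ f g = 1) -> G g0 -> f g0 = 1 -> S != 0.
Proof.
move=> [fK [D tD hS]] f01 Gg0 f1; have DG := tD.1; have [r [rD rk ru]] := ltrans_rep tD.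
apply: (has_sum_ind_neq0 (x0 := r g0) hS) => [x /DG|//|]; [exact: f01|exact: rD|].
by rewrite -f1; apply: esym; exact: (rinv_eq fK (DG _ (rD _ Gg0)) Gg0 (rk _ Gg0)).
Qed.

End OneSubgroup.

(** Each coset of K splits into [K : K'] cosets of K'. Giving volume 1 to K' instead of K therefore
    multiplies the integral by the index, so that integrals with different normalisations can be
    compared. *)
Lemma haar_index (K K' : set 'M[F]_n) (f : 'M[F]_n -> C) S (E : seq 'M[F]_n) :
  mx_group K -> mx_group K' -> (K `<=` G)%classic -> (K' `<=` K)%classic ->
  uniq E -> left_transversal K K' [set` E] ->
  is_haar_int G K f S -> is_haar_int G K' f ((size E)%:R * S).
Proof.
move=> gK gK' KG K'K uE tE hS; have K'G : (K' `<=` G)%classic by move=> x /K'K /KG.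
have [fK [D tD sS]] := hS; have DG := tD.1; have [r [rD rk ru]] := ltrans_rep tD.
have [D' tD'] := ltrans_exists gG gK'.
have DG' := tD'.1; have [r' [rD' rk' ru']] := ltrans_rep tD'.
have EK := tE.1; have [re [reE rek reu]] := ltrans_rep tE.
split=> [g k Gg /K'K Kk|]; first exact: fK.
exists D' => //.
apply: (has_sum_fiber (p := r) (fib := fun d => [seq r' (d *m e) | e <- E])) sS.
- move=> x Dx; have Gx := DG' _ Dx; have Grx := DG _ (rD _ Gx).
  split; [exact: rD| |exact: (rinv_eq fK Grx Gx (rk _ Gx))].
  have Ke := rk _ Gx; have eE := reE _ Ke.
  apply/mapP; exists (re (invmx (r x) *m x)) => //.
  apply: esym; apply: ru' => //; first by apply: mxg_M => //; apply/KG/EK.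
  have := rek _ Ke; rewrite mulmxA => h.
  apply: (coset_sym gG gK') => //; first by apply: mxg_M => //; apply/KG/EK.
  by rewrite invmxM ?(mxg_unit gG Grx) ?(mxg_unit gK (EK _ eE)).
- move=> d Dd; have Gd := DG _ Dd; split; last 2 first.
  + by rewrite size_map.
  + move=> _ /mapP[e eE ->]; have Ke := EK _ eE.
    have Gde : G (d *m e) by apply: mxg_M => //; apply: KG.
    split; first exact: rD'.
    apply: ru => //; first exact/DG'/rD'.
    have h : K (invmx d *m (d *m e)) by rewrite mulKmx // (mxg_unit gG).
    apply: (coset_trans gG gK Gde h); apply: (coset_sym gG gK) => //.
      exact/DG'/rD'.
    by apply: K'K; apply: rk'.
  rewrite map_inj_in_uniq // => e e' eE e'E rr.
  have Ke := EK _ eE; have Ke' := EK _ e'E.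
  have Gde : G (d *m e) by apply: mxg_M => //; apply: KG.
  have Gde' : G (d *m e') by apply: mxg_M => //; apply: KG.
  have h1 := rk' _ Gde; have h2 := rk' _ Gde'; rewrite -rr in h2.
  have h3 : K' (invmx e *m e').
    have := coset_trans gG gK' (DG' _ (rD' _ Gde)) (coset_sym gG gK' (DG' _ (rD' _ Gde)) Gde h1) h2.
    by rewrite invmxM ?(mxg_unit gG Gd) ?(mxg_unit gK Ke) // -mulmxA mulKmx ?(mxg_unit gG Gd).
  have r1 := reu e' e Ke' eE h3.
  by rewrite -r1; apply: reu => //; apply: (coset_refl gK).
Qed.

End Haar.

Lemma congr_finite_index n m m' : (m <= m')%N ->
  exists2 E : seq 'M[F]_n, uniq E &
    left_transversal (@congr_subgroup F n m.+1) (congr_subgroup m'.+1) [set` E].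
Proof.
move=> mm; have gK := congr_group n m; have gK' := congr_group n m'.
have [D tD] := ltrans_exists gK gK'.
have [g /congr_GLo[]//|g h cg ch gh|E uE hE] := ltrans_finite gK gK' (k := 0) (M := m'.+1%:Z) tD.
  apply: congr_of_diff; [exact: congr_GLo cg|by case: ch|exact: mx_inp_subC].
exists E => //; suff -> : [set` E]%classic = D by [].
by apply/seteqP; split=> x /= /hE.
Qed.

End MatrixGroups.

(** * Uniqueness of Godement-Jacquet and Tate factors *)

(** Here a and b are the indices that correct the normalisations of two Haar measures. They occur
    alike on both sides of a functional equation and so do not affect the factor. *)
Lemma cancel_scale (K : fieldType) (a b x y g1 g2 : K) : a * x != 0 ->
  a * x = b * y -> a * (g1 * x) = b * (g2 * y) -> g1 = g2.
Proof.
move=> nz e e'; apply: (mulIf nz); rewrite [in RHS]e mulrCA e'.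
by rewrite [in RHS]mulrCA.
Qed.

Section GJUnique.
Variables (F : padic_field) (R : realType).
Local Notation C := R[i].
Local Notation v := (@pf_val F).
Local Notation q := (pf_q F).

Definition indic (T : Type) (A : T -> Prop) (x : T) : C := if `[< A x >] then 1 else 0.

Lemma indicT (T : Type) (A : T -> Prop) x : A x -> indic A x = 1.
Proof. by move=> h; rewrite /indic; case: asboolP. Qed.

Lemma indicF (T : Type) (A : T -> Prop) x : ~ A x -> indic A x = 0.
Proof. by move=> h; rewrite /indic; case: asboolP. Qed.

Lemma indic_eq (T T' : Type) (A : T -> Prop) (B : T' -> Prop) x y :
  (A x <-> B y) -> indic A x = indic B y.
Proof. by move=> h; rewrite /indic (asbool_equiv_eq h). Qed.

Lemma indic_cases (T : Type) (A : T -> Prop) x : indic A x = 0 \/ indic A x = 1.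
Proof. by rewrite /indic; case: asboolP; [right|left]. Qed.

Lemma scale_near0 (a b : C) (Z1 Z2 : ratfun R) :
  near0 (fun z => a * rval Z1 z = b * rval Z2 z) -> cst a * Z1 = cst b * Z2.
Proof.
move=> H; apply: ratfun_eq0; have [h1 _] := rf_near Z1; have [h2 _] := rf_near Z2.
apply: near0_mono (near0_and H (near0_and h1 h2)) => z _ [e [r1 r2]].
exists (a * rval Z1 z); first by apply: rf_atM => //; apply: rf_at_cst.
by rewrite e; apply: rf_atM => //; apply: rf_at_cst.
Qed.

Lemma scale_nearoo (a b : C) (Z1 Z2 : ratfun R) :
  nearoo (fun z => a * rval Z1 z = b * rval Z2 z) -> cst a * Z1 = cst b * Z2.
Proof.
move=> H; apply: ratfun_eqoo; have [_ h1] := rf_near Z1; have [_ h2] := rf_near Z2.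
apply: nearoo_mono (nearoo_and H (nearoo_and h1 h2)) => z _ [e [r1 r2]].
exists (a * rval Z1 z); first by apply: rf_atM => //; apply: rf_at_cst.
by rewrite e; apply: rf_atM => //; apply: rf_at_cst.
Qed.

Lemma rval0 z : rval (0 : ratfun R) z = 0.
Proof. by apply: rvalE; have := rf_at_cst 0 z; rewrite /cst !rmorph0. Qed.

(** Tested on the indicator function of a neighbourhood of 1 where f = 1: the zeta integral is then
    a nonzero volume, and the Fourier transform is unique, so g is the quotient of two determined
    functions. *)
Lemma gj_unique n (psi : F -> C) (f : 'M[F]_n -> C) (g1 g2 : ratfun R) M :
  gj_equation psi f g1 -> gj_equation psi f g2 ->
  (forall k, congr_subgroup M.+1 k -> f k = 1) -> g1 = g2.
Proof.
move=> H1 H2 f1.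
pose Phi : 'M[F]_n -> C := indic (fun x => mx_inp M.+1%:Z (x - 1%:M)).
have sPhi : schwartz Phi.
  exists M.+1%:Z; split=> [x y hy|x].
    apply: indic_eq; rewrite addrAC; split=> h; last exact: mx_inpD.
    by rewrite -(addrK y (x - _)); apply: mx_inpB.
  rewrite /Phi /indic; case: asboolP => [h _|]; last by rewrite eqxx.
  have {}h : mx_inp 0 (x - 1%:M) by apply: mx_inp_le h; lia.
  have := mx_inpD h (@mx_inp1 F n); rewrite subrK; apply: mx_inp_le; lia.
have [Phi1 [m1 [Z1 [Z1' [F1 h1 h1' e1]]]]] := H1 _ sPhi.
have [Phi2 [m2 [Z2 [Z2' [F2 h2 h2' e2]]]]] := H2 _ sPhi.
have e12 : Phi1 = Phi2.
  by apply: funext => x; apply: is_int_unique (F1 x) (F2 x).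
rewrite -e12 in h2'; clear F1 F2 e12 Phi2.
have gGL := @GL_group F n.
have sub m : (@congr_subgroup F n m.+1 `<=` @GL F n)%classic by move=> g [].
(* The two equations may normalise the Haar measure by different congruence subgroups; both are
   compared with a common smaller one. *)
pose mm := maxn m1 m2.
have [E1 uE1 tE1] := @congr_finite_index F n m1 mm (leq_maxl _ _).
have [E2 uE2 tE2] := @congr_finite_index F n m2 mm (leq_maxr _ _).
have KK1 : (@congr_subgroup F n mm.+1 `<=` congr_subgroup m1.+1)%classic.
  by move=> g; apply: congr_sub; rewrite ltnS leq_maxl.
have KK2 : (@congr_subgroup F n mm.+1 `<=` congr_subgroup m2.+1)%classic.
  by move=> g; apply: congr_sub; rewrite ltnS leq_maxr.
have N1 : (size E1)%:R != 0 :> C.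
  have [d [[dE _] _]] := tE1.2 _ (mxg_1 (congr_group F n m1)).
  by rewrite pnatr_eq0; apply: contraTneq dE => /size0nil ->.
have eZ : cst (size E1)%:R * Z1 = cst (size E2)%:R * Z2.
  apply: scale_near0; apply: near0_mono (near0_and h1 h2) => z _ [a b].
  have a' := haar_index gGL (congr_group F n m1) (congr_group F n mm) (sub m1) KK1 uE1 tE1 a.
  have b' := haar_index gGL (congr_group F n m2) (congr_group F n mm) (sub m2) KK2 uE2 tE2 b.
  exact: (haar_unique gGL (congr_group F n mm) a' b').
have eZ' : cst (size E1)%:R * Z1' = cst (size E2)%:R * Z2'.
  apply: scale_nearoo; apply: nearoo_mono (nearoo_and h1' h2') => z _ [a b].
  have a' := haar_index gGL (congr_group F n m1) (congr_group F n mm) (sub m1) KK1 uE1 tE1 a.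
  have b' := haar_index gGL (congr_group F n m2) (congr_group F n mm) (sub m2) KK2 uE2 tE2 b.
  exact: (haar_unique gGL (congr_group F n mm) a' b').
have Z10 : Z1 != 0.
  have [z hz] := near0_ex h1; apply/eqP => z0; rewrite z0 rval0 in hz.
  have : (0 : C) != 0; last by rewrite eqxx.
  (* On the support of [Phi] all three factors of the integrand are 1, the determinant being a
     unit. *)
  have val_one g : congr_subgroup M.+1 g ->
      Phi g * f g * (z / sqrtC q%:R ^+ n.-1) ^ v (\det g) = 1.
    move=> cg; rewrite f1 // /Phi indicT; last by case: cg.
    have [gu g0 _] := congr_GLo cg.
    have [|_] := det_congr g0 (@mx_inp1 F n); first by apply: mx_inp_le cg.2; lia.
    by rewrite det1 => /val_1p[_ ->]; rewrite expr0z !mulr1.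
  have G1 : @GL F n 1%:M by apply: mxg_1 gGL.
  apply: (@haar_ind_neq0 _ _ _ _ gGL _ _ _ 1%:M hz _ G1).
  - move=> g Gg; have [h|h] := pselect (mx_inp M.+1%:Z (g - 1%:M)).
      by right; apply: val_one.
    by left; rewrite /Phi indicF // !mul0r.
  - exact: (val_one _ (mxg_1 (congr_group F n M))).
have nz : cst (size E1)%:R * Z1 != 0 := mulf_neq0 (cst_neq0 N1) Z10.
rewrite e1 e2 in eZ'; exact: (cancel_scale nz eZ eZ').
Qed.

End GJUnique.

(** * A smooth linear form not vanishing at a given vector *)

Section SmoothForms.
Variables (F : padic_field) (R : realType).
Local Notation C := R[i].
Variables (n : nat) (Pi : grep F R n).
Hypothesis sPi : smooth_rep (@GL F n) Pi.
Local Notation V := (grep_space Pi).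
Implicit Types (x y : V).

Let act := @gact F R n Pi.

Lemma act_lin g c x y : g \in unitmx -> act g (c *: x + y) = c *: act g x + act g y.
Proof. by have [h _ _ _] := sPi; move=> gu; apply: h. Qed.

Lemma act_D g x y : g \in unitmx -> act g (x + y) = act g x + act g y.
Proof. by move=> gu; rewrite -[x]scale1r act_lin // !scale1r. Qed.

Lemma act_0 g : g \in unitmx -> act g 0 = 0.
Proof.
by move=> gu; have := act_D 0 0 gu; rewrite addr0 => /eqP; rewrite -subr_eq subrr => /eqP.
Qed.

Lemma act_Z g c x : g \in unitmx -> act g (c *: x) = c *: act g x.
Proof. by move=> gu; rewrite -[c *: x]addr0 act_lin // act_0 // addr0. Qed.

Lemma act_M g h x : g \in unitmx -> h \in unitmx -> act (g *m h) x = act g (act h x).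
Proof. by have [_ _ h1 _] := sPi; move=> gu hu; apply: h1. Qed.

Lemma act_smooth x : exists m, forall k, congr_subgroup m.+1 k -> act k x = x.
Proof.
by have [_ _ _ /(_ x)[m hm]] := sPi; exists m => k ck; apply: hm => //; case: ck.
Qed.

Variable m : nat.
Local Notation K := (@congr_subgroup F n m.+1).

Definition coinv_comb (s : seq (C * 'M[F]_n * V)) : V :=
  \sum_(t <- s) t.1.1 *: (act t.1.2 t.2 - t.2).

(** The kernel of the projection to the K-coinvariants. The linear combination is kept as a list, so
    that a congruence subgroup fixing all the finitely many vectors involved can be chosen. *)
Definition coinv_kernel (x : V) : Prop := exists2 s : seq (C * 'M[F]_n * V),
  forall t, t \in s -> K t.1.2 & x = coinv_comb s.

(* The average of [k v - v] over a finite quotient of K that acts on both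
   vectors vanishes. *)
Lemma coinv_fixed x : (forall k, K k -> act k x = x) -> coinv_kernel x -> x = 0.
Proof.
move=> fx [s sK xs].
have [M [mM hM]] : exists M, (m <= M)%N /\ forall t, t \in s -> forall k,
    congr_subgroup M.+1 k -> act k t.2 = t.2.
  elim: s {sK xs} => [|t s [M [mM IH]]]; first by exists m.
  have [M' hM'] := act_smooth t.2; exists (maxn M M'); split.
    by apply: leq_trans mM (leq_maxl _ _).
  move=> t'; rewrite inE => /orP[/eqP ->|ts] k ck.
    by apply: hM'; apply: congr_sub ck; rewrite ltnS leq_maxr.
  by apply: IH => //; apply: congr_sub ck; rewrite ltnS leq_maxl.
have [E uE tE] := @congr_finite_index F n m M mM.
have gK := congr_group F n m; have gK' := congr_group F n M.
have EK e : e \in E -> K e by move=> eE; apply: tE.1.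
have [r [rE rk ru]] := ltrans_rep tE.
(* Right multiplication by k permutes the cosets represented by E, because the smaller congruence
   subgroup is normal in K. *)
have avg k y : K k -> (forall k', congr_subgroup M.+1 k' -> act k' y = y) ->
    \sum_(e <- E) act e (act k y) = \sum_(e <- E) act e y.
  move=> Kk fy; have ku := mxg_unit gK Kk.
  have inj : {in E &, injective (fun e => r (e *m k))}.
    move=> e e' eE e'E rr.
    have Ke := EK _ eE; have Ke' := EK _ e'E.
    have Kek := mxg_M gK Ke Kk; have Kek' := mxg_M gK Ke' Kk.
    have h2 := rk _ Kek'; rewrite -rr in h2.
    have h3 := coset_trans gK gK' (EK _ (rE _ Kek)) (coset_sym gK gK' (EK _ (rE _ Kek)) Kek (rk _ Kek)) h2.
    have eu := mxg_unit gK Ke; have eu' := mxg_unit gK Ke'.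
    have := congr_conj (congr_GLo (mxg_V gK Kk)) h3.
    rewrite invmxK invmxM // !mulmxA mulmxV // mul1mx.
    rewrite -!mulmxA mulmxV // mulmx1 => h4.
    by rewrite -(ru _ _ Ke' eE h4); exact: (ru _ _ Ke' e'E (coset_refl gK gK' Ke')).
  have uE' : uniq [seq r (e *m k) | e <- E] by rewrite map_inj_in_uniq.
  have pE : perm_eq [seq r (e *m k) | e <- E] E.
    apply: uniq_perm => //; apply: (uniq_min_size uE' _ _).2.
      by move=> _ /mapP[e eE ->]; apply: rE; exact: (mxg_M gK (EK _ eE) Kk).
    by rewrite size_map.
  rewrite -[RHS](perm_big _ pE) big_map big_seq [RHS]big_seq.
  apply: eq_bigr => e eE; have Ke := EK _ eE; have Kek := mxg_M gK Ke Kk.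
  have eu := mxg_unit gK Ke.
  have Kr := EK _ (rE _ Kek).
  rewrite -act_M // -{1}[e *m k](mulKVmx (mxg_unit gK Kr)) act_M ?(mxg_unit gK Kr) //.
    by rewrite fy //; apply: rk.
  exact: (mxg_unit gK' (rk _ Kek)).
have s0 : \sum_(e <- E) act e x = 0.
  rewrite xs /coinv_comb.
  have -> : \sum_(e <- E) act e (\sum_(t <- s) t.1.1 *: (act t.1.2 t.2 - t.2)) =
     \sum_(t <- s) t.1.1 *: (\sum_(e <- E) act e (act t.1.2 t.2) - \sum_(e <- E) act e t.2).
    under [RHS]eq_bigr => t _ do rewrite -sumrB scaler_sumr.
    rewrite exchange_big /= big_seq [RHS]big_seq; apply: eq_bigr => e /EK /(mxg_unit gK) eu.
    have hs : {morph act e : a b / a + b >-> a + b} by move=> a b; apply: act_D.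
    rewrite (big_morph _ hs (act_0 eu)); apply: eq_bigr => t _.
    by rewrite act_Z // act_D // -scaleN1r act_Z // scaleN1r.
  rewrite big_seq big1 // => t ts; rewrite avg ?subrr ?scaler0 //; first exact: sK.
  by move=> k'; apply: hM.
have {}s0 : (size E)%:R *: x = 0.
  rewrite -s0 big_seq (eq_bigr (fun=> x)); last by move=> e /EK; apply: fx.
  by rewrite -big_seq big_const_seq count_predT iter_addr_0 scaler_nat.
move/eqP: s0; rewrite scaler_eq0 pnatr_eq0 => /orP[/eqP/size0nil E0|/eqP//].
by have [d [[dE _] _]] := tE.2 _ (mxg_1 gK); move: dE; rewrite E0.
Qed.

Definition subspace_K (W : set V) : Prop :=
  [/\ forall c x y, W x -> W y -> W (c *: x + y), W 0
    & forall k x, K k -> W (act k x - x)].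

Lemma coinv_kernel_subspace : subspace_K coinv_kernel.
Proof.
split=> [c x y [s sK ->] [t tK ->]||k x Kk].
- exists ([seq (c * a.1.1, a.1.2, a.2) | a <- s] ++ t).
    move=> a; rewrite mem_cat => /orP[/mapP[b bs ->]/=|/tK//]; exact: sK.
  rewrite /coinv_comb big_cat big_map scaler_sumr; congr (_ + _).
  by apply: eq_bigr => a _; rewrite scalerA.
- by exists [::] => //; rewrite /coinv_comb big_nil.
- exists [:: (1, k, x)]; first by move=> t; rewrite inE => /eqP ->.
  by rewrite /coinv_comb big_seq1 scale1r.
Qed.

(** A maximal subspace A that contains all k y - y but not x is a hyperplane, and the coordinate
    along x modulo A is the form. It is invariant under K because A contains k y - y; that some such
    subspace exists is [coinv_fixed]. *)
Lemma smooth_form_exists x : x != 0 -> (forall k, K k -> act k x = x) ->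
  exists lam : V -> C^o, smooth_form (@GL F n) lam /\ lam x = 1.
Proof.
move=> x0 fx.
(* Nonemptiness is a premise so that the union of the empty chain, which is the empty set, satisfies
   P. A maximal set is still nonempty, being otherwise properly contained in [coinv_kernel]. *)
pose P (W : set V) := (exists w, W w) -> subspace_K W /\ ~ W x.
have [|A [PA maxA]] := @Zorn_bigcup V P.
  move=> Fm FP tot [w [X FX Xw]].
  have QX Y w' : Fm Y -> Y w' -> subspace_K Y /\ ~ Y x by move=> FY Yw; apply: FP => //; exists w'.
  have [[_ X0 XK] _] := QX _ _ FX Xw.
  split; last by move=> [Y FY Yx]; have [_] := QX _ _ FY Yx.
  split=> [c a b [Y FY Ya] [Y' FY' Y'b]||k y Kk]; last 2 first.
  - by exists X.
  - by exists X => //; apply: XK.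
  have [YY|YY] := tot _ _ FY FY'.
    have [[lin _ _] _] := QX _ _ FY' Y'b.
    by exists Y' => //; apply: lin => //; apply: YY.
  have [[lin _ _] _] := QX _ _ FY Ya.
  by exists Y => //; apply: lin => //; apply: YY.
have neA : exists w, A w.
  apply: contrapT => /forallNP nA.
  apply: (maxA coinv_kernel).
    split; first by move=> w /nA.
    by move=> /(_ 0) h; apply: (nA 0); apply: h; have [] := coinv_kernel_subspace.
  move=> _; split; first exact: coinv_kernel_subspace.
  by move=> /(coinv_fixed fx) e; rewrite e eqxx in x0.
have [[linA A0 AK] nAx] := PA neA.
have AZ c a : A a -> A (c *: a) by move=> Aa; rewrite -[_ *: _]addr0; apply: linA.
have ex y : exists c : C, A (y - c *: x).
  have [Ay|nAy] := pselect (A y); first by exists 0; rewrite scale0r subr0.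
  (* B is the span of A and y. By maximality it contains x, and solving for y gives the
     coefficient. *)
  pose B : set V := [set u | exists2 c : C, True & A (u - c *: y)]%classic.
  have Bx : B x.
    apply: contrapT => nBx; apply: (maxA B).
      split; first by move=> a Aa; exists 0; rewrite // scale0r subr0.
      by move=> /(_ y) h; apply: nAy; apply: h; exists 1; rewrite // scale1r subrr.
    move=> _; split=> //; split=> [c a b [ca _ ha] [cb _ hb]||k z Kk].
    - exists (c * ca + cb) => //.
      have -> : c *: a + b - (c * ca + cb) *: y = c *: (a - ca *: y) + (b - cb *: y).
        by rewrite scalerBr scalerDl scalerA opprD addrACA.
      exact: linA.
    - by exists 0; rewrite // scale0r subr0.
    - by exists 0; rewrite // scale0r subr0; apply: AK.
  have [c _ h] := Bx.
  have c0 : c != 0 by apply: contra_notN nAx => /eqP c0; rewrite c0 scale0r subr0 in h.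
  exists c^-1; rewrite (_ : y - c^-1 *: x = (- c^-1) *: (x - c *: y)); first exact: AZ.
  by rewrite scalerBr scalerA mulNr mulVf // scaleN1r opprK scaleNr addrC.
have uniq_c y c c' : A (y - c *: x) -> A (y - c' *: x) -> c = c'.
  move=> h h'; apply/eqP; rewrite -subr_eq0; apply: contra_notT nAx => cc.
  have := linA (-1) _ _ h h'; rewrite scaleN1r.
  have -> : - (y - c *: x) + (y - c' *: x) = (c - c') *: x.
    by rewrite opprB addrA subrK scalerBl.
  by move=> /(AZ (c - c')^-1); rewrite scalerA mulVf // scale1r.
pose lam y : C^o := xget 0 [set c : C | A (y - c *: x)]%classic.
have lamP y : A (y - lam y *: x) by apply: (@xgetPex _ 0 [set c : C | A (y - c *: x)]%classic); exact: ex.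
have lamE y c : A (y - c *: x) -> lam y = c by move=> h; apply: uniq_c (lamP y) h.
exists lam; split; last by apply: lamE; rewrite scale1r subrr.
split.
  move=> c a b; apply: lamE.
  have -> : c *: a + b - (c *: lam a + lam b) *: x = c *: (a - lam a *: x) + (b - lam b *: x).
    by rewrite scalerBr scalerDl scalerA opprD addrACA.
  exact: linA.
exists m => k y _ Kk; apply: lamE.
have -> : gact k y - lam y *: x = 1 *: (act k y - y) + (y - lam y *: x).
  by rewrite scale1r addrA subrK.
by apply: linA => //; apply: AK.
Qed.

End SmoothForms.

(** Applied to a matrix coefficient equal to 1 on a congruence subgroup. Without a form that is
    nonzero on some vector, the condition defining the factor would carry no information. *)
Lemma gj_gamma_unique (F : padic_field) (R : realType) n (psi : F -> R[i])
    (Pi : grep F R n) g1 g2 :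
  supercuspidal_GL Pi -> gj_gamma psi Pi g1 -> gj_gamma psi Pi g2 -> g1 = g2.
Proof.
move=> [sPi [[x x0] _] _] h1 h2.
have [m fx] := act_smooth sPi x.
have [lam [slam lx]] := smooth_form_exists sPi x0 fx.
apply: (gj_unique (M := m) (h1 x lam slam) (h2 x lam slam)) => k ck.
by rewrite (fx _ ck).
Qed.

Lemma field_identity (K : fieldType) (g Z N X a b c : K) : X != 0 ->
  a * Z = N -> b * (g * Z) = c * N * X^-1 -> g * X * b * N = c * a * N.
Proof.
move=> X0 e1 e2; have -> : g * X * b * N = a * X * (b * (g * Z)) by rewrite -e1; ring.
by rewrite e2; field.
Qed.

(** * The Tate factor of an unramified character *)

Section TateUnramified.
Variables (F : padic_field) (R : realType).
Local Notation C := R[i].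
Local Notation v := (@pf_val F).
Local Notation q := (pf_q F).
Variable psi : F -> C.
Hypothesis psi1 : level1_character psi.

Lemma psiD x y : psi (x + y) = psi x * psi y.
Proof. by have [h _ _] := psi1. Qed.

Lemma psi_p x : inp 1 x -> psi x = 1.
Proof. by have [_ h _] := psi1; apply: h. Qed.

Lemma psi0 : psi 0 = 1.
Proof. by apply: psi_p; apply: inp0. Qed.

Lemma psi_neq0 x : psi x != 0.
Proof.
have := psiD x (- x); rewrite subrr psi0 => e.
by apply: contra_eq_neq e => ->; rewrite mul0r oner_neq0.
Qed.

Lemma psiN x : psi (- x) = (psi x)^-1.
Proof. by apply: inv_uniq_r; rewrite -psiD subrr psi0. Qed.

Lemma psi_nontrivial x : ~ inp 1 x -> exists2 y, inp 0 y & psi (x * y) != 1.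
Proof.
move=> hx; have [_ _ [y y0 hy]] := psi1.
have x0 : x != 0 by apply: contra_notN hx => /eqP ->; apply: inp0.
exists (x^-1 * y); last by rewrite mulVKf.
apply: inp_pM => //; right; rewrite valV //.
suff : v x <= 0 by lia.
by rewrite leNgt; apply: contra_notN hx => h; right; lia.
Qed.

(** For x in p the character y -> psi(x y) is trivial on o, whose self-dual volume is the square
    root of q; for other x it is nontrivial on o and the integral vanishes. *)
Lemma fourier_o (Phi' : 'M[F]_1 -> C) x :
  is_fourier psi (indic R (fun y : 'M[F]_1 => mx_inp 0 y)) Phi' ->
  Phi' x = sqrtC q%:R * indic R (fun y : 'M[F]_1 => mx_inp 1 y) x.
Proof.
move=> /(_ x) h.
have tr y : \tr (x *m y) = x 0 0 * y 0 0 by rewrite /mxtrace big_ord1 mxE big_ord1.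
have mi k (y : 'M[F]_1) : mx_inp k y <-> inp k (y 0 0).
  by split=> [H|H i j]; [exact: H|rewrite !ord1].
have [x1|nx1] := pselect (mx_inp 1 x).
  rewrite indicT // mulr1.
  have -> : sqrtC q%:R = vol F R 1 1 0 :> C by rewrite /vol expr0z divr1 expr1.
  apply: is_int_unique (is_int_lattice F R 1 1 0).
  apply: is_int_ext h => y; have [y0|ny] := pselect (mx_inp 0 y); last first.
    by rewrite /indic asboolF // mul0r.
  rewrite indicT // asboolT // mul1r tr psi_p //.
  by apply: inp_Mp; [apply/mi|apply/mi].
rewrite indicF // mulr0.
have [|y y0 hy] := @psi_nontrivial (x 0 0); first by move/mi.
pose Y : 'M[F]_1 := y%:M.
have Y0 : mx_inp 0 Y by apply/mi; rewrite mxE eqxx mulr1n.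
apply: (@is_int_eigen _ _ _ _ _ _ Y (psi (x 0 0 * y)) _ hy h) => t.
rewrite !tr !mxE eqxx mulr1n mulrDr psiD.
suff -> : indic R (fun y : 'M[F]_1 => mx_inp 0 y) (t + Y) = indic R (fun y => mx_inp 0 y) t by ring.
by apply: indic_eq; split=> H; [rewrite -(addrK Y t); apply: mx_inpB|apply: mx_inpD].
Qed.

Variables (tau : F -> C) (w : F).
Hypotheses (qtau : mult_char tau) (utau : unramified tau) (w0 : w != 0) (vw : v w = 1).

Lemma tau_w_neq0 : tau w != 0.
Proof.
have [t1 tM _] := qtau; have wi0 : w^-1 != 0 by rewrite invr_eq0.
have := tM _ _ w0 wi0; rewrite divff // t1 => e.
by apply: contra_eq_neq e => ->; rewrite mul0r oner_neq0.
Qed.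

Lemma tau_wV x : x != 0 -> tau (w^-1 * x) = (tau w)^-1 * tau x.
Proof.
have [t1 tM _] := qtau => x0; have wi0 : w^-1 != 0 by rewrite invr_eq0.
by rewrite tM // -(inv_uniq_r (etrans (esym (tM _ _ w0 wi0)) _)) // divff.
Qed.

(* Subtracting from the zeta integrals of the indicator functions of o and p
   their translates by w leaves the volume of the unit group. *)
Lemma tate_gamma_unramified (g : ratfun R) : tate_gamma psi tau g ->
  g * (cst q%:R * Xs) * (1 - cst (tau w)^-1 * (cst q%:R * Xs)^-1) =
  cst (sqrtC q%:R * (tau w)^-1) * (1 - cst (tau w) * Xs).
Proof.
move=> H; pose Phi := indic R (fun y : 'M[F]_1 => mx_inp 0 y).
have sPhi : schwartz Phi.
  exists 0; split=> [x y hy|x].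
    by apply: indic_eq; split=> h; [rewrite -(addrK y x); apply: mx_inpB|apply: mx_inpD].
  by rewrite /Phi /indic oppr0; case: asboolP => // _; rewrite eqxx.
have [Phi' [m [Z [Z' [F1 hZ hZ' e]]]]] := H _ sPhi.
have PE x := fourier_o x F1.
have gGL := @GL_group F 1.
have gK := congr_group F 1 m.
have KG : (@congr_subgroup F 1 m.+1 `<=` @GL F 1)%classic by move=> k [].
have t0 := tau_w_neq0.
pose W : 'M[F]_1 := (w^-1)%:M.
have GW : @GL F 1 W by rewrite /GL /= unitmxE det_scalar1 unitfE invr_eq0.
pose U : 'M[F]_1 -> C := indic R (fun y : 'M[F]_1 => v (y 0 0) = 0).
have GLa (y : 'M[F]_1) : @GL F 1 y -> y 0 0 != 0.
  by rewrite /GL /= unitmxE det_mx11 unitfE.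
have Wa (y : 'M[F]_1) : (W *m y) 0 0 = w^-1 * y 0 0.
  by rewrite mxE big_ord1 mxE eqxx mulr1n.
have vWa (y : 'M[F]_1) : @GL F 1 y -> v ((W *m y) 0 0) = v (y 0 0) - 1.
  by move=> /GLa y0; rewrite Wa pf_valM ?invr_eq0 // valV // vw addrC.
have mi k (y : 'M[F]_1) : @GL F 1 y -> (mx_inp k y <-> k <= v (y 0 0)).
  move=> /GLa y0; split=> [h|h i j]; first by apply/(inpE _ y0); exact: h.
  by rewrite !ord1; right.
have key0 z : z != 0 -> is_gj_zeta m.+1 Phi (fun x : 'M[F]_1 => tau (x 0 0)) z (rval Z z) ->
    is_haar_int (@GL F 1) (congr_subgroup m.+1) U ((1 - tau w * z) * rval Z z).
  move=> z0 h; have := haarB gGL gK KG h (haarZ (tau w * z) (haar_translate gGL GW h)).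
  rewrite mulrBl mul1r; apply: (haar_ext gGL KG) => y Gy.
  have WG : @GL F 1 (W *m y) := mxg_M gGL GW Gy.
  rewrite expr0 divr1 !det_mx11 vWa // Wa tau_wV ?GLa // expfzDr // exprN1.
  have -> : Phi (W *m y) = indic R (fun k : int => 1 <= k) (v (y 0 0)).
    by apply: indic_eq; rewrite mi // vWa //; split; lia.
  have -> : Phi y = indic R (fun k : int => 0 <= k) (v (y 0 0)).
    by apply: indic_eq; rewrite mi.
  have -> : tau w * z * (indic R (fun k : int => 1 <= k) (v (y 0 0)) * ((tau w)^-1 * tau (y 0 0))
     * (z ^ v (y 0 0) / z)) =
     indic R (fun k : int => 1 <= k) (v (y 0 0)) * tau (y 0 0) * z ^ v (y 0 0).
    by field; rewrite t0 z0.
  rewrite -!mulrA -mulrBl /U.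
  have [e0|ne0] := eqVneq (v (y 0 0)) 0.
    rewrite e0 (indicT _ (x := y)) // indicT // indicF // expr0z utau ?GLa //.
    by rewrite subr0 !mulr1.
  rewrite (indicF _ (x := y)); last by move=> h'; rewrite h' eqxx in ne0.
  rewrite (@indic_eq _ _ _ (fun k : int => 0 <= k) (fun k : int => 1 <= k) _ (v (y 0 0))).
    by rewrite subrr mul0r.
  by split; lia.
(* The Fourier transform is supported on p, so the subtraction leaves the elements of valuation 1, a
   translate of the units. This shift produces the factor (tau w)^-1 (q z)^-1. *)
have keyoo z : z != 0 -> is_gj_zeta m.+1 Phi' (fun x : 'M[F]_1 => tau ((invmx x) 0 0))
      (q%:R * z)^-1 (rval Z' z) ->
    is_haar_int (@GL F 1) (congr_subgroup m.+1)
      (fun y => sqrtC q%:R * (tau w)^-1 * (q%:R * z)^-1 * U (W *m y))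
      ((1 - (tau w)^-1 * (q%:R * z)^-1) * rval Z' z).
  move=> z0 h; set xi := (q%:R * z)^-1 in h *.
  have xi0 : xi != 0 by rewrite invr_eq0 mulf_neq0 // q_neq0.
  have := haarB gGL gK KG h (haarZ ((tau w)^-1 * xi) (haar_translate gGL GW h)).
  rewrite mulrBl mul1r; apply: (haar_ext gGL KG) => y Gy.
  have WG : @GL F 1 (W *m y) := mxg_M gGL GW Gy.
  have iv (x : 'M[F]_1) : @GL F 1 x -> tau (invmx x 0 0) = (tau (x 0 0))^-1.
    move=> Gx; have x0 := GLa _ Gx; apply: inv_uniq_r; have [t1 tM _] := qtau.
    have e1 : x 0 0 * invmx x 0 0 = 1.
      by have := congr1 (fun y : 'M[F]_1 => y 0 0) (mulmxV Gx); rewrite !mxE big_ord1 eqxx.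
    rewrite -tM // ?e1 //; apply: contra_eq_neq e1 => ->.
    by rewrite mulr0 eq_sym oner_neq0.
  rewrite expr0 divr1 !det_mx11 !PE !iv // vWa // Wa tau_wV ?GLa // expfzDr // exprN1.
  have -> : indic R (fun y : 'M[F]_1 => mx_inp 1 y) (W *m y) = indic R (fun k : int => 2 <= k) (v (y 0 0)).
    by apply: indic_eq; rewrite mi // vWa //; split; lia.
  have -> : indic R (fun y : 'M[F]_1 => mx_inp 1 y) y = indic R (fun k : int => 1 <= k) (v (y 0 0)).
    by apply: indic_eq; rewrite mi.
  have ty0 : tau (y 0 0) != 0.
    have [t1 tM _] := qtau; have y0 := GLa _ Gy; have yi0 : (y 0 0)^-1 != 0 by rewrite invr_eq0.
    have := tM _ _ y0 yi0; rewrite divff // t1 => e1.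
    by apply: contra_eq_neq e1 => ->; rewrite mul0r oner_neq0.
  have -> : (tau w)^-1 * xi * (sqrtC q%:R * indic R (fun k : int => 2 <= k) (v (y 0 0)) *
       ((tau w)^-1 * tau (y 0 0))^-1 * (xi ^ v (y 0 0) / xi)) =
       sqrtC q%:R * indic R (fun k : int => 2 <= k) (v (y 0 0)) * (tau (y 0 0))^-1 * xi ^ v (y 0 0).
    by field; rewrite t0 xi0 ty0.
  rewrite -!mulrA -mulrBr -mulrBl /U; congr (_ * _).
  have [e0|ne0] := eqVneq (v (y 0 0)) 1.
    have y0 := GLa _ Gy.
    rewrite (indicT _ (x := W *m y)); last by rewrite vWa // e0.
    have -> : tau (y 0 0) = tau w.
      have [t1 tM _] := qtau; rewrite -[y 0 0](mulVKf w0) tM ?mulf_neq0 ?invr_eq0 //.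
      by rewrite (utau (x := w^-1 * _)) ?mulr1 ?mulf_neq0 ?invr_eq0 // pf_valM ?invr_eq0 // valV // vw e0.
    by rewrite e0 indicT // indicF // expr1z subr0 mul1r mulr1.
  rewrite (indicF _ (x := W *m y)); last by rewrite vWa // => h'; move/eqP: ne0; lia.
  rewrite (@indic_eq _ _ _ (fun k : int => 1 <= k) (fun k : int => 2 <= k) _ (v (y 0 0))).
    by rewrite subrr mul0r !mulr0.
  by split; move/eqP: ne0; lia.
have [z1 [hz1 z10]] : exists z, is_gj_zeta m.+1 Phi (fun x : 'M[F]_1 => tau (x 0 0)) z (rval Z z) /\ z != 0.
  apply: near0_ex; apply: near0_mono hZ => z z0 h; by [].
pose N := (1 - tau w * z1) * rval Z z1.
have hN : is_haar_int (@GL F 1) (congr_subgroup m.+1) U N by apply: key0.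
have N0 : N != 0.
  apply: (@haar_ind_neq0 _ _ _ _ gGL _ _ _ 1%:M hN _ (mxg_1 gGL)).
    by move=> y _; apply: indic_cases.
  by rewrite /U indicT // mxE eqxx val_one.
have eZ : (1 - cst (tau w) * Xs) * Z = cst N.
  apply: ratfun_eq0; have [hr _] := rf_near Z.
  apply: near0_mono (near0_and hZ hr) => z z0 [h r]; exists N; last exact: rf_at_cst.
  rewrite (haar_unique gGL gK hN (key0 z z0 h)).
  apply: rf_atM => //; apply: rf_atB; first exact: rf_at1.
  by apply: rf_atM; [apply: rf_at_cst|apply: rf_at_X].
have eZ' : (1 - cst (tau w)^-1 * (cst q%:R * Xs)^-1) * Z' =
    cst (sqrtC q%:R * (tau w)^-1 * N) * (cst q%:R * Xs)^-1.
  apply: ratfun_eqoo; have [_ hr] := rf_near Z'.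
  apply: nearoo_mono (nearoo_and hZ' hr) => z z0 [h r].
  have rx : rf_at (cst q%:R * Xs)^-1 z (q%:R * z)^-1.
    apply: rf_atV; first by rewrite mulf_neq0 // q_neq0.
    by apply: rf_atM; [apply: rf_at_cst|apply: rf_at_X].
  exists ((1 - (tau w)^-1 * (q%:R * z)^-1) * rval Z' z).
    apply: rf_atM => //; apply: rf_atB; first exact: rf_at1.
    by apply: rf_atM => //; apply: rf_at_cst.
  rewrite (haar_unique gGL gK (keyoo z z0 h) (haarZ _ (haar_translate gGL GW hN))).
  rewrite [X in rf_at _ _ X]mulrAC.
  by apply: rf_atM => //; apply: rf_at_cst.
have X0 : cst q%:R * Xs != 0 :> ratfun R := mulf_neq0 (cst_neq0 (q_neq0 F R)) (Xs_neq0 R).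
rewrite e in eZ'; have nN : cst N != 0 :> ratfun R by apply: cst_neq0.
apply: (mulIf nN); rewrite cstM in eZ'.
exact: (field_identity X0 eZ eZ').
Qed.

End TateUnramified.

(** * The group SO_3 *)

Notation o0 := (@Ordinal 3 0 isT).
Notation o1 := (@Ordinal 3 1 isT).
Notation o2 := (@Ordinal 3 2 isT).

Lemma ord3P (P : 'I_3 -> Prop) : P o0 -> P o1 -> P o2 -> forall i, P i.
Proof.
move=> p0 p1 p2 [[|[|[|//]]] hi].
- by rewrite (_ : Ordinal hi = o0) //; apply: val_inj.
- by rewrite (_ : Ordinal hi = o1) //; apply: val_inj.
- by rewrite (_ : Ordinal hi = o2) //; apply: val_inj.
Qed.

Lemma sum3 (V : nmodType) (f : 'I_3 -> V) : \sum_i f i = f o0 + f o1 + f o2.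
Proof.
rewrite !big_ord_recl big_ord0 addr0 addrA.
by congr (f _ + f _ + f _); apply: val_inj.
Qed.

Lemma mul3E (K : pzSemiRingType) m n (A : 'M[K]_(m, 3)) (B : 'M[K]_(3, n)) i j :
  (A *m B) i j = A i o0 * B o0 j + A i o1 * B o1 j + A i o2 * B o2 j.
Proof. by rewrite mxE sum3. Qed.

Lemma eq_mx3 (T : Type) (A B : 'M[T]_3) :
  (A o0 o0 = B o0 o0) -> (A o0 o1 = B o0 o1) -> (A o0 o2 = B o0 o2) ->
  (A o1 o0 = B o1 o0) -> (A o1 o1 = B o1 o1) -> (A o1 o2 = B o1 o2) ->
  (A o2 o0 = B o2 o0) -> (A o2 o1 = B o2 o1) -> (A o2 o2 = B o2 o2) -> A = B.
Proof. by move=> *; apply/matrixP; apply: ord3P; apply: ord3P. Qed.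

Lemma det3E (K : comNzRingType) (A : 'M[K]_3) : \det A =
  A o0 o0 * (A o1 o1 * A o2 o2 - A o1 o2 * A o2 o1)
  - A o0 o1 * (A o1 o0 * A o2 o2 - A o1 o2 * A o2 o0)
  + A o0 o2 * (A o1 o0 * A o2 o1 - A o1 o1 * A o2 o0).
Proof.
pose f (a b : nat) := A (inord a) (inord b).
have fE i j : A i j = f i j by rewrite /f !inord_val.
rewrite (expand_det_row _ o0) sum3 /cofactor !(expand_det_row _ ord0) !big_ord_recl !big_ord0.
rewrite /cofactor !det_mx11 !mxE !fE /= /bump /= !(addn0, add0n).
by rewrite ?expr0 ?expr1 ?expr2; ring.
Qed.

Ltac fld := field; repeat match goal with
  | |- is_true (_ && _) => apply/andP; split
  end; try done.

Section SO3.
Variables (F : padic_field) (gam : F).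
Hypotheses (gam0 : gam != 0) (vgam : pf_val gam = 0) (p2 : pf_p F != 2%N).
Local Notation v := (@pf_val F).
Local Notation SO := (SO3 gam).
Local Notation SOo := (SO3o gam).
Local Notation u := (u3 gam).
Local Notation w1 := (w1 F).

Let n2 : (2%:R : F) != 0. Proof. exact: pf_char0. Qed.

Lemma SO3_group : mx_group SO.
Proof.
have unit g : SO g -> g \in unitmx by move=> [d _]; rewrite unitmxE d unitr1.
split=> // [|g h [dg hg] [dh hh]|g Sg].
- by split; rewrite ?det1 // trmx1 mul1mx mulmx1.
- split; first by rewrite det_mulmx dg dh mulr1.
  by rewrite trmx_mul -!mulmxA [g^T *m _]mulmxA [g^T *m _ *m _]mulmxA hg mulmxA.
- have gu := unit _ Sg; have [dg hg] := Sg.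
  split; first by rewrite det_inv dg invr1.
  rewrite -[X in _ *m X *m _]hg !mulmxA -trmx_mul mulmxV // trmx1 mul1mx.
  by rewrite -mulmxA mulmxV // mulmx1.
Qed.

Lemma SO3o_group : mx_group SOo.
Proof.
have gS := SO3_group.
split=> [g [/(mxg_unit gS)]//||g h [Sg g0] [Sh h0]|g [Sg g0]].
- by split; [exact: mxg_1|exact: mx_inp1].
- by split; [exact: mxg_M|have := mx_inpM g0 h0].
- split; first exact: mxg_V.
  by apply: mx_inp_inv => //; [exact: mxg_unit gS _ Sg|case: Sg => -> _; exact: val_one].
Qed.

Lemma SO3o_sub : (SOo `<=` SO)%classic. Proof. by move=> g []. Qed.

Definition J3V : 'M[F]_3 :=
  mxs 3 [:: [:: 0; 0; 1]; [:: 0; 2%:R / gam; 0]; [:: 1; 0; 0]].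

Lemma SO3_inv g : SO g -> g *m (J3V *m g^T *m J3 gam) = 1%:M.
Proof.
move=> [dg hg]; apply: mulmx1C.
rewrite -!mulmxA [g^T *m _]mulmxA hg.
by apply: eq_mx3; rewrite mul3E !mxE /=; fld.
Qed.

(** One entry of g g^-1 = 1, with the inverse expressed through the form: the last row is an
    isotropic vector for the inverse form. *)
Lemma SO3_isotropic g : SO g ->
  g o2 o0 * g o2 o2 = - (g o2 o1 ^+ 2 / gam).
Proof.
move=> /SO3_inv /matrixP /(_ o2 o0); rewrite !mul3E !mxE /=.
rewrite !(mul0r, mulr0, add0r, addr0, mulr1, mul1r) => e.
apply: (mulfI n2); transitivity (g o2 o0 * g o2 o2 + g o2 o2 * g o2 o0); first by ring.
apply/eqP; rewrite -subr_eq0 mulrN opprK -[X in _ == X]e; apply/eqP.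
by fld.
Qed.

Lemma u3_SO x : SO (u x).
Proof.
split; first by rewrite det3E !mxE /=; ring.
by apply: eq_mx3; rewrite !mul3E !mxE /=; fld.
Qed.

Lemma t3_SO y : y != 0 -> SO (t3 y).
Proof.
move=> y0; split; first by rewrite det3E !mxE /=; fld.
by apply: eq_mx3; rewrite !mul3E !mxE /=; fld.
Qed.

Lemma w1_SO : SO w1.
Proof.
split; first by rewrite det3E !mxE /=; ring.
by apply: eq_mx3; rewrite !mul3E !mxE /=; ring.
Qed.

Lemma u3D x y : u x *m u y = u (x + y).
Proof. by apply: eq_mx3; rewrite !mul3E !mxE /=; fld. Qed.

Lemma u3_0 : u 0 = 1%:M.
Proof. by apply: eq_mx3; rewrite !mxE /=; fld. Qed.

Lemma t3M (y z : F) : y != 0 -> z != 0 -> t3 y *m t3 z = t3 (y * z).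
Proof. by move=> y0 z0; apply: eq_mx3; rewrite !mul3E !mxE /=; fld. Qed.

Lemma t3_1 : t3 1 = 1%:M :> 'M[F]_3.
Proof. by apply: eq_mx3; rewrite !mxE /= ?invr1. Qed.

Lemma t3u3 y x : y != 0 -> t3 y *m u x = u (y * x) *m t3 y.
Proof. by move=> y0; apply: eq_mx3; rewrite !mul3E !mxE /=; fld. Qed.

Lemma w1w1 : w1 *m w1 = 1%:M.
Proof. by apply: eq_mx3; rewrite !mul3E !mxE /=; ring. Qed.

Lemma w1t3 y : y != 0 -> w1 *m t3 y = t3 y^-1 *m w1.
Proof. by move=> y0; apply: eq_mx3; rewrite !mul3E !mxE /= ?invrK; ring. Qed.

Definition lo3 (y : F) : 'M[F]_3 := w1 *m u y *m w1.

Lemma lo3E y : lo3 y =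
  mxs 3 [:: [:: 1; 0; 0]; [:: 2%:R * y / gam; 1; 0]; [:: - (y ^+ 2) / gam; - y; 1]].
Proof. by apply: eq_mx3; rewrite !mul3E !mxE /=; ring. Qed.

Lemma lo3_SO y : SO (lo3 y).
Proof.
by apply: (mxg_M SO3_group); [apply: (mxg_M SO3_group)|]; [exact: w1_SO|exact: u3_SO|exact: w1_SO].
Qed.

(** The stabiliser of the isotropic row (0, 0, 1) is the unipotent radical; the orthogonality
    relations determine the remaining entries one after the other. *)
Lemma SO3_row3 g : SO g -> g o2 o0 = 0 -> g o2 o1 = 0 -> g o2 o2 = 1 ->
  g = u (g o0 o1).
Proof.
move=> [dg /matrixP hg] h0 h1 h2.
have := hg o0 o0; have := hg o0 o2; have := hg o1 o2; have := hg o2 o2.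
move: dg; rewrite det3E !mul3E !mxE /= h0 h1 h2.
rewrite !(mul0r, mulr0, add0r, addr0, mulr1, mul1r, subr0) => dg e22 e12 e02 e00.
have d0 : g o1 o0 = 0.
  have : g o1 o0 ^+ 2 = 0.
    have -> : g o1 o0 ^+ 2 = g o1 o0 * (gam / 2%:R) * g o1 o0 * (2%:R / gam) by fld.
    by rewrite e00 mul0r.
  by move/eqP; rewrite expf_eq0 => /eqP.
rewrite d0 !(mul0r, mulr0, add0r, addr0) in e02.
have {}dg : g o1 o1 = 1 by rewrite -dg e02 d0; ring.
rewrite dg mul1r in e12.
have f12 : g o1 o2 = - (2%:R * g o0 o1) / gam.
  have -> : g o0 o1 = - (gam / 2%:R * g o1 o2) by apply/eqP; rewrite -addr_eq0 addrC; apply/eqP; rewrite -[RHS]e12; ring.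
  by fld.
have c02 : g o0 o2 = - g o0 o1 ^+ 2 / gam.
  have e : 2%:R * g o0 o2 = - (g o1 o2 * (gam / 2%:R) * g o1 o2).
    by apply/eqP; rewrite -addr_eq0; apply/eqP; rewrite -[RHS]e22; ring.
  apply: (mulfI n2); rewrite e f12; fld.
by apply: eq_mx3; rewrite !mxE /=.
Qed.

Lemma mul_row3 (g h k : 'M[F]_3) : g o2 o0 = h o2 o0 -> g o2 o1 = h o2 o1 -> g o2 o2 = h o2 o2 ->
  forall j, (g *m k) o2 j = (h *m k) o2 j :> F.
Proof. by move=> e0 e1 e2 j; rewrite !mul3E e0 e1 e2. Qed.

(** The torus and the lower unipotent factor are chosen to have the last row of h. The quotient then
    has last row (0, 0, 1) and is unipotent by [SO3_row3]. *)
Lemma SO3_bigcell h : SO h -> h o2 o2 != 0 ->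
  exists x, h = u x *m t3 (h o2 o2)^-1 *m lo3 (- (h o2 o1 / h o2 o2)).
Proof.
move=> Sh c0; set c := h o2 o2; set b := h o2 o1; have gS := SO3_group.
have ci0 : c^-1 != 0 by rewrite invr_eq0.
pose k := t3 c^-1 *m lo3 (- (b / c)).
have Sk : SO k by apply: (mxg_M gS); [exact: t3_SO|exact: lo3_SO].
have ku := mxg_unit gS Sk.
have iso : h o2 o0 = - (b ^+ 2 / gam) / c.
  by apply: (mulIf c0); rewrite SO3_isotropic // divfK.
pose g := h *m invmx k.
have Sg : SO g by apply: (mxg_M gS) => //; apply: (mxg_V gS).
have rk : forall j, g o2 j = (k *m invmx k) o2 j.
  by apply: mul_row3; rewrite ?iso -/b -/c /k lo3E mul3E !mxE /= invrK; fld.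
rewrite mulmxV // in rk.
exists (g o0 o1); rewrite -mulmxA -/k -(SO3_row3 Sg) ?rk ?mxE //.
by rewrite /g mulmxKV.
Qed.

Lemma u3_int x : inp 0 x -> SOo (u x).
Proof.
move=> x0; split; first exact: u3_SO.
have gi : inp 0 gam^-1 by right; rewrite valV // vgam oppr0.
have i0 : inp 0 (0 : F) by apply: inp0.
have i1 : inp 0 (1 : F) by apply: inp01.
apply: ord3P; apply: ord3P; rewrite mxE //=.
  by rewrite expr2; apply: inp_pM => //; apply: inpN; apply: inp_pM.
by apply: inp_pM => //; apply: inpN; apply: inp_pM => //; apply: inp_nat.
Qed.

Lemma t3_int y : y != 0 -> v y = 0 -> SOo (t3 y).
Proof.
move=> y0 vy; split; first exact: t3_SO.
have i0 : inp 0 (0 : F) by apply: inp0.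
have i1 : inp 0 (1 : F) by apply: inp01.
apply: ord3P; apply: ord3P; rewrite mxE //=; right; rewrite ?valV // vy //.
Qed.

Lemma w1_int : SOo w1.
Proof.
split; first exact: w1_SO.
have i0 : inp 0 (0 : F) by apply: inp0.
have i1 : inp 0 (1 : F) by apply: inp01.
by apply: ord3P; apply: ord3P; rewrite mxE //=; apply: inpN.
Qed.

Lemma lo3_int y : inp 0 y -> SOo (lo3 y).
Proof.
move=> y0; have gS := SO3o_group; apply: (mxg_M gS); last exact: w1_int.
by apply: (mxg_M gS); [exact: w1_int|exact: u3_int].
Qed.

(** The big cell suffices when the last entry of the last row has the least valuation. Otherwise w1
    exchanges the outer entries: isotropy makes their valuations add up to twice the middle one, so
    one of the two is at most the middle one. *)
Lemma SO3_iwasawa h : SO h -> exists x y k,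
  [/\ y != 0, SOo k & h = u x *m t3 y *m k].
Proof.
have gS := SO3_group; have gSo := SO3o_group.
have big h' : SO h' -> h' o2 o2 != 0 -> inp 0 (h' o2 o1 / h' o2 o2) -> exists x y k,
    [/\ y != 0, SOo k & h' = u x *m t3 y *m k].
  move=> Sh c0 bc; have [x e] := SO3_bigcell Sh c0.
  exists x, (h' o2 o2)^-1, (lo3 (- (h' o2 o1 / h' o2 o2))); split=> //.
    by rewrite invr_eq0.
  by apply: lo3_int; apply: inpN.
move=> Sh; have iso := SO3_isotropic Sh.
have [[c0 bc]|nbig] := pselect (h o2 o2 != 0 /\ inp 0 (h o2 o1 / h o2 o2)).
  exact: big.
pose h' := h *m w1; have Sh' : SO h' by apply: (mxg_M gS) => //; exact: w1_SO.
have e2 : h' o2 o2 = h o2 o0 by rewrite mul3E !mxE /=; ring.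
have e1 : h' o2 o1 = - h o2 o1 by rewrite mul3E !mxE /=; ring.
suff [a0 ab] : h' o2 o2 != 0 /\ inp 0 (h' o2 o1 / h' o2 o2).
  have [x [y [k [y0 Sk e]]]] := big _ Sh' a0 ab.
  exists x, y, (k *m w1); split=> //; first by apply: (mxg_M gSo) => //; exact: w1_int.
  by rewrite mulmxA -e /h' -mulmxA w1w1 mulmx1.
rewrite e1 e2.
have [b0|b0] := eqVneq (h o2 o1) 0.
  rewrite b0 oppr0 mul0r; split; last exact: inp0.
  have [c0|c0] := eqVneq (h o2 o2) 0.
    apply: contraTneq (mxg_unit gS Sh) => a0; rewrite unitmxE det3E a0 b0 c0.
    rewrite (_ : _ - _ + _ = 0) ?unitr0 //; ring.
  by exfalso; apply: nbig; split=> //; rewrite b0 mul0r; apply: inp0.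
have [c0 a0] : h o2 o2 != 0 /\ h o2 o0 != 0.
  have : h o2 o0 * h o2 o2 != 0.
    by rewrite iso oppr_eq0 mulf_neq0 ?invr_eq0 // expf_neq0.
  by rewrite mulf_eq0 negb_or => /andP[].
split=> //; rewrite mulNr; apply: inpN; right.
have vb : v (h o2 o0) + v (h o2 o2) = v (h o2 o1) *+ 2.
  rewrite -pf_valM // iso valN val_div ?expf_neq0 // valX // vgam subr0 //.
have nb : ~ (0 <= v (h o2 o1) - v (h o2 o2)).
  by move=> h0; apply: nbig; split=> //; right; rewrite val_div.
by rewrite val_div //; lia.
Qed.

(** ** The pro-unipotent radical of the Iwahori subgroup of SO_3 *)

Definition I3p : set 'M[F]_3 :=
  [set k | SO k /\ forall i j : 'I_3, inp (j <= i)%N%:Z (k i j - (i == j)%:R)]%classic.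

Lemma I3p_int k : I3p k -> SOo k.
Proof.
move=> [Sk h]; split=> // i j; rewrite -[k i j](subrK (i == j)%:R).
apply: inpD; first by apply: inp_le (h i j); case: leq.
by case: eqP => _; [exact: inp01|exact: inp0].
Qed.

Lemma I3p_group : mx_group I3p.
Proof.
have gS := SO3_group.
split=> [g [/(mxg_unit gS)]//||g h Ig Ih|g Ig].
- split; first exact: mxg_1.
  by move=> i j; rewrite mxE subrr; apply: inp0.
- have [Sg hg] := Ig; have [Sh hh] := Ih; split; first exact: mxg_M.
  move=> i j.
  have -> : (g *m h) i j - (i == j)%:R = ((g - 1%:M) *m (h - 1%:M)) i j
      + ((g - 1%:M) i j + (h - 1%:M) i j).
    rewrite mulmxBl mulmxBr mulmx1 mul1mx !mxE; ring.
  have hg' (a b : 'I_3) : inp (b <= a)%N%:Z ((g - 1%:M) a b) by have := hg a b; rewrite !mxE.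
  have hh' (a b : 'I_3) : inp (b <= a)%N%:Z ((h - 1%:M) a b) by have := hh a b; rewrite !mxE.
  apply: inpD; last by apply: inpD.
  rewrite mxE; apply: inp_sum => k _; apply: inp_le (inpM (hg' i k) (hh' k j)).
  (* An entry on or below the diagonal of the product of two matrices k - 1 has in each term a
     factor on or below the diagonal, hence in p. *)
  have : (j <= i)%N -> (k <= i)%N || (j <= k)%N by lia.
  by case: (j <= i)%N; case: (k <= i)%N; case: (j <= k)%N => // /(_ isT).
- have [Sg hg] := Ig; split; first exact: mxg_V.
  have -> : invmx g = J3V *m g^T *m J3 gam.
    by rewrite -[LHS]mulmx1 -(SO3_inv Sg) mulKmx // (mxg_unit gS).
  have gi : inp 0 gam^-1 by right; rewrite valV // vgam oppr0.
  have g0 : inp 0 gam by right; rewrite vgam.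
  have ti : inp 0 (2%:R^-1 : F) by right; rewrite valV // val2.
  have t0 : inp 0 (2%:R : F) by apply: inp_nat.
  have E (i j : 'I_3) : inp (j <= i)%N%:Z (g i j - (i == j)%:R) by [].
  apply: ord3P; apply: ord3P; rewrite !mul3E !mxE /= !(mul0r, mulr0, add0r, addr0, mulr1, mul1r, subr0).
  + by have := E o2 o2.
  + have := E o1 o2; rewrite subr0 /= => h; apply: inp_Mp => //; exact: inp_pM.
  + by have := E o0 o2; rewrite subr0.
  + have := E o2 o1; rewrite subr0 /= => h; apply: inp_pM => //; exact: inp_pM.
  + have := E o1 o1 => /= h.
    rewrite (_ : _ - 1 = g o1 o1 - 1) //; by fld.
  + have := E o0 o1; rewrite subr0 /= => h; apply: inp_pM => //; exact: inp_pM.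
  + by have := E o2 o0; rewrite subr0.
  + have := E o1 o0; rewrite subr0 /= => h; apply: inp_Mp => //; exact: inp_pM.
  + by have := E o0 o0.
Qed.

Lemma I3p_congr m k : SO k -> congr_subgroup m.+1 k -> I3p k.
Proof.
move=> Sk [_ k1]; split=> // i j; have := k1 i j; rewrite !mxE; apply: inp_le.
by case: leq.
Qed.

Lemma lo3_I3p y : inp 1 y -> I3p (lo3 y).
Proof.
move=> y1; split; first exact: lo3_SO.
have gi : inp 0 gam^-1 by right; rewrite valV // vgam oppr0.
have i0 k : inp k (0 : F) by apply: inp0.
have y0 : inp 0 y by apply: inp_le y1.
rewrite lo3E; apply: ord3P; apply: ord3P; rewrite mxE /= ?subrr ?subr0 //.
- by apply: inp_Mp => //; apply: inp_pM => //; apply: inp_nat.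
- by apply: inp_Mp => //; apply: inpN; rewrite expr2; apply: inp_pM.
- exact: inpN.
Qed.

Lemma u3_I3p x : inp 0 x -> I3p (u x).
Proof.
move=> x0; have [Sx hx] := u3_int x0; split=> //.
have i0 k : inp k (0 : F) by apply: inp0.
apply: ord3P; apply: ord3P; rewrite ?[_ == _]/= ?subr0; try exact: hx.
all: by rewrite mxE /= ?subrr ?subr0.
Qed.

Lemma t3_I3p y : y != 0 -> (I3p (t3 y) <-> inp 1 (y - 1)).
Proof.
move=> y0; split=> [[_ /(_ o0 o0)]|y1]; first by rewrite mxE.
split; first exact: t3_SO.
have i0 k : inp k (0 : F) by apply: inp0.
apply: ord3P; apply: ord3P; rewrite mxE /= ?subrr ?subr0 //.
have -> : y^-1 - 1 = - (y^-1 * (y - 1)) by fld.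
apply: inpN; apply: inp_pM => //; right; have [_ vy] := val_1p y1.
by rewrite valV // vy oppr0.
Qed.

(** The last row of an invertible integral matrix is primitive. *)
Lemma SO3o_row3 k : SOo k -> inp 1 (k o2 o0) -> inp 1 (k o2 o1) -> k o2 o2 != 0 /\ v (k o2 o2) = 0.
Proof.
move=> Sk a1 b1; have [_ k0] := Sk.
have [_ ki] := mxg_V SO3o_group Sk.
have := congr1 (fun A : 'M[F]_3 => A o2 o2) (mulmxV (mxg_unit SO3o_group Sk)).
rewrite mul3E mxE eqxx => e.
have c1 : ~ inp 1 (k o2 o2).
  move=> c1; apply: (@inp_not1 F); rewrite (_ : 1 = true%:R :> F) // -e.
  by apply: inpD; [apply: inpD|]; apply: inp_Mp.
have c0 : k o2 o2 != 0 by apply: contra_notN c1 => /eqP ->; apply: inp0.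
split=> //; apply/eqP; rewrite eq_le; apply/andP; split.
  by rewrite leNgt; apply: contra_notN c1 => h; right; lia.
by apply/(inpE _ c0).
Qed.

(** The Bruhat decomposition modulo p: the residue of the lower left corner tells the two cells
    apart, the small cell being lower triangular times unipotent by [SO3_bigcell]. *)
Lemma SO3o_decomp k : SOo k ->
  exists x y i, [/\ inp 0 x, y != 0, v y = 0, I3p i &
    k = u x *m t3 y *m i /\ inp 1 (k o2 o0) \/
    k = u x *m t3 y *m w1 *m i /\ ~ inp 1 (k o2 o0)].
Proof.
have gS := SO3_group; have gSo := SO3o_group; have gI := I3p_group.
have key h x y i : SOo h -> I3p i -> y != 0 -> v y = 0 -> h = u x *m t3 y *m i -> inp 0 x.
  move=> Sh Ii y0 vy e.
  have St := t3_int y0 vy.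
  have ui := mxg_unit gI Ii; have ut := mxg_unit gSo St.
  have : SOo (u x).
    have -> : u x = h *m invmx i *m invmx (t3 y) by rewrite e mulmxK // mulmxK.
    apply: (mxg_M gSo); last exact: mxg_V.
    by apply: (mxg_M gSo) => //; apply: (mxg_V gSo); apply: I3p_int.
  by move=> [_ /(_ o0 o1)]; rewrite mxE.
move=> Sk; have [Sk' k0] := Sk; have iso := SO3_isotropic Sk'.
have [a1|na1] := pselect (inp 1 (k o2 o0)).
  have b1 : inp 1 (k o2 o1).
    have [->|b0] := eqVneq (k o2 o1) 0; first exact: inp0.
    have : inp 1 (k o2 o1 ^+ 2).
      have -> : k o2 o1 ^+ 2 = - (k o2 o0 * k o2 o2 * gam) by rewrite iso; fld.
      by apply: inpN; apply: inp_Mp; [apply: inp_Mp|right; rewrite vgam].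
    by move/inpE; rewrite expf_neq0 // valX // => /(_ isT) h; right; lia.
  have [c0 vc] := SO3o_row3 Sk a1 b1.
  have [x e] := SO3_bigcell Sk' c0.
  have ci0 : (k o2 o2)^-1 != 0 by rewrite invr_eq0.
  have vci : v (k o2 o2)^-1 = 0 by rewrite valV // vc.
  have Il : I3p (lo3 (- (k o2 o1 / k o2 o2))).
    by apply: lo3_I3p; apply: inpN; apply: inp_Mp => //; right; rewrite vci.
  exists x, (k o2 o2)^-1, (lo3 (- (k o2 o1 / k o2 o2))); split=> //; last by left.
  exact: key Sk Il ci0 vci e.
pose h := k *m w1; have Sh : SOo h by apply: (mxg_M gSo) => //; exact: w1_int.
have e2 : h o2 o2 = k o2 o0 by rewrite mul3E !mxE /=; ring.
have e1 : h o2 o1 = - k o2 o1 by rewrite mul3E !mxE /=; ring.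
have c0 : h o2 o2 != 0 by rewrite e2; apply: contra_notN na1 => /eqP ->; apply: inp0.
have vc : v (h o2 o2) = 0.
  have : inp 0 (h o2 o2) by rewrite e2.
  move=> /(inpE _ c0) h0; apply/eqP; rewrite eq_le h0 andbT leNgt.
  by apply: contra_notN na1 => h1; right; rewrite -e2; lia.
have [x e] := SO3_bigcell (SO3o_sub Sh) c0.
set y := - (h o2 o1 / h o2 o2) in e.
have y0 : inp 0 y.
  apply: inpN; apply: inp_Mp; first by rewrite e1; apply: inpN; exact: k0.
  by right; rewrite valV // vc.
have ci0 : (h o2 o2)^-1 != 0 by rewrite invr_eq0.
have vci : v (h o2 o2)^-1 = 0 by rewrite valV // vc.
exists x, (h o2 o2)^-1, (u y); split=> //; last 2 first.
- exact: u3_I3p.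
- right; split=> //.
  have -> : k = h *m w1 by rewrite /h -mulmxA w1w1 mulmx1.
  by rewrite {1}e /lo3 !mulmxA -[_ *m w1 *m w1]mulmxA w1w1 mulmx1.
have St := t3_int ci0 vci; have Sl := lo3_int y0.
have : SOo (u x).
  have -> : u x = h *m invmx (lo3 y) *m invmx (t3 (h o2 o2)^-1).
    by rewrite {1}e mulmxK ?(mxg_unit gSo Sl) // mulmxK // (mxg_unit gSo St).
  apply: (mxg_M gSo); last exact: mxg_V.
  by apply: (mxg_M gSo) => //; apply: (mxg_V gSo).
by move=> [_ /(_ o0 o1)]; rewrite mxE.
Qed.

End SO3.

(** * The local coefficient *)

Section Spherical.
Variables (F : padic_field) (R : realType) (gam : F).
Hypotheses (gam0 : gam != 0) (vgam : pf_val gam = 0) (p2 : pf_p F != 2%N).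
Local Notation C := R[i].
Local Notation v := (@pf_val F).
Local Notation q := (pf_q F).
Local Notation SO := (SO3 gam).
Local Notation SOo := (SO3o gam).
Local Notation u := (u3 gam).
Local Notation w1 := (w1 F).

(** ** Heights and the spherical section *)

(* [ht h] is the valuation of y in an Iwasawa decomposition h = u3 x * t3 y * k,
   i.e. minus the least valuation of an entry in the last row of h. *)
Definition ht (h : 'M[F]_3) : int := xget 0 [set n : int | exists x y k,
  [/\ y != 0, SOo k, h = u x *m t3 y *m k & v y = n]]%classic.

Definition row3_in (j : int) (h : 'M[F]_3) := forall b : 'I_3, inp j (h o2 b).

Lemma row3_inM j h k : row3_in j h -> mx_inp 0 k -> row3_in j (h *m k).
Proof.
move=> hj k0 b; rewrite mul3E.
by apply: inpD; [apply: inpD|]; apply: inp_Mp.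
Qed.

(** The last row of [u x *m t3 y] is (0, 0, y^-1), and integral matrices with integral inverse
    preserve the least valuation of a row. Heights thereby become computable from entries. *)
Lemma row3_in_iwasawa j x y k : y != 0 -> SOo k ->
  row3_in j (u x *m t3 y *m k) <-> j <= - v y.
Proof.
move=> y0 Sk; have gSo := SO3o_group gam.
have e b : (u x *m t3 y) o2 b = if b == o2 then y^-1 else 0.
  by move: b; apply: ord3P; rewrite mul3E !mxE /= !(mul0r, mulr0, add0r, addr0, mul1r).
have yi0 : y^-1 != 0 by rewrite invr_eq0.
split=> [h|h].
  have [_ ki] := mxg_V gSo Sk.
  have := row3_inM h ki; rewrite mulmxK ?(mxg_unit gSo Sk) // => /(_ o2).
  by rewrite e eqxx => /(inpE _ yi0); rewrite valV.
apply: row3_inM; last by case: Sk.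
by move=> b; rewrite e; case: eqP => _; [right; rewrite valV|exact: inp0].
Qed.

Lemma htE x y k : y != 0 -> SOo k -> ht (u x *m t3 y *m k) = v y.
Proof.
move=> y0 Sk; apply: xget_unique; first by exists x, y, k.
move=> _ [x' [y' [k' [y0' Sk' e <-]]]].
have h1 := (row3_in_iwasawa (- v y) x y0 Sk).2 (lexx _).
have h2 := (row3_in_iwasawa (- v y') x' y0' Sk').2 (lexx _).
rewrite e in h1; rewrite -e in h2.
move/(row3_in_iwasawa _ _ y0' Sk'): h1; move/(row3_in_iwasawa _ _ y0 Sk): h2; lia.
Qed.

Lemma ht_row h j : SO h -> row3_in j h <-> j <= - ht h.
Proof.
move=> /(SO3_iwasawa gam0 vgam p2)[x [y [k [y0 Sk ->]]]].
by rewrite htE //; apply: row3_in_iwasawa.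
Qed.

Lemma ht_eq h n : SO h -> row3_in (- n) h -> ~ row3_in (- n + 1) h -> ht h = n.
Proof.
move=> Sh /(ht_row _ Sh) a b.
have {}b : ~ (- n + 1 <= - ht h) by move=> /(ht_row _ Sh).
lia.
Qed.

Lemma ht_u3 x h : SO h -> ht (u x *m h) = ht h.
Proof.
move=> /(SO3_iwasawa gam0 vgam p2)[x' [y [k [y0 Sk ->]]]].
by rewrite !mulmxA u3D // !htE.
Qed.

Lemma ht_t3 a h : a != 0 -> SO h -> ht (t3 a *m h) = v a + ht h.
Proof.
move=> a0 /(SO3_iwasawa gam0 vgam p2)[x [y [k [y0 Sk ->]]]].
rewrite !mulmxA t3u3 // -[u _ *m _ *m _]mulmxA t3M // !htE ?mulf_neq0 //.
exact: pf_valM.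
Qed.

Lemma ht_K h k : SO h -> SOo k -> ht (h *m k) = ht h.
Proof.
move=> /(SO3_iwasawa gam0 vgam p2)[x [y [k' [y0 Sk' ->]]]] Sk.
rewrite -!mulmxA !(mulmxA (u x)) !htE //.
by apply: (mxg_M (SO3o_group gam)).
Qed.

Lemma ht_1 : ht 1%:M = 0.
Proof.
have := @htE 0 1 1%:M (oner_neq0 _) (mxg_1 (SO3o_group gam)).
by rewrite u3_0 // t3_1 !mul1mx val_one.
Qed.

Lemma ht_SOo k : SOo k -> ht k = 0.
Proof.
move=> Sk; rewrite -[k]mul1mx ht_K ?ht_1 //; exact: mxg_1 (SO3_group _).
Qed.

Variable (t : F).
Hypotheses (t0 : t != 0) (vt : v t = 1).

Lemma w1ut_SO x : SO (w1 *m u x *m t3 t).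
Proof.
have gS := SO3_group gam; apply: (mxg_M gS); last exact: t3_SO.
by apply: (mxg_M gS); [exact: w1_SO|exact: u3_SO].
Qed.

Lemma w1ut_row x : [/\ (w1 *m u x *m t3 t) o2 o0 = t, (w1 *m u x *m t3 t) o2 o1 = x
  & (w1 *m u x *m t3 t) o2 o2 = - (x ^+ 2 / (gam * t))].
Proof.
by split; rewrite !mul3E !mxE /=; fld.
Qed.

Lemma ht_w1ut_p x : inp 1 x -> ht (w1 *m u x *m t3 t) = -1.
Proof.
move=> x1; have [e0 e1 e2] := w1ut_row x; apply: ht_eq; first exact: w1ut_SO.
  apply: ord3P; rewrite ?e0 ?e1 ?e2 opprK //; first by right; rewrite vt.
  apply: inpN; rewrite (_ : (1 : int) = 1 + (1 + -1)) // expr2 -mulrA.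
  apply: inpM => //; apply: inpM => //; right.
  by rewrite valV ?mulf_neq0 // pf_valM // vt vgam.
by move=> /(_ o0); rewrite e0 opprK => /(inpE _ t0); rewrite vt.
Qed.

Lemma ht_w1ut x : x != 0 -> v x <= 0 -> ht (w1 *m u x *m t3 t) = 1 - v x *+ 2.
Proof.
move=> x0 vx; have [e0 e1 e2] := w1ut_row x.
have n0 : - (x ^+ 2 / (gam * t)) != 0.
  by rewrite oppr_eq0 mulf_neq0 ?expf_neq0 // invr_eq0 mulf_neq0.
have vn : v (- (x ^+ 2 / (gam * t))) = v x *+ 2 - 1.
  by rewrite valN val_div ?expf_neq0 ?mulf_neq0 // valX // pf_valM // vt vgam.
apply: ht_eq; first exact: w1ut_SO.
  by apply: ord3P; rewrite ?e0 ?e1 ?e2; right; rewrite ?vt ?vn; lia.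
by move=> /(_ o2); rewrite e2 => /(inpE _ n0); rewrite vn; lia.
Qed.

(** * The Jacquet integral of the translated spherical section *)

Section Jacquet.
Variable psi : F -> C.
Hypothesis psi1 : level1_character psi.

(* Up to a multiple of the indicator function of p, the integrand transforms by
   a nontrivial character under translation by o. *)
Lemma jacquet_value (zeta S : C) : zeta != 0 ->
  is_int (fun x : 'M[F]_1 =>
    zeta ^ ht (w1 *m u (x 0 0) *m t3 t) * (psi (x 0 0))^-1) S ->
  S = vol F R 1 1 1 * (zeta^-1 - zeta).
Proof.
move=> z0 h; have [_ _ [y y0 hy]] := psi1.
have mi k (x : 'M[F]_1) : mx_inp k x <-> inp k (x 0 0).
  by split=> [H|H i j]; [exact: H|rewrite !ord1].
have h1 := is_intB h (is_intZ (zeta^-1 - zeta) (is_int_lattice F R 1 1 1)).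
suff /eqP : S - (zeta^-1 - zeta) * vol F R 1 1 1 = 0 by rewrite subr_eq0 mulrC => /eqP.
apply: (@is_int_eigen _ _ _ _ _ _ y%:M (psi y)^-1 _ _ h1); last first.
  by apply: contra_neq hy => /(congr1 (fun a => a^-1)); rewrite invrK invr1.
(* On p the power of zeta is zeta^-1, on the units it is zeta. Subtracting zeta^-1 - zeta on p makes
   the coefficient of psi^-1 equal to zeta on all of o. *)
pose f2 (x : F) : C := zeta ^ ht (w1 *m u x *m t3 t) * (psi x)^-1
   - (zeta^-1 - zeta) * indic R (inp 1) x.
have fo x : inp 0 x -> f2 x = zeta * (psi x)^-1.
  move=> x0; rewrite /f2; have [x1|nx1] := pselect (inp 1 x).
    rewrite ht_w1ut_p // indicT // (psi_p psi1 x1) invr1 !mulr1 exprN1; ring.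
  have xn0 : x != 0 by apply: contra_notN nx1 => /eqP ->; apply: inp0.
  have vx : v x = 0.
    move/(inpE _ xn0): x0 => x0; apply/eqP; rewrite eq_le x0 andbT leNgt.
    by apply: contra_notN nx1 => h'; right; lia.
  by rewrite ht_w1ut ?vx // indicF // mul0rn subr0 expr1z mulr0 subr0.
have fn x : ~ inp 0 x -> f2 x = zeta ^ (1 - v x *+ 2) * (psi x)^-1 /\ v x < 0 /\ x != 0.
  move=> x0; have xn0 : x != 0 by apply: contra_notN x0 => /eqP ->; apply: inp0.
  have vx : v x < 0 by rewrite ltNge; apply: contra_notN x0 => h'; right.
  split=> //; rewrite /f2 indicF; last by move=> x1; apply: x0; apply: inp_le x1.
  by rewrite mulr0 subr0 ht_w1ut // ltW.
have key x : f2 (x + y) = (psi y)^-1 * f2 x.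
  have [x0|nx0] := pselect (inp 0 x).
    rewrite !fo //; last exact: inpD.
    by rewrite (psiD psi1) invfM; ring.
  have [-> [vx xn0]] := fn x nx0.
  have [xy0 vxy] := @val_addl F x y xn0 (inp_le (ltac:(lia) : v x + 1 <= 0) y0).
  have nxy : ~ inp 0 (x + y) by move=> /(inpE _ xy0); rewrite vxy; lia.
  have [-> _] := fn _ nxy.
  by rewrite vxy (psiD psi1) invfM; ring.
have e1 x : (if `[< mx_inp 1 x >] then 1 else 0) = indic R (inp 1) ((x : 'M[F]_1) 0 0) :> C.
  by rewrite -(indic_eq R (mi 1 x)).
move=> x; rewrite !e1.
have -> : (x + y%:M) 0 0 = x 0 0 + y by rewrite !mxE eqxx mulr1n.
exact: key.
Qed.

End Jacquet.

Definition f_sph : sec F R := fun h _ => Xs ^ ht h.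

Lemma rval_Xz z (n : int) : z != 0 -> rval (Xs ^ n : ratfun R) z = z ^ n.
Proof. by move=> z0; apply: rvalE; apply: rf_atXz => //; apply: rf_at_X. Qed.

Lemma Xz_laurent (n : int) : exists (P : {poly C}) (N : nat),
  Xs ^ n = FracField.tofrac P / Xs ^+ N.
Proof.
case: n => n; first by exists 'X^n, 0%N; rewrite expr0 invr1 mulr1 rmorphXn.
by exists 1, n.+1; rewrite rmorph1 mul1r NegzE -exprnN.
Qed.

Lemma holo_sph : holo_section gam (fun=> 1) f_sph.
Proof.
split.
- move=> m b x g m0 b0 Sg; rewrite /f_sph.
  have Sug : SO (u x *m g) by apply: (mxg_M (SO3_group gam)) => //; exact: u3_SO.
  by rewrite -mulmxA ht_t3 // ht_u3 // expfzDr ?Xs_neq0 // cst1 mulr1.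
- exists 0%N => g k b b0 Sg Sk ck; rewrite /f_sph ht_K //.
  by apply: I3p_int; apply: I3p_congr ck.
- by move=> k Sk; apply: Xz_laurent.
Qed.

(** A right translate of the spherical section. For [f_sph] itself the function x -> f(w1 u(x)) is
    invariant under o, where psi is nontrivial, so its Jacquet integral vanishes; the translation
    reduces the invariance to p. *)
Definition f_sph_t : sec F R := fun h _ => Xs ^ ht (h *m t3 t).

Lemma t3_conj_int k : SO k -> congr_subgroup 2 k -> SOo (t3 t^-1 *m k *m t3 t).
Proof.
move=> Sk [_ k1]; have ti0 : t^-1 != 0 by rewrite invr_eq0.
have gS := SO3_group gam.
split; first by apply: (mxg_M gS); [apply: (mxg_M gS)|]; rewrite //; apply: t3_SO.
have tm (s : F) : s != 0 -> v s = 1 \/ v s = -1 -> mx_inp (-1) (t3 s).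
  move=> s0 vs; apply: ord3P; apply: ord3P; rewrite mxE /=; try exact: inp0.
  - by right; case: vs => ->.
  - by apply: inp_le (inp01 F).
  - by right; rewrite valV //; case: vs => ->.
have -> : t3 t^-1 *m k *m t3 t = t3 t^-1 *m (k - 1%:M) *m t3 t + 1%:M.
  by rewrite mulmxBr mulmxBl mulmx1 t3M // mulVf // t3_1 subrK.
apply: mx_inpD; last exact: mx_inp1.
have := mx_inpM (mx_inpM (tm _ ti0 _) k1) (tm _ t0 (or_introl vt)).
by apply; rewrite valV // vt; right.
Qed.

Lemma holo_sph_t : holo_section gam (fun=> 1) f_sph_t.
Proof.
have gS := SO3_group gam; have ti0 : t^-1 != 0 by rewrite invr_eq0.
have St : SO (t3 t) by apply: t3_SO.
split.
- move=> m b x g m0 b0 Sg; rewrite /f_sph_t.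
  have Sgt : SO (g *m t3 t) by apply: (mxg_M gS).
  have Sug : SO (u x *m (g *m t3 t)) by apply: (mxg_M gS) => //; exact: u3_SO.
  by rewrite -!mulmxA ht_t3 // ht_u3 // expfzDr ?Xs_neq0 // cst1 mulr1.
- exists 1%N => g k b b0 Sg Sk ck; rewrite /f_sph_t.
  have -> : g *m k *m t3 t = g *m t3 t *m (t3 t^-1 *m k *m t3 t).
    by rewrite -!mulmxA (mulmxA (t3 t)) t3M // divff // t3_1 mul1mx.
  by rewrite ht_K //; [apply: (mxg_M gS)|apply: t3_conj_int].
- by move=> k Sk; apply: Xz_laurent.
Qed.

(** In Iwasawa coordinates h = u(x0) t3(y) k the substitution x -> y^-1 (x + x0) contributes q^(-v
    y) and the section contributes z^(-v y). Thus M f_s is the spherical section at 1 - s, where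
    q^(-(1-s)) = (q z)^-1, times its value at 1. *)
Lemma is_M_sph_scale (Mf : sec F R) h b : is_M gam f_sph Mf -> SO h -> b != 0 ->
  Mf h b = (cst q%:R * Xs) ^ (- ht h) * Mf 1%:M 1.
Proof.
move=> hM Sh b0; have gS := SO3_group gam.
have [x0 [y [k [y0 Sk e]]]] := SO3_iwasawa gam0 vgam p2 Sh.
have hth : ht h = v y by rewrite e htE.
have [r1 _] := rf_near (Mf h b); have [r2 _] := rf_near (Mf 1%:M 1).
apply: ratfun_eq0; apply: near0_mono (near0_and hM (near0_and r1 r2)) => z z0 [H [a1 a2]].
exists (rval (Mf h b) z) => //.
have qz0 : q%:R * z != 0 by rewrite mulf_neq0 // q_neq0.
suff -> : rval (Mf h b) z = (q%:R * z) ^ (- ht h) * rval (Mf 1%:M 1) z.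
  apply: rf_atM => //; apply: rf_atXz => //.
  by apply: rf_atM; [apply: rf_at_cst|apply: rf_at_X].
have H1 := H _ 1 (mxg_1 gS) (oner_neq0 _).
have yi0 : y^-1 != 0 by rewrite invr_eq0.
have H2 := is_intZ (z ^ (- v y)) (is_int_translate (x0%:M) (is_int_dilate yi0 H1)).
have -> : (q%:R * z) ^ (- ht h) * rval (Mf 1%:M 1) z =
   z ^ (- v y) * ((q%:R ^ v y^-1) ^+ (1 * 1) * rval (Mf 1%:M 1) z).
  by rewrite valV // hth expfzMl muln1 expr1; ring.
apply: is_int_unique (H _ _ Sh b0) _; apply: is_int_ext H2 => x.
rewrite /f_sph !rval_Xz // mulmx1.
have -> : (y^-1 *: (x + x0%:M)) 0 0 = y^-1 * (x 0 0 + x0) by rewrite !mxE eqxx mulr1n.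
have -> : w1 *m u (x 0 0) *m h = t3 y^-1 *m (w1 *m u (y^-1 * (x 0 0 + x0))) *m k.
  rewrite e !mulmxA -[w1 *m _ *m u x0]mulmxA u3D // -w1t3 // -[w1 *m t3 y *m _]mulmxA.
  by rewrite t3u3 // mulVKf // !mulmxA.
have Sw : SO (w1 *m u (y^-1 * (x 0 0 + x0))).
  by apply: (mxg_M gS); [exact: w1_SO|exact: u3_SO].
rewrite [ht (_ *m k)]ht_K //; last by apply: (mxg_M gS) => //; exact: t3_SO.
by rewrite ht_t3 // valV // expfzDr.
Qed.

Lemma is_M_sph_t (Mf Mf1 : sec F R) h b : is_M gam f_sph Mf -> is_M gam f_sph_t Mf1 ->
  SO h -> b != 0 -> Mf1 h b = (cst q%:R * Xs) ^ (- ht (h *m t3 t)) * Mf 1%:M 1.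
Proof.
move=> hM hM1 Sh b0; have gS := SO3_group gam.
have Sht : SO (h *m t3 t) by apply: (mxg_M gS) => //; exact: t3_SO.
rewrite -(is_M_sph_scale hM Sht b0); apply: ratfun_eq_near; left.
apply: near0_mono (near0_and hM hM1) => z _ [H H1].
apply: is_int_unique (H1 _ _ Sh b0) _; apply: is_int_ext (H _ _ Sht b0) => x.
by rewrite /f_sph /f_sph_t !mulmxA.
Qed.

Lemma field_jacquet (K : fieldType) (c M w a b : K) : w != 0 ->
  w * a = c * (M * (w * b)) -> c * M * b = a.
Proof. by move=> w0 e; apply: (mulfI w0); rewrite e; ring. Qed.

(** [jacquet_value] is applied twice to the translated section: with zeta = z on one side, and after
    M with zeta = (q z)^-1 on the other. The common volume cancels. The product c * Mf 1 is the
    scalar by which M^* acts on spherical sections. *)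
Lemma local_coefficient (psi : F -> C) (c : ratfun R) (Mf : sec F R) :
  level1_character psi -> is_C psi gam (fun=> 1) c -> is_M gam f_sph Mf ->
  c * Mf 1%:M 1 * (cst q%:R * Xs - (cst q%:R * Xs)^-1) = Xs^-1 - Xs.
Proof.
move=> psi1 hC hM; have [Mf1 [J [J' [hM1 hJ hJ' eJ]]]] := hC _ holo_sph_t.
have gS := SO3_group gam.
set V := vol F R 1 1 1.
have V0 : V != 0 by apply: vol_neq0.
have eJ1 : J = cst V * (Xs^-1 - Xs).
  have [r _] := rf_near J.
  apply: ratfun_eq0; apply: near0_mono (near0_and hJ r) => z z0 [h rJ].
  exists (rval J z) => //.
  have -> : rval J z = V * (z^-1 - z).
    apply: (jacquet_value psi1 z0); apply: is_int_ext h => x.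
    by rewrite /f_sph_t rval_Xz.
  apply: rf_atM; first exact: rf_at_cst.
  by apply: rf_atB; [apply: rf_atV => //|]; apply: rf_at_X.
have eJ2 : J' = Mf 1%:M 1 * (cst V * (cst q%:R * Xs - (cst q%:R * Xs)^-1)).
  have [_ r] := rf_near J'; have [_ r1] := rf_near (Mf 1%:M 1).
  apply: ratfun_eqoo; apply: nearoo_mono (nearoo_and hJ' (nearoo_and r r1)) => z z0 [h [rJ rm]].
  have qz0 : q%:R * z != 0 by rewrite mulf_neq0 // q_neq0.
  have rqz : rf_at (cst q%:R * Xs) z (q%:R * z) by apply: rf_atM; [apply: rf_at_cst|apply: rf_at_X].
  have xi0 : (q%:R * z)^-1 != 0 by rewrite invr_eq0.
  exists (rval J' z) => //.
  (* The integral is divided by this value before [jacquet_value] is applied, so a zero is treated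
     apart. *)
  have [m0|m0] := eqVneq (rval (Mf 1%:M 1) z) 0.
    have -> : rval J' z = 0.
      have h0 := is_intZ 0 (is_int_lattice F R 1 1 0); rewrite mul0r in h0.
      apply: is_int_unique h _; apply: is_int_ext h0 => x; rewrite mul0r.
      have Sw : SO (w1 *m u (x 0 0)) by apply: (mxg_M gS); [exact: w1_SO|exact: u3_SO].
      rewrite (is_M_sph_t hM hM1 Sw (oner_neq0 _)).
      rewrite (rvalE (rf_atM (rf_atXz _ qz0 rqz) rm)) m0 mulr0 mul0r //.
    by rewrite -(mul0r (V * (q%:R * z - (q%:R * z)^-1))) -{1}m0; apply: rf_atM => //;
      apply: rf_atM; [apply: rf_at_cst|apply: rf_atB => //; apply: rf_atV].
  have -> : rval J' z = rval (Mf 1%:M 1) z * (V * (q%:R * z - (q%:R * z)^-1)).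
    have h2 := is_intZ (rval (Mf 1%:M 1) z)^-1 h.
    apply: (mulfI (_ : (rval (Mf 1%:M 1) z)^-1 != 0)); first by rewrite invr_eq0.
    rewrite mulKf // -{1}[q%:R * z]invrK; apply: (jacquet_value psi1 xi0).
    apply: is_int_ext h2 => x.
    have Sw : SO (w1 *m u (x 0 0)) by apply: (mxg_M gS); [exact: w1_SO|exact: u3_SO].
    rewrite (is_M_sph_t hM hM1 Sw (oner_neq0 _)).
    rewrite (rvalE (rf_atM (rf_atXz _ qz0 rqz) rm)) exprz_inv.
    by rewrite [_ * rval _ z]mulrC -mulrA mulKf.
  apply: rf_atM => //; apply: rf_atM; first exact: rf_at_cst.
  by apply: rf_atB => //; apply: rf_atV.
have cV0 : cst V != 0 :> ratfun R := cst_neq0 V0.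
apply: (field_jacquet cV0); rewrite -eJ1 -eJ2; exact: eJ.
Qed.

End Spherical.

(** * The group SO_(2l) *)

Section Antidiagonal.
Variables (F : padic_field) (n : nat).
Local Notation J := (Jmx F n).

(** The adjoint for the form J, written as the reflection in the anti-diagonal: on SO_(2l) it is the
    inverse, with entries that can be read off. *)
Definition star (g : 'M[F]_n) : 'M[F]_n := \matrix_(i, j) g (rev_ord j) (rev_ord i).

Lemma JmxE (i j : 'I_n) : J i j = (j == rev_ord i)%:R.
Proof.
rewrite mxE -val_eqE /=; congr (_%:R); congr nat_of_bool.
by have := ltn_ord i; have := ltn_ord j; lia.
Qed.

Lemma mulJmx m (A : 'M[F]_(n, m)) i j : (J *m A) i j = A (rev_ord i) j.
Proof.
rewrite mxE (bigD1 (rev_ord i)) //= JmxE eqxx mul1r big1 ?addr0 // => k ki.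
by rewrite JmxE (negbTE ki) mul0r.
Qed.

Lemma tr_Jmx : J^T = J.
Proof. by apply/matrixP => i j; rewrite !mxE addnC. Qed.

Lemma mulmxJ m (A : 'M[F]_(m, n)) i j : (A *m J) i j = A i (rev_ord j).
Proof.
have -> : A *m J = (J *m A^T)^T by rewrite trmx_mul trmxK tr_Jmx.
by rewrite mxE mulJmx mxE.
Qed.

Lemma mulJJ : J *m J = 1%:M.
Proof.
by apply/matrixP => i j; rewrite mulJmx JmxE rev_ordK mxE eq_sym.
Qed.

Lemma starE g : star g = J *m g^T *m J.
Proof. by apply/matrixP => i j; rewrite mulmxJ mulJmx !mxE. Qed.

Lemma starM g h : star (g *m h) = star h *m star g.
Proof. by rewrite !starE trmx_mul !mulmxA -[_ *m J *m J]mulmxA mulJJ mulmx1. Qed.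

Lemma star1 : star 1%:M = 1%:M.
Proof. by rewrite starE trmx1 mulmx1 mulJJ. Qed.

Lemma starD g h : star (g + h) = star g + star h.
Proof. by apply/matrixP => i j; rewrite !mxE. Qed.

Lemma starK g : star (star g) = g.
Proof. by apply/matrixP => i j; rewrite !mxE !rev_ordK. Qed.

Lemma det_star g : \det (star g) = \det g.
Proof. by rewrite starE !det_mulmx det_tr mulrC mulrA -det_mulmx mulJJ det1 mul1r. Qed.

Lemma star_orth g : g^T *m J *m g = J <-> star g *m g = 1%:M.
Proof.
rewrite starE -!mulmxA; split=> [e|e]; first by rewrite e mulJJ.
by rewrite -[LHS]mul1mx -mulJJ -mulmxA e mulmx1.
Qed.
End Antidiagonal.

Section EvenOrthogonalGroup.
Variables (F : padic_field) (l : nat).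
Hypotheses (hl : (2 <= l)%N) (p2 : pf_p F != 2%N).
Local Notation v := (@pf_val F).
Local Notation J := (Jmx F (2 * l)).
Local Notation SO := (@SOeven F l).
Local Notation M := 'M[F]_(2 * l).
Implicit Types (g h x y : M).

Lemma SOE g : SO g <-> \det g = 1 /\ star g *m g = 1%:M.
Proof. by rewrite /SOeven /=; split=> -[d /star_orth]. Qed.

Lemma SO_unit g : SO g -> g \in unitmx.
Proof. by move=> [d _]; rewrite unitmxE d unitr1. Qed.

Lemma SO_inv g : SO g -> invmx g = star g.
Proof.
move=> Sg; have [_ e] := (SOE g).1 Sg.
by rewrite -[LHS]mul1mx -e -mulmxA mulmxV ?mulmx1 // SO_unit.
Qed.

Lemma SO_group : mx_group SO.
Proof.
split=> [||g h /SOE[dg eg] /SOE[dh eh]|g Sg]; first exact: SO_unit.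
- by apply/SOE; rewrite det1 star1 mulmx1.
- apply/SOE; rewrite det_mulmx dg dh mulr1; split=> //.
  by rewrite starM -mulmxA [star g *m _]mulmxA eg mul1mx.
- have [dg eg] := (SOE g).1 Sg; rewrite SO_inv //; apply/SOE; split.
    by rewrite det_star.
  by rewrite starK; apply: mulmx1C.
Qed.

(** ** The filtration of the Iwahori subgroup at the barycentre of the alcove *)

(* (2l-2) times the coordinates of the barycentre. *)
Definition hgt (i : nat) : int := if (i < l)%N then l%:Z - 1 - i%:Z else l%:Z - i%:Z.
Local Notation H := (2 * l%:Z - 2).

Lemma hgt_rev (i : 'I_(2 * l)) : hgt (rev_ord i) = - hgt i.
Proof.
have := ltn_ord i; rewrite /hgt /= => hi.
by case: ltnP => a; case: ltnP => b; lia.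
Qed.

(** The condition of depth r / (2l - 2) at the barycentre, 2l - 2 being the Coxeter number of D_l.
    The entries in [affine_generic] are those of the simple affine roots, which have degree exactly
    1. *)
Definition wt (r : int) (i j : nat) (c : F) := c = 0 \/ r <= v c * H + hgt i - hgt j.
Definition filt (r : int) x := forall i j : 'I_(2 * l), wt r i j (x i j).

(** Restated as integrality conditions, which are visibly additive; the direct inequality is not,
    since the valuation of a sum, possibly 0, is not determined. *)
Lemma wtP r i j c : wt r i j c <->
  forall k : int, (k - 1) * H + hgt i - hgt j < r -> inp k c.
Proof.
have [->|c0] := eqVneq c 0.
  by split=> _; [move=> k _; apply: inp0|left].
split=> [[/eqP|h k hk]|h]; first by rewrite (negbTE c0).
  right; have : 0 < H by lia. move=> H0.
  rewrite leNgt; apply/negP => hv.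
  have : v c * H <= (k - 1) * H by apply: ler_wpM2r; lia.
  by lia.
by right; rewrite leNgt; apply/negP => hr; have /(inpE _ c0) := h (v c + 1) (ltac:(rewrite addrK; exact: hr)); lia.
Qed.

Lemma wtD r i j c d : wt r i j c -> wt r i j d -> wt r i j (c + d).
Proof.
move=> /wtP hc /wtP hd; apply/wtP => k hk.
by apply: inpD; [apply: hc|apply: hd].
Qed.

Lemma wt0 r i j : wt r i j 0. Proof. by left. Qed.

Lemma wtN r i j c : wt r i j c -> wt r i j (- c).
Proof. by move=> [->|h]; [left; rewrite oppr0|right; rewrite valN]. Qed.

Lemma wtM r s i j k c d : wt r i j c -> wt s j k d -> wt (r + s) i k (c * d).
Proof.
have [->|c0] := eqVneq c 0; first by rewrite mul0r; left.
have [->|d0] := eqVneq d 0; first by rewrite mulr0; left.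
move=> [/eqP|h1]; first by rewrite (negbTE c0).
move=> [/eqP|h2]; first by rewrite (negbTE d0).
by right; rewrite pf_valM // mulrDl; lia.
Qed.

Lemma filtD r x y : filt r x -> filt r y -> filt r (x + y).
Proof. by move=> hx hy i j; rewrite mxE; apply: wtD. Qed.

Lemma filtN r x : filt r x -> filt r (- x).
Proof. by move=> hx i j; rewrite mxE; apply: wtN. Qed.

Lemma filt0 r : filt r 0.
Proof. by move=> i j; rewrite mxE; left. Qed.

Lemma filtM r s x y : filt r x -> filt s y -> filt (r + s) (x *m y).
Proof.
move=> hx hy i j; rewrite mxE; elim/big_ind: _ => [|c d|k _]; first exact: wt0.
  exact: wtD.
exact: wtM.
Qed.

Lemma filt_le r s x : s <= r -> filt r x -> filt s x.
Proof. by move=> sr h i j; have [->|h'] := h i j; [left|right; lia]. Qed.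

Lemma filt_star r x : filt r x -> filt r (star x).
Proof.
move=> h i j; rewrite mxE; have := h (rev_ord j) (rev_ord i).
by rewrite /wt !hgt_rev => -[->|h']; [left|right; lia].
Qed.

Lemma filt_inp r x (i j : 'I_(2 * l)) k : filt r x ->
  (k - 1) * H + hgt i - hgt j < r -> inp k (x i j).
Proof. by move=> h hk; have /wtP := h i j; apply. Qed.

(** For g = 1 + x, orthogonality reads x + star x = - star x * x, a second order term: to first
    order x lies in the Lie algebra. *)
Lemma SO_star_sub r g : SO g -> 0 <= r -> filt r (g - 1%:M) ->
  filt (r + r) ((g - 1%:M) + star (g - 1%:M)).
Proof.
move=> /SOE[_ e] r0 h.
have -> : (g - 1%:M) + star (g - 1%:M) = - (star (g - 1%:M) *m (g - 1%:M)).
  set x := g - 1%:M; have gx : g = 1%:M + x by rewrite addrC subrK.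
  rewrite gx starD star1 mulmxDl mul1mx mulmxDr mulmx1 in e.
  apply/eqP; rewrite -addr_eq0; apply/eqP.
  move/eqP: e; rewrite -subr_eq0 => /eqP <-.
  by apply/matrixP => i j; rewrite !mxE; ring.
by apply: filtN; apply: filtM => //; apply: filt_star.
Qed.

(** Only the positions (2l, 1) and (l, l+1), counted from 1, are delicate: the bound defining I^+ is
    weaker there than the filtration demands. Entries (rev j, j) belong to no root, and
    orthogonality makes them smaller. *)
Lemma iwahori_filt g : iwahori_plus g <-> SO g /\ filt 1 (g - 1%:M).
Proof.
have H0 : 0 < H by lia.
split=> [[Sg h]|[Sg h]]; split=> //; last first.
  move=> i j; have -> : g i j - (i == j)%:R = (g - 1%:M) i j by rewrite !mxE.
  apply: (filt_inp h); have hi := ltn_ord i; have hj := ltn_ord j.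
  by rewrite /hgt; case: ltnP => a; case: ltnP => b; case: leqP => c /=; lia.
have [_ /matrixP orth] := Sg.
(* The (j, j) entry of the orthogonality relation equates 2 g_jj g_(rev j, j), up to sign, with the
   sum of the other products; 2 g_jj is a unit. *)
have col (e : int) (j : 'I_(2 * l)) :
    (forall k, k != j -> k != rev_ord j -> inp e (g k j * g (rev_ord k) j)) ->
    inp e (g (rev_ord j) j).
  move=> hk; have := orth j j; rewrite -mulmxA mxE.
  under eq_bigr => k _ do rewrite mulJmx mxE.
  have nj : rev_ord j != j by rewrite -val_eqE /=; have := ltn_ord j; lia.
  have [gj0 vgj] : g j j != 0 /\ v (g j j) = 0.
    by apply: val_1p; have := h j j; rewrite leqnn eqxx.
  rewrite JmxE eq_sym (negbTE nj) (bigD1 j) //= (bigD1 (rev_ord j)) //= rev_ordK => e0.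
  have -> : g (rev_ord j) j = - (2%:R * g j j)^-1 *
      (\sum_(i < 2 * l | (i != j) && (i != rev_ord j)) g i j * g (rev_ord i) j).
    have n2 : (2%:R : F) != 0 by apply: pf_char0.
    apply: (mulfI (_ : 2%:R * g j j != 0)); first by rewrite mulf_neq0.
    rewrite mulNr mulrN mulVKf ?mulf_neq0 //; apply/eqP; rewrite -addr_eq0; apply/eqP.
    by rewrite -[RHS]e0; ring.
  have n2 : (2%:R : F) != 0 by apply: pf_char0.
  apply: inp_pM; last by apply: inp_sum => k /andP[k1 k2]; apply: hk.
  by apply: inpN; right; rewrite valV ?mulf_neq0 // pf_valM // val2 // vgj.
have off (i j : 'I_(2 * l)) : i != j -> inp (j <= i)%N%:Z (g i j).
  by move=> ij; have := h i j; rewrite (negbTE ij) subr0.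
move=> i j; have e : (g - 1%:M) i j = g i j - (i == j)%:R by rewrite !mxE.
have hij := h i j; rewrite -e in hij.
apply/wtP => k hk.
have [hi hj] := (ltn_ord i, ltn_ord j).
have [corner|nc] := boolP ((nat_of_ord j == 0%N) && (nat_of_ord i == (2 * l).-1)).
  have ij : i != j by rewrite -val_eqE /=; lia.
  have ri : i = rev_ord j by apply: val_inj => /=; lia.
  have {}e : (g - 1%:M) i j = g i j by rewrite e (negbTE ij) subr0.
  rewrite e; apply: (@inp_le _ _ 2).
    by move: hk; rewrite /hgt; case: ltnP => a; case: ltnP => b; nia.
  rewrite ri; apply: col => m mj mr; apply: (@inpM _ 1 1).
    by apply: inp_le (off _ _ mj); move: mj; rewrite -val_eqE /=; case: leqP; lia.
  have mr' : rev_ord m != j by apply: contra mr => /eqP <-; rewrite rev_ordK.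
  by apply: inp_le (off _ _ mr'); move: mr'; rewrite -val_eqE /=; case: leqP; lia.
have [mid|nm] := boolP ((nat_of_ord j == l) && (nat_of_ord i == l.-1)).
  have ij : i != j by rewrite -val_eqE /=; lia.
  have ri : i = rev_ord j by apply: val_inj => /=; lia.
  have {}e : (g - 1%:M) i j = g i j by rewrite e (negbTE ij) subr0.
  rewrite e; apply: (@inp_le _ _ 1).
    by move: hk; rewrite /hgt; case: ltnP => a; case: ltnP => b; nia.
  rewrite ri; apply: col => m mj mr.
  have mr' : rev_ord m != j by apply: contra mr => /eqP <-; rewrite rev_ordK.
  have [ml|ml] := leqP l m.
    apply: inp_Mp; last by apply: inp_le (off _ _ mr'); case: leqP.
    by apply: inp_le (off _ _ mj); case: leqP => //; lia.
  apply: inp_pM; first by apply: inp_le (off _ _ mj); case: leqP.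
  apply: inp_le (off _ _ mr'); case: leqP => //=; move: mr; rewrite -val_eqE /=; lia.
apply: inp_le hij.
move: hk; rewrite /hgt; move: nc nm; rewrite !negb_and.
by case: ltnP => a; case: ltnP => b; case: (leqP j i) => c /=; nia.
Qed.

Lemma iwahori_group : mx_group (@iwahori_plus F l).
Proof.
split=> [g [/SO_unit]//||g h|g].
- apply/iwahori_filt; split; first exact: mxg_1 SO_group.
  by rewrite subrr; apply: filt0.
- move=> /iwahori_filt[Sg hg] /iwahori_filt[Sh hh]; apply/iwahori_filt.
  split; first exact: mxg_M SO_group _ _ Sg Sh.
  have -> : g *m h - 1%:M = (g - 1%:M) *m (h - 1%:M) + ((g - 1%:M) + (h - 1%:M)).
    by rewrite mulmxBl mulmxBr mulmx1 mul1mx; apply/matrixP => i j; rewrite !mxE; ring.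
  apply: filtD; last exact: filtD.
  by apply: (@filt_le 2) => //; apply: (filtM hg hh).
- move=> /iwahori_filt[Sg hg]; apply/iwahori_filt.
  split; first exact: mxg_V SO_group _ Sg.
  rewrite SO_inv // (_ : star g - 1%:M = star (g - 1%:M)); first exact: filt_star.
  by apply/matrixP => i j; rewrite !mxE (inj_eq rev_ord_inj) eq_sym.
Qed.

Lemma iwahori_sub : (@iwahori_plus F l `<=` SO)%classic.
Proof. by move=> g []. Qed.

(** ** The affine generic character *)

Lemma entE g (i j : 'I_(2 * l)) : ent g i.+1 j.+1 = g i j.
Proof. by rewrite /ent /= !valK. Qed.

Lemma entD g h i j : ent (g + h) i j = ent g i j + ent h i j.
Proof.
rewrite /ent; case: insub => [a|]; last by rewrite addr0.
by case: insub => [b|]; rewrite ?addr0 // mxE.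
Qed.

Lemma ent_ord g i j (hi : (i < 2 * l)%N) (hj : (j < 2 * l)%N) :
  ent g i.+1 j.+1 = g (Ordinal hi) (Ordinal hj).
Proof. exact: (entE g (Ordinal hi) (Ordinal hj)). Qed.

Lemma ent_1_off i j : i != j -> ent (1%:M : M) i.+1 j.+1 = 0.
Proof.
move=> ij; rewrite /ent /=; case: insubP => //= a _ ea; case: insubP => //= b _ eb.
by rewrite mxE -val_eqE /= ea eb (negbTE ij).
Qed.

Lemma filt_ent r x i j k : filt r x -> (k - 1) * H + hgt i - hgt j < r ->
  inp k (ent x i.+1 j.+1).
Proof.
move=> h hk; rewrite /ent /=; case: insubP => [a _ ea|_]; last exact: inp0.
case: insubP => [b _ eb|_]; last exact: inp0.
by apply: (filt_inp h); rewrite ea eb.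
Qed.

Section Character.
Variables (R : realType) (w a : F) (psi : F -> R[i]).
Hypotheses (w0 : w != 0) (vw : v w = 1) (a0 : a != 0) (va : v a = 0).
Hypothesis psi1 : level1_character psi.

Definition aff_form h : F :=
  \sum_(1 <= i < l) ent h i i.+1 + a * ent h l.-1 l.+1 + w^-1 * ent h (2 * l).-1 1.

Lemma aff_formD x y : aff_form (x + y) = aff_form x + aff_form y.
Proof.
rewrite /aff_form; under eq_bigr => i _ do rewrite entD.
by rewrite big_split /= !entD; ring.
Qed.

Let l1 : l.-1 = l.-2.+1. Proof. by lia. Qed.
Let l2 : (2 * l).-1 = (2 * l).-2.+1. Proof. by lia. Qed.

Lemma aff_form1 : aff_form 1%:M = 0.
Proof.
rewrite /aff_form l1 l2 !ent_1_off; try by lia.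
rewrite !mulr0 !addr0 big_nat big1 // => -[//|i] /andP[_ hi].
by rewrite ent_1_off //; lia.
Qed.

Lemma aff_form_sub1 x : aff_form (x - 1%:M) = aff_form x.
Proof. by have := aff_formD (x - 1%:M) 1%:M; rewrite subrK aff_form1 addr0. Qed.

Lemma aff_form_filt2 x : filt 2 x -> inp 1 (aff_form x).
Proof.
move=> h; rewrite /aff_form l1 l2; apply: inpD; first apply: inpD.
- rewrite big_nat; apply: inp_sum => -[//|i] /andP[_ hi].
  by apply: (filt_ent h); rewrite /hgt; case: ltnP => b; case: ltnP => c; lia.
- apply: inp_pM; first by right; rewrite va.
  by apply: (filt_ent h); rewrite /hgt; case: ltnP => b; case: ltnP => c; lia.
- have -> : (1 : int) = -1 + 2 by [].
  apply: inpM; first by right; rewrite valV // vw.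
  by apply: (filt_ent h); rewrite /hgt; case: ltnP => b; case: ltnP => c; lia.
Qed.

Lemma affine_generic_filt2 g : filt 2 (g - 1%:M) -> affine_generic w a psi g = 1.
Proof.
move=> h; rewrite /affine_generic -/(aff_form g) -[g](subrK 1%:M) aff_formD aff_form1 addr0.
by apply: (psi_p psi1); apply: aff_form_filt2.
Qed.

(** The cross term (g - 1)(h - 1) lies in the second step of the filtration, where the linear form
    takes values in p. *)
Lemma affine_genericM g h : iwahori_plus g -> iwahori_plus h ->
  affine_generic w a psi (g *m h) = affine_generic w a psi g * affine_generic w a psi h.
Proof.
move=> /iwahori_filt[_ hg] /iwahori_filt[_ hh]; rewrite /affine_generic -!/(aff_form _).
have -> : g *m h = (g - 1%:M) *m (h - 1%:M) + (g + h - 1%:M).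
  by rewrite mulmxBl mulmxBr mulmx1 mul1mx; apply/matrixP => i j; rewrite !mxE; ring.
rewrite aff_formD (psiD psi1) (psi_p psi1); last first.
  by apply: aff_form_filt2; apply: (filtM hg hh).
rewrite mul1r -(psiD psi1) -aff_formD; congr psi.
exact: aff_form_sub1.
Qed.

(* g_chi is monomial: row i has its nonzero entry [gc_c i] in column [gc_s i]. *)
Definition gc_s (i : nat) : nat :=
  if i == 0%N then (2 * l).-1 else if i == (2 * l).-1 then 0%N
  else if i == l.-1 then l else if i == l then l.-1 else i.
Definition gc_c (i : nat) : F :=
  if i == 0%N then - w^-1 else if i == (2 * l).-1 then - w
  else if i == l.-1 then a^-1 else if i == l then a else 1.

Lemma gc_cases (i : nat) :
  i = 0%N /\ gc_s i = (2 * l).-1 /\ gc_c i = - w^-1 \/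
  i = (2 * l).-1 /\ gc_s i = 0%N /\ gc_c i = - w \/
  i = l.-1 /\ gc_s i = l /\ gc_c i = a^-1 \/
  i = l /\ gc_s i = l.-1 /\ gc_c i = a \/
  (i <> 0%N /\ i <> (2 * l).-1 /\ i <> l.-1 /\ i <> l) /\ gc_s i = i /\ gc_c i = 1.
Proof.
rewrite /gc_s /gc_c; case: eqP => ?; first by left.
case: eqP => ?; first by right; left.
case: eqP => ?; first by do 2 right; left.
case: eqP => ?; first by do 3 right; left.
by do 4 right.
Qed.

Lemma gc_s_lt (i : 'I_(2 * l)) : (gc_s i < 2 * l)%N.
Proof. by have := ltn_ord i; rewrite /gc_s; repeat case: ifP => ?; lia. Qed.
Definition gc_o (i : 'I_(2 * l)) : 'I_(2 * l) := Ordinal (gc_s_lt i).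

Lemma gc_oK : involutive gc_o.
Proof.
move=> i; apply: val_inj => /=; have := ltn_ord i.
have [|[|[|[|]]]] := gc_cases i => -[e1 [e2 _]];
have [|[|[|[|]]]] := gc_cases (gc_s i) => -[e3 [e4 _]]; lia.
Qed.

Lemma gc_c_neq0 i : gc_c i != 0.
Proof.
have [|[|[|[|]]]] := gc_cases i => -[_ [_ ->]]; by rewrite ?oppr_eq0 ?invr_eq0 ?oner_neq0.
Qed.

Lemma gc_cK (i : 'I_(2 * l)) : gc_c i * gc_c (gc_o i) = 1.
Proof.
have := ltn_ord i; rewrite /gc_c /= /gc_s => hi.
repeat case: eqP => ?; try lia; rewrite ?mulrNN ?mulVf ?mulfV ?mulr1 //.
Qed.

(** [g_chi] fixes the barycentre: the change of height under its permutation is compensated by the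
    valuation of its entry. Conjugation therefore preserves the filtration. *)
Lemma gc_hgt (i : 'I_(2 * l)) : hgt (gc_o i) = hgt i + v (gc_c i) * H.
Proof.
have := ltn_ord i; rewrite /gc_c /hgt /= /gc_s => hi.
repeat case: eqP => ?; rewrite ?valN ?valV // ?vw ?va ?val_one; repeat case: ltnP => ?; lia.
Qed.

Lemma g_chiE (i j : 'I_(2 * l)) : g_chi l w a i j = if j == gc_o i then gc_c i else 0.
Proof.
have := ltn_ord i; have := ltn_ord j.
rewrite /g_chi /mx1 mxE -val_eqE /= !inE => hi hj.
have [|[|[|[|]]]] := gc_cases i => -[e [-> ->]];
  repeat (case: ifP => ?); first [done | exfalso; clear p2 w0 vw a0 va; lia].
Qed.

Lemma mul_gchi x i j : (g_chi l w a *m x) i j = gc_c i * x (gc_o i) j.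
Proof.
rewrite mxE (bigD1 (gc_o i)) //= g_chiE eqxx big1 ?addr0 // => k ki.
by rewrite g_chiE (negbTE ki) mul0r.
Qed.

Lemma gchi_mul x i j : (x *m g_chi l w a) i j = x i (gc_o j) * gc_c (gc_o j).
Proof.
rewrite mxE (bigD1 (gc_o j)) //= g_chiE gc_oK eqxx big1 ?addr0 // => k ki.
rewrite g_chiE; case: eqP => [e|_]; last by rewrite mulr0.
by rewrite e gc_oK eqxx in ki.
Qed.

Lemma gchi_sq : g_chi l w a *m g_chi l w a = 1%:M.
Proof.
apply/matrixP => i j; rewrite mul_gchi g_chiE gc_oK mxE eq_sym.
by case: eqP => [->|_]; rewrite ?mulr0 // gc_cK.
Qed.

Lemma gchi_conj x i j : (g_chi l w a *m x *m g_chi l w a) i j =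
  gc_c i * x (gc_o i) (gc_o j) * gc_c (gc_o j).
Proof. by rewrite gchi_mul mul_gchi. Qed.

Lemma filt_gchi r x : filt r x -> filt r (g_chi l w a *m x *m g_chi l w a).
Proof.
move=> h i j; rewrite gchi_conj.
have [->|x0] := eqVneq (x (gc_o i) (gc_o j)) 0; first by left; rewrite mulr0 mul0r.
have [/eqP|] := h (gc_o i) (gc_o j); first by rewrite (negbTE x0).
rewrite !gc_hgt => h'; right; rewrite !pf_valM ?mulf_neq0 ?gc_c_neq0 //.
have e : v (gc_c (gc_o j)) = - v (gc_c j).
  by have := congr1 v (gc_cK j); rewrite pf_valM ?gc_c_neq0 // val_one; lia.
by rewrite e !mulrDl mulNr; lia.
Qed.

(** Conjugation exchanges the entries (l-1, l) and (l-1, l+1), whose contributions swap exactly. It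
    also exchanges the entry (1, 2) with the affine one, but only up to reflection in the
    anti-diagonal, which the Lie algebra condition on x + star x corrects modulo p. For l >= 3 the
    entries (1, 2) and (l-1, l) are distinct. *)
Lemma aff_form_gchi x : (3 <= l)%N -> filt 1 x -> filt 2 (x + star x) ->
  inp 1 (aff_form (g_chi l w a *m x *m g_chi l w a) - aff_form x).
Proof.
move=> l3 hx hs; set y := g_chi l w a *m x *m g_chi l w a.
have ey i j (hi : (i < 2 * l)%N) (hj : (j < 2 * l)%N) :
    ent y i.+1 j.+1 = gc_c i * ent x (gc_s i).+1 (gc_s j).+1 * gc_c (gc_s j).
  rewrite (ent_ord y hi hj) gchi_conj -(entE x (gc_o _) (gc_o _)) //.
have es i j (hi : (i < 2 * l)%N) (hj : (j < 2 * l)%N) :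
    ent (x + star x) i.+1 j.+1 = ent x i.+1 j.+1 + ent x (2 * l - j) (2 * l - i).
  rewrite entD; congr (_ + _); rewrite (ent_ord _ hi hj) mxE -entE /=.
  by congr ent; lia.
have s0 : gc_s 0 = (2 * l).-1 by rewrite /gc_s.
have c0 : gc_c 0 = - w^-1 by rewrite /gc_c.
have sm i : (0 < i < l.-1)%N -> gc_s i = i by rewrite /gc_s => hi; repeat case: eqP => ?; lia.
have cm i : (0 < i < l.-1)%N -> gc_c i = 1 by rewrite /gc_c => hi; repeat case: eqP => ? //; lia.
have sl1 : gc_s l.-1 = l by rewrite /gc_s; repeat case: eqP => ?; lia.
have sl : gc_s l = l.-1 by rewrite /gc_s; repeat case: eqP => ?; lia.
have cl1 : gc_c l.-1 = a^-1 by rewrite /gc_c; repeat case: eqP => ? //; lia.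
have cl : gc_c l = a by rewrite /gc_c; repeat case: eqP => ? //; lia.
have sn2 : gc_s (2 * l).-2 = (2 * l).-2 by rewrite /gc_s; repeat case: eqP => ?; lia.
have cn2 : gc_c (2 * l).-2 = 1 by rewrite /gc_c; repeat case: eqP => ? //; lia.
have sn1 : gc_s (2 * l).-1 = 0%N by rewrite /gc_s; repeat case: eqP => ?; lia.
have cn1 : gc_c (2 * l).-1 = - w by rewrite /gc_c; repeat case: eqP => ? //; lia.
have split_sum (f : nat -> F) : \sum_(1 <= i < l) f i = f 1%N + \sum_(2 <= i < l.-1) f i + f l.-1.
  rewrite big_ltn; last by lia.
  rewrite -addrA; congr (_ + _).
  rewrite -[X in index_iota 2 X](_ : l.-1.+1 = l); last by lia.
  by rewrite big_nat_recr //=; lia.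
rewrite /aff_form !split_sum.
have mid : \sum_(2 <= i < l.-1) ent y i i.+1 = \sum_(2 <= i < l.-1) ent x i i.+1.
  rewrite big_nat [RHS]big_nat; apply: eq_bigr => -[//|i] /andP[i2 il].
  rewrite ey; try by lia.
  by rewrite !sm ?cm ?mul1r ?mulr1 //; lia.
rewrite mid l1 l2.
have e1 : ent y 1 2 = - w^-1 * ent x (2 * l) 2.
  rewrite ey; try by lia.
  rewrite s0 c0 sm ?cm ?mulr1; try by lia.
  by congr (_ * ent _ _ _); lia.
have e2 : ent y l.-2.+1 l.-2.+2 = a * ent x l.-2.+1 l.+1.
  rewrite ey; try by lia.
  rewrite (sm l.-2) ?(cm l.-2) ?mul1r -?l1 ?sl1 ?cl 1?mulrC //; lia.
have e3 : ent y l.-2.+1 l.+1 = a^-1 * ent x l.-2.+1 l.-2.+2.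
  rewrite ey; try by lia.
  rewrite (sm l.-2) ?(cm l.-2) ?mul1r ?sl ?cl1 1?mulrC; try by lia.
  by congr (_ * ent _ _ _); lia.
have e4 : ent y (2 * l).-2.+1 1 = - w * ent x (2 * l).-2.+1 (2 * l).
  rewrite ey; try by lia.
  rewrite s0 sn2 cn2 cn1 mul1r mulrC; by congr (_ * ent _ _ _); lia.
rewrite e1 e2 e3 e4.
have h1 : inp 2 (ent x (2 * l) 2 + ent x (2 * l).-2.+1 1).
  have -> : ent x (2 * l) 2 + ent x (2 * l).-2.+1 1 = ent (x + star x) (2 * l).-1.+1 2.
    rewrite es; try by lia.
    by congr (ent _ _ _ + ent _ _ _); lia.
  by apply: (filt_ent hs); rewrite /hgt; case: ltnP => b; case: ltnP => c; lia.
have h2 : inp 1 (ent x 1 2 + ent x (2 * l).-2.+1 (2 * l)).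
  have -> : ent x 1 2 + ent x (2 * l).-2.+1 (2 * l) = ent (x + star x) 1 2.
    rewrite es; try by lia.
    by congr (ent _ _ _ + ent _ _ _); lia.
  by apply: (filt_ent hs); rewrite /hgt; case: ltnP => b; case: ltnP => c; lia.
set s := \sum_(_ <= _ < _) _.
rewrite (_ : _ - _ = - (w^-1 * (ent x (2 * l) 2 + ent x (2 * l).-2.+1 1))
   - (ent x 1 2 + ent x (2 * l).-2.+1 (2 * l))); last by field; rewrite w0 a0.
apply: inpB => //; apply: inpN; rewrite (_ : (1 : int) = -1 + 2) //.
by apply: inpM => //; right; rewrite valV // vw.
Qed.

Lemma iwahori_gchi g : SO (g_chi l w a) -> iwahori_plus g ->
  iwahori_plus (g_chi l w a *m g *m g_chi l w a).
Proof.
move=> Sc /iwahori_filt[Sg hg]; apply/iwahori_filt.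
split; first by do 2 apply: (mxg_M SO_group) => //.
have -> : g_chi l w a *m g *m g_chi l w a - 1%:M =
    g_chi l w a *m (g - 1%:M) *m g_chi l w a.
  by rewrite mulmxBr mulmxBl mulmx1 gchi_sq.
exact: filt_gchi.
Qed.

Lemma affine_generic_gchi g : (3 <= l)%N -> iwahori_plus g ->
  affine_generic w a psi (g_chi l w a *m g *m g_chi l w a) = affine_generic w a psi g.
Proof.
move=> l3 /iwahori_filt[Sg hg]; rewrite /affine_generic -!/(aff_form _).
have hs := SO_star_sub Sg (ler01 : 0 <= (1 : int)) hg.
have := aff_form_gchi l3 hg hs.
have -> : g_chi l w a *m (g - 1%:M) *m g_chi l w a =
  g_chi l w a *m g *m g_chi l w a - 1%:M by rewrite mulmxBr mulmxBl mulmx1 gchi_sq.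
rewrite !aff_form_sub1 => h.
by rewrite -[aff_form (_ *m _ *m _)](subrK (aff_form g)) (psiD psi1) (psi_p psi1 h) mul1r.
Qed.

End Character.
End EvenOrthogonalGroup.

Notation k0 := (@Ordinal 4 0 isT).
Notation k1 := (@Ordinal 4 1 isT).
Notation k2 := (@Ordinal 4 2 isT).
Notation k3 := (@Ordinal 4 3 isT).

Lemma ord4P (P : 'I_4 -> Prop) : P k0 -> P k1 -> P k2 -> P k3 -> forall i, P i.
Proof.
move=> p0 p1 p2 p3 [[|[|[|[|//]]]] hi].
- by rewrite (_ : Ordinal hi = k0) //; apply: val_inj.
- by rewrite (_ : Ordinal hi = k1) //; apply: val_inj.
- by rewrite (_ : Ordinal hi = k2) //; apply: val_inj.
- by rewrite (_ : Ordinal hi = k3) //; apply: val_inj.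
Qed.

Lemma sum4 (V : nmodType) (f : 'I_4 -> V) : \sum_i f i = f k0 + f k1 + f k2 + f k3.
Proof.
rewrite !big_ord_recl big_ord0 addr0 !addrA.
by congr (f _ + f _ + f _ + f _); apply: val_inj.
Qed.

Lemma mul4E (K : pzSemiRingType) m n (A : 'M[K]_(m, 4)) (B : 'M[K]_(4, n)) i j :
  (A *m B) i j = A i k0 * B k0 j + A i k1 * B k1 j + A i k2 * B k2 j + A i k3 * B k3 j.
Proof. by rewrite mxE sum4. Qed.

(* det (1 + X M Y) = det (1 + M Y X) = det h for Y X = 1 and M = h - 1 *)
Lemma det_embed (K : comNzRingType) m n (X : 'M[K]_(m, n)) (Y : 'M[K]_(n, m)) (h : 'M[K]_n) :
  Y *m X = 1%:M -> \det (1%:M + X *m (h - 1%:M) *m Y) = \det h.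
Proof.
move=> YX; pose A := (h - 1%:M) *m Y.
have e1 : block_mx 1%:M (- X) A 1%:M =
    block_mx 1%:M 0 A 1%:M *m block_mx 1%:M (- X) 0 (1%:M + A *m X).
  rewrite mulmx_block !(mul1mx, mul0mx, mulmx1, mulmx0, addr0, add0r).
  by rewrite mulmxN addrCA addNr addr0.
have e2 : block_mx 1%:M (- X) A 1%:M =
    block_mx 1%:M (- X) 0 1%:M *m block_mx (1%:M + X *m A) 0 A 1%:M.
  rewrite mulmx_block !(mul1mx, mul0mx, mulmx1, mulmx0, addr0, add0r).
  by rewrite mulNmx addrK.
have := congr1 (@determinant _ _) e1; rewrite e2 !det_mulmx.
rewrite !det_ublock !det_lblock !det1 !mulr1 !mul1r -mulmxA => ->.
by rewrite /A -mulmxA YX mulmx1 addrC subrK.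
Qed.

Section Embedding.
Variables (F : padic_field) (l : nat) (gam : F).
Hypotheses (hl : (2 <= l)%N) (p2 : pf_p F != 2%N).
Hypotheses (gam0 : gam != 0) (vgam : pf_val gam = 0).
Local Notation v := (@pf_val F).
Local Notation SO := (@SOeven F l).
Local Notation M := 'M[F]_(2 * l).

Let n2 : (2%:R : F) != 0. Proof. exact: pf_char0. Qed.
Let n4 : (4%:R : F) != 0. Proof. exact: pf_char0. Qed.

(** ** The embedding of SO_3, conjugated by w^(l,1) *)

(** An isometric embedding of the quadratic space of [J3]: the hyperbolic plane of the first and
    last basis vectors, and the middle vector (1/4, gam) of norm gam/2, which is the third column of
    [Amx]. [emb_Y] is the adjoint, so that [emb h] is h on the image and the identity on its
    orthogonal complement. *)
Definition emb_X : 'M[F]_(2 * l, 3) := \matrix_(i, b)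
  if i == 0%N :> nat then (b == o0)%:R
  else if i == l.-1 :> nat then (b == o1)%:R / 4%:R
  else if i == l :> nat then (b == o1)%:R * gam
  else if i == (2 * l).-1 :> nat then (b == o2)%:R else 0.

Definition emb_Y : 'M[F]_(3, 2 * l) := \matrix_(b, j)
  if j == 0%N :> nat then (b == o0)%:R
  else if j == l.-1 :> nat then (b == o1)%:R * 2%:R
  else if j == l :> nat then (b == o1)%:R / (2%:R * gam)
  else if j == (2 * l).-1 :> nat then (b == o2)%:R else 0.

Definition emb (h : 'M[F]_3) : M := 1%:M + emb_X *m (h - 1%:M) *m emb_Y.

Let h0 : (0 < 2 * l)%N. Proof. lia. Qed.
Let h1 : (l.-1 < 2 * l)%N. Proof. lia. Qed.
Let h2 : (l < 2 * l)%N. Proof. lia. Qed.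
Let h3 : ((2 * l).-1 < 2 * l)%N. Proof. lia. Qed.
Let i0 := Ordinal h0.
Let i1 := Ordinal h1.
Let i2 := Ordinal h2.
Let i3 := Ordinal h3.

Lemma sum_special (f : 'I_(2 * l) -> F) :
  (forall i : 'I_(2 * l), i != 0%N :> nat -> i != l.-1 :> nat -> i != l :> nat ->
     i != (2 * l).-1 :> nat -> f i = 0) ->
  \sum_i f i = f i0 + f i1 + f i2 + f i3.
Proof.
move=> hf; rewrite (bigD1 i0) //= (bigD1 i1) /=; last by rewrite -val_eqE /=; lia.
rewrite (bigD1 i2) /=; last by rewrite -!val_eqE /=; lia.
rewrite (bigD1 i3) /=; last by rewrite -!val_eqE /=; lia.
rewrite big1 ?addr0 ?addrA // => i; rewrite -!val_eqE /= => /andP[/andP[/andP[? ?] ?] ?].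
exact: hf.
Qed.

Lemma special_neq : [/\ (l.-1 == 0)%N = false, (l == 0)%N = false, ((2 * l).-1 == 0)%N = false
  & [/\ (l == l.-1)%N = false, ((2 * l).-1 == l.-1)%N = false & ((2 * l).-1 == l)%N = false]].
Proof. by do 2?split; apply/eqP; lia. Qed.

Lemma emb_YX : emb_Y *m emb_X = 1%:M.
Proof.
have [e1 e2 e3 [e4 e5 e6]] := special_neq.
apply/matrixP => b c; rewrite mxE sum_special; last first.
  move=> i /negbTE a0 /negbTE a1 /negbTE a2 /negbTE a3.
  by rewrite !mxE a0 a1 a2 a3 mul0r.
rewrite !mxE /= !eqxx e1 e2 e3 e4 e5 e6; move: b c.
by apply: ord3P; apply: ord3P; rewrite /= ?eqxx; fld.
Qed.

Lemma emb_XJ : emb_X^T *m Jmx F (2 * l) = J3 gam *m emb_Y.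
Proof.
apply/matrixP => b j; rewrite mulmxJ mul3E !mxE /=.
have hj := ltn_ord j.
move: b; apply: ord3P; rewrite /=; repeat (case: ifP => ?); first [exfalso; lia | fld].
Qed.

Lemma emb_SO h : SO3 gam h -> SO (emb h).
Proof.
move=> [dh eh]; split; first by rewrite /emb det_embed ?emb_YX.
have XJ := emb_XJ; have JX : Jmx F (2 * l) *m emb_X = emb_Y^T *m J3 gam.
  apply: trmx_inj; rewrite trmx_mul tr_Jmx XJ trmx_mul trmxK; congr (_ *m _).
  by apply: eq_mx3; rewrite !mxE.
have eh' : (h - 1%:M)^T *m J3 gam + J3 gam *m (h - 1%:M) +
    (h - 1%:M)^T *m J3 gam *m (h - 1%:M) = 0.
  have -> : (h - 1%:M)^T = h^T - 1%:M by rewrite linearB /= trmx1.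
  rewrite !mulmxBl !mulmxBr !mul1mx !mulmx1 eh.
  by apply/matrixP => i j; rewrite !mxE; ring.
rewrite /emb; set D := h - 1%:M in eh' *.
have -> : (1%:M + emb_X *m D *m emb_Y)^T = 1%:M + emb_Y^T *m D^T *m emb_X^T.
  by rewrite linearD /= trmx1 !trmx_mul mulmxA.
rewrite mulmxDl mul1mx mulmxDr mulmx1 mulmxDl.
have e1 : Jmx F (2 * l) *m (emb_X *m D *m emb_Y) = emb_Y^T *m (J3 gam *m D) *m emb_Y.
  by rewrite !mulmxA JX.
have e2 : emb_Y^T *m D^T *m emb_X^T *m Jmx F (2 * l) = emb_Y^T *m (D^T *m J3 gam) *m emb_Y.
  by rewrite -!mulmxA XJ.
have e3 : emb_Y^T *m D^T *m emb_X^T *m Jmx F (2 * l) *m (emb_X *m D *m emb_Y) =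
    emb_Y^T *m (D^T *m J3 gam *m D) *m emb_Y.
  rewrite e2 -!mulmxA; congr (_ *m (_ *m (_ *m _))).
  by rewrite !mulmxA emb_YX mul1mx.
rewrite e1 e3 e2 -[RHS]addr0 -addrA; congr (_ + _).
rewrite addrA -!mulmxDl -!mulmxDr.
by rewrite [X in _ *m X *m _](_ : _ = 0) ?mulmx0 ?mul0mx // -eh' [J3 gam *m D + _]addrC.
Qed.

Lemma embM g h : emb (g *m h) = emb g *m emb h.
Proof.
rewrite /emb mulmxDl mul1mx mulmxDr mulmx1.
have -> : emb_X *m (g - 1%:M) *m emb_Y *m (emb_X *m (h - 1%:M) *m emb_Y) =
    emb_X *m ((g - 1%:M) *m (h - 1%:M)) *m emb_Y.
  by rewrite !mulmxA -[_ *m emb_Y *m emb_X]mulmxA emb_YX mulmx1.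
have -> : g *m h - 1%:M = (h - 1%:M) + ((g - 1%:M) + (g - 1%:M) *m (h - 1%:M)).
  by rewrite mulmxBl !mulmxBr !mulmx1 !mul1mx; apply/matrixP => i j; rewrite !mxE; ring.
set H := h - 1%:M; set G := g - 1%:M.
by rewrite !mulmxDr !mulmxDl !addrA.
Qed.

Lemma emb_entry h (i j : 'I_(2 * l)) : emb h i j = (i == j)%:R +
  \sum_b \sum_c emb_X i b * (h - 1%:M) b c * emb_Y c j.
Proof.
rewrite /emb mxE [in LHS]mxE; congr (_ + _); rewrite mxE exchange_big /=.
by apply: eq_bigr => c _; rewrite mxE mulr_suml.
Qed.

(** The image only meets the heights l-1, 0 and 1-l. A step between neighbours counts l - 1 >= 2,
    and an element of p on the diagonal counts 2l - 2. The lower left entry has to be in p^2, which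
    isotropy of the last row ensures. *)
Lemma emb_I3p h : (3 <= l)%N -> I3p gam h -> filt 2 (emb h - 1%:M).
Proof.
move=> l3 [Sh hh].
have E (b c : 'I_3) : inp (c <= b)%N%:Z ((h - 1%:M) b c).
  by have := hh b c; rewrite !mxE.
have E20 : inp 2 ((h - 1%:M) o2 o0).
  have iso := SO3_isotropic gam0 Sh.
  have e20 : (h - 1%:M) o2 o0 = h o2 o0 by rewrite !mxE subr0.
  have e21 : (h - 1%:M) o2 o1 = h o2 o1 by rewrite !mxE subr0.
  have b1 : inp 1 (h o2 o1) by rewrite -e21; exact: E.
  have [c0 vc] : h o2 o2 != 0 /\ v (h o2 o2) = 0.
    by apply: val_1p; have := hh o2 o2.
  rewrite e20 (_ : h o2 o0 = - (h o2 o1 ^+ 2 / gam) * (h o2 o2)^-1); last by rewrite -iso mulfK.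
  apply: inp_Mp; last by right; rewrite valV // vc.
  apply: inpN; apply: inp_Mp; last by right; rewrite valV // vgam.
  by rewrite expr2; apply: (@inpM _ 1 1).
have vv (b c : 'I_3) (x y : F) (i j : nat) (k : int) : inp 0 x -> inp 0 y ->
    inp k ((h - 1%:M) b c) -> 2 <= k * (2 * l%:Z - 2) + hgt l i - hgt l j ->
    wt l 2 i j (x * (h - 1%:M) b c * y).
  move=> x0 y0 kk hk; have : inp k (x * (h - 1%:M) b c * y).
    by apply: inp_Mp => //; apply: inp_pM.
  move=> [->|hv]; [by left|right].
  have : k * (2 * l%:Z - 2) <= v (x * (h - 1%:M) b c * y) * (2 * l%:Z - 2).
    by apply: ler_wpM2r; lia.
  lia.
have X0 (i : 'I_(2 * l)) b : inp 0 (emb_X i b).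
  rewrite mxE; repeat (case: ifP => _); try exact: inp0; try exact: inp_nat.
    by apply: inp_Mp; [exact: inp_nat|right; rewrite valV // val4].
  by apply: inp_Mp; [exact: inp_nat|right; rewrite vgam].
have Y0 (j : 'I_(2 * l)) b : inp 0 (emb_Y b j).
  rewrite mxE; repeat (case: ifP => _); try exact: inp0; try exact: inp_nat.
    by apply: inp_Mp; exact: inp_nat.
  by apply: inp_Mp; [exact: inp_nat|right; rewrite valV ?mulf_neq0 // pf_valM // vgam val2].
(* heights of the rows of emb_X and of the columns of emb_Y *)
pose hb (b : 'I_3) : int := (l%:Z - 1) * (1 - (b : nat)%:Z).
have Xh (i : 'I_(2 * l)) b : emb_X i b = 0 \/ hgt l i = hb b.
  have hi := ltn_ord i; rewrite mxE /hb /hgt; move: b; apply: ord3P; rewrite /= ?mul0r;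
  repeat (case: eqP => ?); rewrite ?mul0r; first [by left | right; case: ltnP => ?; lia].
have Yh (j : 'I_(2 * l)) b : emb_Y b j = 0 \/ hgt l j = hb b.
  have hj := ltn_ord j; rewrite mxE /hb /hgt; move: b; apply: ord3P; rewrite /= ?mul0r;
  repeat (case: eqP => ?); rewrite ?mul0r; first [by left | right; case: ltnP => ?; lia].
move=> i j.
have -> : (emb h - 1%:M) i j = \sum_b \sum_c emb_X i b * (h - 1%:M) b c * emb_Y c j.
  by rewrite mxE emb_entry !mxE; ring.
rewrite sum3 !sum3.
have one b c : wt l 2 i j (emb_X i b * (h - 1%:M) b c * emb_Y c j).
  have [->|ib] := Xh i b; first by left; rewrite !mul0r.
  have [->|jc] := Yh j c; first by left; rewrite mulr0.
  have [[bb cc]|nbc] := pselect (b = o2 /\ c = o0).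
    by apply: (vv _ _ _ _ _ _ 2) => //; rewrite ?bb ?cc // ib jc bb cc /hb /=; lia.
  apply: (vv _ _ _ _ _ _ (c <= b)%N%:Z) => //; rewrite ib jc /hb.
  move: nbc; move: b c {ib jc}; apply: ord3P; apply: ord3P => /= nbc; try lia.
  by case: nbc.
by repeat (exact: one || apply: wtD).
Qed.

Lemma emb_t3 y : emb (t3 y) = \matrix_(i, j) (if i == j then
  (if i == 0%N :> nat then y else if i == (2 * l).-1 :> nat then y^-1 else 1) else 0).
Proof.
apply/matrixP => i j; rewrite emb_entry !sum3 !mxE /= -val_eqE /=.
have hi := ltn_ord i; have hj := ltn_ord j.
rewrite !(mulr0n, mulr1n, subrr, subr0, mul0r, mulr0, add0r, addr0).
repeat (case: eqP => ?); rewrite ?eqxx /=; first [exfalso; lia | ring | idtac].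
Qed.

(** ** The element w^(l,1) *)

Definition wl_s (i : nat) : nat :=
  if i == 0%N then l.-2 else if (i < l.-1)%N then i.-1
  else if (i <= l)%N then i else if (i < (2 * l).-1)%N then i.+1 else l.+1.

Lemma wl_s_lt (i : 'I_(2 * l)) : (wl_s i < 2 * l)%N.
Proof. by have := ltn_ord i; rewrite /wl_s => hi; repeat (case: ifP => ?); lia. Qed.
Definition wl_o (i : 'I_(2 * l)) : 'I_(2 * l) := Ordinal (wl_s_lt i).

Lemma wl1E (i j : 'I_(2 * l)) : wl1 F l i j = (j == wl_o i)%:R.
Proof.
rewrite mxE -val_eqE /=; congr (_%:R); congr nat_of_bool.
have hi := ltn_ord i; have hj := ltn_ord j.
by rewrite /wl_s; repeat (case: ifP => ?); lia.
Qed.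

Lemma wl_o_inj : injective wl_o.
Proof.
move=> i j /(congr1 val) /= e; apply: val_inj; move: e.
have hi := ltn_ord i; have hj := ltn_ord j.
by rewrite /= /wl_s; repeat (case: ifP => ?); lia.
Qed.

Lemma wl_o_rev i : wl_o (rev_ord i) = rev_ord (wl_o i).
Proof.
apply: val_inj => /=; have hi := ltn_ord i.
by rewrite /= /wl_s; repeat (case: ifP => ?); lia.
Qed.

Lemma wl1_mul (A : M) i j : (wl1 F l *m A) i j = A (wl_o i) j.
Proof.
rewrite mxE (bigD1 (wl_o i)) //= wl1E eqxx mul1r big1 ?addr0 // => k ki.
by rewrite wl1E (negbTE ki) mul0r.
Qed.

Lemma mul_wl1T (A : M) i j : (A *m (wl1 F l)^T) i j = A i (wl_o j).
Proof.
have -> : A *m (wl1 F l)^T = (wl1 F l *m A^T)^T by rewrite trmx_mul trmxK.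
by rewrite mxE wl1_mul mxE.
Qed.

Lemma wl1_orth : wl1 F l *m (wl1 F l)^T = 1%:M.
Proof.
by apply/matrixP => i j; rewrite wl1_mul mxE wl1E (inj_eq wl_o_inj) mxE.
Qed.

Lemma star_wl1 : star (wl1 F l) = (wl1 F l)^T.
Proof.
apply/matrixP => i j; rewrite mxE wl1E [RHS]mxE wl1E.
by rewrite wl_o_rev (inj_eq rev_ord_inj).
Qed.

Definition wl_half (i : 'I_(2 * l)) : 'I_(2 * l) := if (i < l.-1)%N then wl_o i else i.

(* w^(l,1) is the product of a permutation matrix and its conjugate by the
   antidiagonal matrix. *)
Lemma det_wl1 : \det (wl1 F l) = 1.
Proof.
pose X : M := \matrix_(i, j) (j == wl_half i)%:R.
have Xm (A : M) i j : (X *m A) i j = A (wl_half i) j.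
  rewrite mxE (bigD1 (wl_half i)) //= mxE eqxx mul1r big1 ?addr0 // => k ki.
  by rewrite mxE (negbTE ki) mul0r.
have inj : injective wl_half.
  move=> i j; rewrite /wl_half; have hi := ltn_ord i; have hj := ltn_ord j.
  case: ifP => ci; case: ifP => cj //; first exact: wl_o_inj.
    by move=> /(congr1 val) /=; rewrite /wl_s; repeat (case: ifP => ?); lia.
  by move=> /(congr1 val) /=; rewrite /wl_s; repeat (case: ifP => ?); lia.
have XX : X *m X^T = 1%:M.
  by apply/matrixP => i j; rewrite Xm !mxE (inj_eq inj).
have -> : wl1 F l = X *m star X^T.
  apply/matrixP => i j; rewrite wl1E Xm !mxE; congr (_%:R); congr nat_of_bool.
  rewrite -!val_eqE /= /wl_half; have hi := ltn_ord i; have hj := ltn_ord j.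
  case: (ltnP i l.-1) => ci /=.
    have hs := wl_s_lt i.
    have -> : (2 * l - (wl_s i).+1 < l.-1)%N = false.
      by apply/negbTE; rewrite /wl_s; repeat (case: ifP => ?); lia.
    by rewrite /=; lia.
  case: ifP => cj /=; last by rewrite /wl_s; repeat (case: ifP => ?); lia.
  by rewrite /wl_s; repeat (case: ifP => ?); lia.
by rewrite det_mulmx det_star -det_mulmx XX det1.
Qed.

Lemma wl1_SO : SO (wl1 F l).
Proof. by apply/SOE; rewrite det_wl1 star_wl1; split=> //; apply: mulmx1C wl1_orth. Qed.

Lemma wl1_inv : invmx (wl1 F l) = (wl1 F l)^T.
Proof. by rewrite (SO_inv wl1_SO) star_wl1. Qed.

Definition Amx_inv : 'M[F]_4 :=
  mxs 4 [:: [:: 1; 0; 0; 0]; [:: 0; 2%:R; - (2%:R * gam)^-1; 0];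
            [:: 0; 2%:R; (2%:R * gam)^-1; 0]; [:: 0; 0; 0; 1]].

Lemma invAmx : invmx (Amx gam) = Amx_inv.
Proof.
have e : Amx gam *m Amx_inv = 1%:M.
  by apply/matrixP; apply: ord4P; apply: ord4P; rewrite mul4E !mxE /=; fld.
have Au : Amx gam \in unitmx by have [] := mulmx1_unit e.
by rewrite -[LHS]mulmx1 -e mulmxA mulVmx // mul1mx.
Qed.

(** The columns of [Amx], and with [emb_B] the rows of its inverse, that survive in Amx (x^sharp -
    1) Amx^-1: the second row and column of x^sharp - 1 vanish. *)
Definition emb_A : 'M[F]_(4, 3) := \matrix_(i, j) nth 0 (nth [::]
  [:: [:: 1; 0; 0]; [:: 0; 4%:R^-1; 0]; [:: 0; gam; 0]; [:: 0; 0; 1]] i) j.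
Definition emb_B : 'M[F]_(3, 4) := \matrix_(i, j) nth 0 (nth [::]
  [:: [:: 1; 0; 0; 0]; [:: 0; 2%:R; (2%:R * gam)^-1; 0]; [:: 0; 0; 0; 1]] i) j.

Lemma ent_ordinal m n (A : 'M[F]_(m, n)) (i : 'I_m) (j : 'I_n) : ent A i.+1 j.+1 = A i j.
Proof. by rewrite /ent /= !valK. Qed.

(** w^(l,1) carries the first, the two middle and the last indices to the central block of four in
    which [embed] is placed. Moving it to the right turns the argument of W into a lower unipotent
    times [emb h]. *)
Lemma wl1_embed h : wl1 F l *m embed l gam h = emb h *m wl1 F l.
Proof.
suff e : forall i j, embed l gam h (wl_o i) (wl_o j) = emb h i j.
  have -> : emb h = wl1 F l *m embed l gam h *m (wl1 F l)^T.
    by apply/matrixP => i j; rewrite mul_wl1T wl1_mul e.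
  by rewrite -mulmxA (mulmx1C wl1_orth) mulmx1.
have blk (i j : 'I_4) : ent (Amx gam *m sharp h *m Amx_inv) i.+1 j.+1 =
    (i == j)%:R + \sum_b \sum_c emb_A i b * (h - 1%:M) b c * emb_B c j.
  rewrite ent_ordinal !sum3 !mul4E !mxE /=.
  rewrite (@ent_ordinal _ _ h o0 o0) (@ent_ordinal _ _ h o0 o1) (@ent_ordinal _ _ h o0 o2).
  rewrite (@ent_ordinal _ _ h o1 o0) (@ent_ordinal _ _ h o1 o1) (@ent_ordinal _ _ h o1 o2).
  rewrite (@ent_ordinal _ _ h o2 o0) (@ent_ordinal _ _ h o2 o1) (@ent_ordinal _ _ h o2 o2).
  by move: i j; apply: ord4P; apply: ord4P; rewrite /=; fld.
pose sp (i : nat) := [|| i == 0%N, i == l.-1, i == l | i == (2 * l).-1].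
pose ix (i : nat) : 'I_4 := if i == 0%N then k0 else if i == l.-1 then k1 else if i == l then k2 else k3.
have win (i : 'I_(2 * l)) : (l.-1 <= (wl_s i).+1 <= l.+2)%N = sp i.
  by have hi := ltn_ord i; rewrite /sp /wl_s; repeat (case: ifP => ?); lia.
have wix (i : 'I_(2 * l)) : sp i -> ((wl_s i).+1 - (l - 2))%N = (ix i).+1.
  by have hi := ltn_ord i; rewrite /sp /ix /wl_s; repeat (case: ifP => ? /=); lia.
have Xix (i : 'I_(2 * l)) b : emb_X i b = if sp i then emb_A (ix i) b else 0.
  by rewrite !mxE /sp /ix; repeat (case: ifP => _); move: b; apply: ord3P => //=; ring.
have Yix (j : 'I_(2 * l)) b : emb_Y b j = if sp j then emb_B b (ix j) else 0.
  by rewrite !mxE /sp /ix; repeat (case: ifP => _); move: b; apply: ord3P => //=; ring.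
have ixj (i j : 'I_(2 * l)) : sp i -> sp j -> (i == j) = (ix i == ix j).
  rewrite -!val_eqE /= /sp /ix; repeat (case: ifP => ? /=); lia.
have inj (i j : 'I_(2 * l)) : ((wl_s i).+1 == (wl_s j).+1) = (i == j).
  by rewrite eqSS -(inj_eq wl_o_inj) -val_eqE.
move=> i j; rewrite /embed invAmx mxE /= !win inj emb_entry.
case si : (sp i); last first.
  by rewrite /= big1 ?addr0 // => b _; rewrite big1 // => c _; rewrite Xix si !mul0r.
case sj : (sp j); last first.
  by rewrite /= big1 ?addr0 // => b _; rewrite big1 // => c _; rewrite Yix sj mulr0.
rewrite /= !wix // blk (ixj _ _ si sj); congr (_ + _).
by apply: eq_bigr => b _; apply: eq_bigr => c _; rewrite Xix Yix si sj.
Qed.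

End Embedding.

(** * The Whittaker function *)

Section Torus.
Variables (F : padic_field) (l : nat).
Hypotheses (hl : (2 <= l)%N) (p2 : pf_p F != 2%N).
Local Notation v := (@pf_val F).
Local Notation SO := (@SOeven F l).
Local Notation M := 'M[F]_(2 * l).

Let n4 : (4%:R : F) != 0. Proof. exact: pf_char0. Qed.

(* Conjugation by diag(tor_d) turns chi on U into the inverse of psiU. *)
Definition tor_d (i : nat) : F :=
  if (i < l.-1)%N then (-1) ^+ i.+1 else if i == l.-1 then (-1) ^+ l / 4%:R
  else if i == l then (-1) ^+ l * 4%:R else (-1) ^+ i.

Lemma tor_dV (i : 'I_(2 * l)) : tor_d (rev_ord i) * tor_d i = 1.
Proof.
have hi := ltn_ord i; rewrite /tor_d /=.
have sq (k : nat) : (-1) ^+ k * (-1) ^+ k = 1 :> F by rewrite -exprMn mulrNN mulr1 expr1n.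
have od (j k : nat) : (j + k = 2 * l)%N -> (-1) ^+ j * (-1) ^+ k = 1 :> F.
  by move=> e; rewrite -exprD e mul2n -muln2 exprM sqrr_sign.
repeat (case: ifP => ?); try (exfalso; lia).
- by apply: od; lia.
- by rewrite -[RHS](sq l); field.
- by rewrite -[RHS](sq l); field.
- by apply: od; lia.
Qed.

Lemma tor_d_neq0 (i : 'I_(2 * l)) : tor_d i != 0.
Proof. by apply: contra_eq_neq (tor_dV i) => ->; rewrite mulr0 eq_sym oner_neq0. Qed.

Lemma val_sign k : v ((-1) ^+ k) = 0.
Proof. by rewrite valX ?oppr_eq0 ?oner_neq0 // valN1 mul0rn. Qed.

Lemma val_tor i : v (tor_d i) = 0.
Proof.
have s0 k : (-1) ^+ k != 0 :> F by rewrite expf_neq0 // oppr_eq0 oner_neq0.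
rewrite /tor_d; repeat (case: ifP => _); rewrite ?val_sign //.
  by rewrite val_div // val_sign val4.
by rewrite pf_valM // val_sign val4.
Qed.

Definition tor : M := \matrix_(i, j) if i == j then tor_d i else 0.

Lemma mul_tor (A : M) i j : (tor *m A) i j = tor_d i * A i j.
Proof.
rewrite mxE (bigD1 i) //= mxE eqxx big1 ?addr0 // => k ki.
by rewrite mxE eq_sym (negbTE ki) mul0r.
Qed.

Lemma mul_tor_r (A : M) i j : (A *m tor) i j = A i j * tor_d j.
Proof.
rewrite mxE (bigD1 j) //= mxE eqxx big1 ?addr0 // => k ki.
by rewrite mxE (negbTE ki) mulr0.
Qed.

Lemma star_tor_mul (A : M) i j : (star tor *m A) i j = tor_d (rev_ord i) * A i j.
Proof.
rewrite mxE (bigD1 i) //= !mxE eqxx big1 ?addr0 // => k ki.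
by rewrite !mxE (inj_eq rev_ord_inj) (negbTE ki) mul0r.
Qed.

Lemma star_tor_tor : star tor *m tor = 1%:M.
Proof.
apply/matrixP => i j; rewrite star_tor_mul !mxE.
by case: eqP => [->|_]; rewrite ?mulr0 // tor_dV.
Qed.

Lemma tor_star : tor *m star tor = 1%:M.
Proof. exact: mulmx1C star_tor_tor. Qed.

Lemma tor_SO : SO tor.
Proof.
apply/SOE; split; last exact: star_tor_tor.
(* The determinant cancels in [tor *m star e = e], since e and star e have the same nonzero
   determinant. *)
pose e : M := \matrix_(i, j) if i == j then (if (i < l)%N then tor_d i else 1) else 0.
have ee : tor *m star e = e.
  apply/matrixP => i j; rewrite mul_tor !mxE (inj_eq rev_ord_inj) eq_sym.
  case: eqP => [->|_]; last by rewrite mulr0.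
  have hj := ltn_ord j; rewrite /=; case: (ltnP j l) => cj.
    by rewrite ifF ?mulr1 //; lia.
  have -> : (2 * l - j.+1 < l)%N by lia.
  by rewrite mulrC; exact: (tor_dV j).
have d0 : \det e != 0.
  rewrite det_trig; last by apply/is_trig_mxP => i j ij; rewrite mxE -val_eqE (ltn_eqF ij).
  apply/prodf_neq0 => i _; rewrite mxE eqxx; case: ifP => _; rewrite ?oner_neq0 //.
  exact: tor_d_neq0.
by apply: (mulIf d0); rewrite mul1r -{2}ee det_mulmx det_star.
Qed.

Lemma tor_conjE (A : M) i j : (star tor *m A *m tor) i j = tor_d (rev_ord i) * A i j * tor_d j.
Proof. by rewrite mul_tor_r star_tor_mul. Qed.

Lemma tor_conj1 : star tor *m 1%:M *m tor = 1%:M.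
Proof. by rewrite mulmx1 star_tor_tor. Qed.

Lemma filt_tor r (A : M) : filt r A -> filt r (star tor *m A *m tor).
Proof.
move=> h i j; rewrite tor_conjE.
have [->|h'] := h i j; first by left; rewrite mulr0 mul0r.
have [->|A0] := eqVneq (A i j) 0; first by left; rewrite mulr0 mul0r.
right; rewrite !pf_valM ?mulf_neq0 ?tor_d_neq0 // !val_tor.
by rewrite add0r addr0.
Qed.

Lemma tor_conj_sub1 (A : M) : star tor *m A *m tor - 1%:M = star tor *m (A - 1%:M) *m tor.
Proof. by rewrite mulmxBr mulmxBl tor_conj1. Qed.

Lemma iwahori_tor g : iwahori_plus g -> iwahori_plus (star tor *m g *m tor).
Proof.
move=> /(iwahori_filt hl p2)[Sg h]; apply/(iwahori_filt hl p2); split.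
  have gS := SO_group F l; have St := tor_SO.
  apply: (mxg_M gS) => //; apply: (mxg_M gS) => //.
  by rewrite -(SO_inv St); apply: mxg_V.
by rewrite tor_conj_sub1; apply: filt_tor.
Qed.

(** The link between [g_chi] and SO_3. On the middle plane both sides are the reflection in the
    vector (1/4, gam): [tor] turns the coefficient a into 16 a = - 4 gam, which is the coefficient
    of that reflection. The proof compares entries at the four special indices and elsewhere. *)
Lemma tor_conj_gchi (w a : F) : w != 0 -> v w = 1 -> a != 0 -> v a = 0 ->
  tor *m g_chi l w a *m star tor = emb l (- (4%:R * a)) (t3 (- w^-1) *m w1 F).
Proof.
move=> w0 vw a0 va; have gam0 : - (4%:R * a) != 0 by rewrite oppr_eq0 mulf_neq0.
have n2 : (2%:R : F) != 0 by apply: pf_char0.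
set gam := - (4%:R * a).
have E1 : (l.-1 == 0%N) = false by lia.
have E2 : (l == 0%N) = false by lia.
have E3 : ((2 * l).-1 == 0%N) = false by lia.
have E4 : (l == l.-1) = false by lia.
have E5 : ((2 * l).-1 == l.-1) = false by lia.
have E6 : ((2 * l).-1 == l) = false by lia.
have td (j : 'I_(2 * l)) : tor_d (rev_ord j) = (tor_d j)^-1.
  by apply: inv_uniq_r; rewrite mulrC; exact: tor_dV.
pose e : F := (-1) ^+ l.
have e0 : e != 0 by rewrite expf_neq0 // oppr_eq0 oner_neq0.
have t0 : tor_d 0 = -1 by rewrite /tor_d ifT ?expr1 //; lia.
have t1 : tor_d l.-1 = e / 4%:R by rewrite /tor_d ltnn eqxx.
have t2 : tor_d l = e * 4%:R by rewrite /tor_d E4 eqxx ifF //; lia.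
have t3' : tor_d (2 * l).-1 = -1.
  rewrite /tor_d !ifF; try lia.
  by rewrite -signr_odd (_ : odd (2 * l).-1) ?expr1 //; lia.
have X (i : 'I_(2 * l)) : let x := emb_X l gam i in
    i = 0%N :> nat /\ [/\ x o0 = 1, x o1 = 0 & x o2 = 0] \/
    i = (2 * l).-1 :> nat /\ [/\ x o0 = 0, x o1 = 0 & x o2 = 1] \/
    i = l.-1 :> nat /\ [/\ x o0 = 0, x o1 = 4%:R^-1 & x o2 = 0] \/
    i = l :> nat /\ [/\ x o0 = 0, x o1 = gam & x o2 = 0] \/
    (i <> 0%N :> nat /\ i <> (2 * l).-1 :> nat /\ i <> l.-1 :> nat /\ i <> l :> nat) /\
      [/\ x o0 = 0, x o1 = 0 & x o2 = 0].
  rewrite /= !mxE; have [ei|n0] := eqVneq (nat_of_ord i) 0%N; first by left; rewrite ei.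
  have [ei|n3] := eqVneq (nat_of_ord i) (2 * l).-1.
    by right; left; rewrite ei E5 E6 /= ?mul0r.
  have [ei|n1] := eqVneq (nat_of_ord i) l.-1.
    by do 2 right; left; split=> //; split; rewrite /= ?mul0r ?mul1r.
  have [ei|n2'] := eqVneq (nat_of_ord i) l.
    by do 3 right; left; split=> //; split; rewrite /= ?mul0r ?mul1r.
  by do 4 right; split=> //; do 3 (split; first by apply/eqP); apply/eqP.
have Y (j : 'I_(2 * l)) : let y b := emb_Y l gam b j in
    j = 0%N :> nat /\ [/\ y o0 = 1, y o1 = 0 & y o2 = 0] \/
    j = (2 * l).-1 :> nat /\ [/\ y o0 = 0, y o1 = 0 & y o2 = 1] \/
    j = l.-1 :> nat /\ [/\ y o0 = 0, y o1 = 2%:R & y o2 = 0] \/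
    j = l :> nat /\ [/\ y o0 = 0, y o1 = (2%:R * gam)^-1 & y o2 = 0] \/
    (j <> 0%N :> nat /\ j <> (2 * l).-1 :> nat /\ j <> l.-1 :> nat /\ j <> l :> nat) /\
      [/\ y o0 = 0, y o1 = 0 & y o2 = 0].
  rewrite /= !mxE; have [ei|n0] := eqVneq (nat_of_ord j) 0%N; first by left; rewrite ei.
  have [ei|n3] := eqVneq (nat_of_ord j) (2 * l).-1.
    by right; left; rewrite ei E5 E6 /= ?mul0r.
  have [ei|n1] := eqVneq (nat_of_ord j) l.-1.
    by do 2 right; left; split=> //; split; rewrite /= ?mul0r ?mul1r.
  have [ei|n2'] := eqVneq (nat_of_ord j) l.
    by do 3 right; left; split=> //; split; rewrite /= ?mul0r ?mul1r.
  by do 4 right; split=> //; do 3 (split; first by apply/eqP); apply/eqP.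
apply/matrixP => i j.
have -> : (tor *m g_chi l w a *m star tor) i j = tor_d i * g_chi l w a i j / tor_d j.
  rewrite mxE (bigD1 j) //= mul_tor !mxE eqxx td big1 ?addr0 // => k kj.
  by rewrite [star tor _ _]mxE [tor _ _]mxE (inj_eq rev_ord_inj) eq_sym (negbTE kj) mulr0.
rewrite (g_chiE hl p2 w0 vw a0 va) emb_entry !sum3.
have hi := ltn_ord i; have hj := ltn_ord j.
have -> : t3 (- w^-1) *m w1 F - 1%:M =
    mxs 3 [:: [:: -1; 0; - w^-1]; [:: 0; - 2%:R; 0]; [:: - w; 0; -1]].
  by apply: eq_mx3; rewrite mxE mul3E !mxE /= ?invrN ?invrK; ring.
rewrite ![mxs _ _ _ _]mxE /= -!val_eqE /=.
have dj := tor_d_neq0 j.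
have tt1 : true%:R = 1 :> F by [].
have Xi := X i; have Yj := Y j; have gi := gc_cases l w a i; move: Xi Yj gi; clear X Y.
case=> [|[|[|[|]]]] -[ei [-> -> ->]];
(case=> [|[|[|[|]]]] -[ej [-> -> ->]]);
(case=> [|[|[|[|]]]] -[ei' [-> ->]]; try (exfalso; clear -ei ei' hl; lia));
(case: eqP => d1; try (exfalso; clear -ei ej d1 hl; lia));
(case: eqP => d2; try (exfalso; clear -ei ej d1 d2 hl; lia));
rewrite ?ei ?ej ?t0 ?t1 ?t2 ?t3' ?(mulr0, mul0r, addr0, add0r) /gam.
all: rewrite ?tt1 ?invrN1 ?invfM ?invrN ?invrK; try (by clear -e0 w0 a0 n2 n4; fld).
by rewrite (val_inj d2) mulr1 divff.
Qed.

End Torus.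

Lemma cancel_sign (K : fieldType) (e x : K) : (4%:R : K) != 0 -> e != 0 ->
  e / 4%:R / - e * x = - (4%:R^-1 * x).
Proof.
by move=> n4 e0; rewrite invrN mulrN mulNr; congr (- (_ * _)); rewrite mulrAC divff // mul1r.
Qed.

Lemma cancel_sign' (K : fieldType) (e a s x y z t : K) : (4%:R : K) != 0 -> e != 0 ->
  - s - 4%:R^-1 * x + a * (e * 4%:R / - e * y) + z * (t * 0) =
  - (s + 4%:R^-1 * x - - (4%:R * a) * y).
Proof. by move=> n4 e0; rewrite invrN mulrN [e * _ / e]mulrAC divff // mul1r; ring. Qed.

(** * The unipotent group, its character and the Jacquet integral *)

Section Unipotent.
Variables (F : padic_field) (l : nat).
Hypotheses (hl : (2 <= l)%N) (p2 : pf_p F != 2%N).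
Local Notation SO := (@SOeven F l).
Local Notation U := (@Ueven F l).
Local Notation M := 'M[F]_(2 * l).
Local Notation tor := (tor F l).

Let n2 : (2%:R : F) != 0. Proof. exact: pf_char0. Qed.
Let n4 : (4%:R : F) != 0. Proof. exact: pf_char0. Qed.

Lemma U_below u (i j : 'I_(2 * l)) : U u -> (j < i)%N -> u i j = 0.
Proof. by move=> [_ h] ji; rewrite h ?(ltnW ji) // -val_eqE gtn_eqF. Qed.

Lemma U_diag u (i : 'I_(2 * l)) : U u -> u i i = 1.
Proof. by move=> [_ h]; rewrite h // eqxx. Qed.

Lemma U_group : mx_group U.
Proof.
split=> [g [/SO_unit]//||g h Ug Uh|g [Sg hg]].
- by split=> [|i j _]; [exact: mxg_1 (SO_group F l)|rewrite mxE].
- split; first exact: (mxg_M (SO_group F l) Ug.1 Uh.1).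
  move=> i j ji; rewrite mxE (bigD1 i) //= U_diag // mul1r Uh.2 // big1 ?addr0 // => k ki.
  have [lt|gt] := ltnP k i; first by rewrite (U_below Ug) // mul0r.
  by rewrite (U_below Uh) ?mulr0 //; move: ki; rewrite -val_eqE /=; lia.
split; first exact: (mxg_V (SO_group F l) Sg).
move=> i j ji; rewrite (SO_inv Sg) mxE hg ?(inj_eq rev_ord_inj) ?[j == i]eq_sym //.
by rewrite /=; lia.
Qed.

Lemma U_mul1 u x (i j : 'I_(2 * l)) : U u -> U x -> j = i.+1 :> nat ->
  (u *m x) i j = u i j + x i j.
Proof.
move=> Uu Ux ij; rewrite mxE (bigD1 i) //= (bigD1 j) /=; last first.
  by rewrite -val_eqE /= ij; lia.
rewrite !U_diag // mul1r mulr1 big1 ?addr0 1?addrC // => k /andP[ki kj].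
have [lt|gt] := ltnP k i; first by rewrite (U_below Uu) // mul0r.
by rewrite (U_below Ux) ?mulr0 //; move: ki kj; rewrite -!val_eqE /=; lia.
Qed.

Lemma U_mul2 u x (i k j : 'I_(2 * l)) : U u -> U x -> k = i.+1 :> nat -> j = k.+1 :> nat ->
  (u *m x) i j = u i j + u i k * x k j + x i j.
Proof.
move=> Uu Ux ik kj; rewrite mxE (bigD1 i) //= (bigD1 k) /=; last first.
  by rewrite -val_eqE /= ik; lia.
rewrite (bigD1 j) /=; last by rewrite -!val_eqE /= kj ik; lia.
rewrite !U_diag // mul1r mulr1 big1 => [|m /andP[/andP[mi mk] mj]]; first ring.
have [lt|gt] := ltnP m i; first by rewrite (U_below Uu) // mul0r.
by rewrite (U_below Ux) ?mulr0 //; move: mi mk mj; rewrite -!val_eqE /=; lia.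
Qed.

(** This position belongs to no root: orthogonality gives twice the entry equal to 0. Hence the
    entry (l-1, l+1), two places off the diagonal, is additive on U, as [psiU] requires. *)
Lemma U_mid u (i j : 'I_(2 * l)) : U u -> i = l.-1 :> nat -> j = l :> nat -> u i j = 0.
Proof.
move=> Uu il jl; have [_ /matrixP/(_ i j)] := (SOE u).1 Uu.1.
have ri : rev_ord i = j by apply: val_inj; rewrite /= il jl; lia.
have rj : rev_ord j = i by rewrite -ri rev_ordK.
rewrite mxE (bigD1 i) //= (bigD1 j) /=; last by rewrite -val_eqE /= il jl; lia.
rewrite big1 => [|k /andP[ki kj]]; last first.
  rewrite mxE ri; have [lt|gt] := ltnP k i; last first.
    by rewrite (U_below Uu (_ : j < k)%N) ?mulr0 //; move: ki kj; rewrite -!val_eqE /=; lia.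
  by rewrite (U_below Uu (_ : (j < rev_ord k)%N)) ?mul0r //=; lia.
rewrite !mxE ri rj !U_diag // -val_eqE /= il jl.
have -> : (l.-1 == l) = false by lia.
rewrite mul1r mulr1 addr0 => /eqP; rewrite -mulr2n -mulr_natl mulf_eq0 (negbTE n2).
by move/eqP.
Qed.

Definition Uint : set M := [set u | U u /\ mx_inp 0 u]%classic.

Lemma mx_inp_star k (g : M) : mx_inp k g -> mx_inp k (star g).
Proof. by move=> h i j; rewrite mxE. Qed.

Lemma Uint_sub : (Uint `<=` U)%classic. Proof. by move=> u []. Qed.

Lemma Uint_group : mx_group Uint.
Proof.
split=> [g [/(mxg_unit U_group)]//||g h [Ug hg] [Uh hh]|g [Ug hg]].
- by split; [exact: mxg_1 U_group|exact: mx_inp1].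
- split; first exact: (mxg_M U_group).
  by rewrite -(addr0 (0 : int)); apply: mx_inpM.
- by split; [exact: (mxg_V U_group)|rewrite (SO_inv Ug.1); apply: mx_inp_star].
Qed.

Lemma Uint_iwahori u : Uint u -> iwahori_plus u.
Proof.
move=> [Uu hu]; split; first exact: Uu.1.
move=> i j; have [ji|ij] := leqP j i; first by rewrite Uu.2 // subrr; apply: inp0.
by rewrite -val_eqE (ltn_eqF ij) subr0; apply: hu.
Qed.

Lemma mx_inp_tor k (A : M) : mx_inp k (star tor *m A) <-> mx_inp k A.
Proof.
have e : 0 + k = k by rewrite add0r.
have it : mx_inp 0 tor.
  move=> i j; rewrite mxE; case: eqP => _; last exact: inp0.
  by right; rewrite val_tor.
split=> h; last by rewrite -e; apply: mx_inpM => //; apply: mx_inp_star.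
by rewrite -[A]mul1mx -(tor_star hl p2) -mulmxA -e; apply: mx_inpM.
Qed.

Variables (R : realType) (w a : F) (psi : F -> R[i]).
Hypotheses (w0 : w != 0) (vw : pf_val w = 1) (a0 : a != 0) (va : pf_val a = 0).
Hypothesis psi1 : level1_character psi.
Local Notation C := R[i].
Local Notation gam := (- (4%:R * a)).
Local Notation chi := (affine_generic w a psi).

Definition uform (u : M) : F :=
  \sum_(1 <= i < l.-1) ent u i i.+1 + 4%:R^-1 * ent u l.-1 l - gam * ent u l.-1 l.+1.

Let el1 : l.-1 = l.-2.+1. Proof. lia. Qed.
Let el : l = l.-2.+2. Proof. lia. Qed.

Lemma uformM u x : U u -> U x -> uform (u *m x) = uform u + uform x.
Proof.
move=> Uu Ux; have E i : (i.+1 < 2 * l)%N ->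
    ent (u *m x) i.+1 i.+2 = ent u i.+1 i.+2 + ent x i.+1 i.+2.
  by move=> hi; rewrite !(ent_ord _ (ltnW hi) hi) U_mul1.
have E1 : ent (u *m x) l.-1 l = ent u l.-1 l + ent x l.-1 l.
  by have := E l.-2; rewrite -el -el1; apply; lia.
have E2 : ent (u *m x) l.-1 l.+1 = ent u l.-1 l.+1 + ent x l.-1 l.+1.
  have h1 : (l.-2 < 2 * l)%N by lia.
  have h2 : (l < 2 * l)%N by lia.
  have h3 : (l.-1 < 2 * l)%N by lia.
  rewrite el1 !(ent_ord _ h1 h2) (U_mul2 (k := Ordinal h3)) //=; last by lia.
  by rewrite (U_mid Ux (i := Ordinal h3)) //= mulr0 addr0.
rewrite /uform E1 E2; have -> : \sum_(1 <= i < l.-1) ent (u *m x) i i.+1 =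
    \sum_(1 <= i < l.-1) ent u i i.+1 + \sum_(1 <= i < l.-1) ent x i i.+1.
  rewrite -big_split /=; apply: eq_big_nat => -[//|i] /andP[_ hi].
  by apply: E; lia.
ring.
Qed.

Lemma psiUM u x : U u -> U x -> psiU psi gam (u *m x) = psiU psi gam u * psiU psi gam x.
Proof. by move=> Uu Ux; rewrite /psiU -!/(uform _) uformM // (psiD psi1). Qed.

Lemma psiU_neq0 (u : M) : psiU psi gam u != 0.
Proof. exact: (psi_neq0 psi1). Qed.

Lemma psiU1 : psiU psi gam (1%:M : M) = 1.
Proof.
apply: (mulfI (psiU_neq0 1%:M)); rewrite -psiUM ?mulmx1 ?mulr1 //; exact: mxg_1 U_group.
Qed.

(** The signs and the factors 4 of [tor_d] are made for this: the relevant ratios are -1 along the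
    first entries, then -1/4 and -4, and - 4 a = gam. The affine entry vanishes on upper triangular
    matrices. *)
Lemma aff_form_tor u : U u -> aff_form w a (star tor *m u *m tor) = - uform u.
Proof.
move=> Uu; have E i j (hi : (i < 2 * l)%N) (hj : (j < 2 * l)%N) :
    ent (star tor *m u *m tor) i.+1 j.+1 = tor_d F l j / tor_d F l i * ent u i.+1 j.+1.
  rewrite !ent_ord tor_conjE mulrAC; congr (_ * _).
  rewrite mulrC; congr (_ * _); apply: inv_uniq_r.
  by rewrite mulrC (tor_dV hl p2 (Ordinal hi)).
have s0 (k : nat) : ((-1) ^+ k : F) != 0 by rewrite expf_neq0 // oppr_eq0 oner_neq0.
have t2 : tor_d F l l.-2 = - (-1) ^+ l.
  by rewrite /tor_d ifT; [rewrite [in RHS]el !exprS; ring|lia].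
have t1 : tor_d F l l.-1 = (-1) ^+ l / 4%:R by rewrite /tor_d ltnn eqxx.
have t0 : tor_d F l l = (-1) ^+ l * 4%:R.
  by rewrite /tor_d ifF; [rewrite ifF ?eqxx //|]; lia.
have tS i : (i.+1 < l.-1)%N -> tor_d F l i.+1 / tor_d F l i = -1.
  move=> hi; rewrite /tor_d !ifT; [|lia|lia].
  by rewrite [_ ^+ i.+2]exprS mulfK.
have h1 : (l.-2 < 2 * l)%N by lia.
have h2 : (l < 2 * l)%N by lia.
have h3 : (l.-1 < 2 * l)%N by lia.
have h4 : ((2 * l).-2 < 2 * l)%N by lia.
have h5 : (0 < 2 * l)%N by lia.
rewrite /aff_form /uform.
have -> : (2 * l).-1 = (2 * l).-2.+1 by lia.
rewrite (E _ _ h4 h5) (ent_ord u h4 h5) (U_below Uu) /=; last by lia.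
have EA := E _ _ h1 h2; rewrite -el1 in EA.
have eS : \sum_(1 <= i < l) ent (star tor *m u *m tor) i i.+1 =
    - \sum_(1 <= i < l.-1) ent u i i.+1 - 4%:R^-1 * ent u l.-1 l.
  have recr (G : nat -> F) : \sum_(1 <= i < l) G i = \sum_(1 <= i < l.-1) G i + G l.-1.
    by rewrite {1}(_ : l = l.-1.+1) ?big_nat_recr //=; lia.
  rewrite recr; congr (_ + _).
    rewrite -sumrN; apply: eq_big_nat => -[//|i] /andP[_ hi].
    have hi1 : (i < 2 * l)%N by lia.
    have hi2 : (i.+1 < 2 * l)%N by lia.
    by rewrite (E _ _ hi1 hi2) tS // mulN1r.
  have := E _ _ h1 h3; rewrite -el1 t1 t2.
  have -> : l.-1.+1 = l by lia.
  by move=> ->; exact: (cancel_sign _ n4 (s0 l)).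
by rewrite eS EA t0 t2; exact: (cancel_sign' _ _ _ _ _ _ n4 (s0 l)).
Qed.

Lemma chi_tor u : U u -> chi (star tor *m u *m tor) = (psiU psi gam u)^-1.
Proof.
move=> Uu; rewrite /affine_generic -/(aff_form w a _) aff_form_tor //.
by rewrite (psiN psi1) /psiU -/(uform u).
Qed.

(* [is_haar_int] integrates right invariant functions, whence the inverse of u. *)
Definition jac_integrand (f : M -> C) (u : M) : C :=
  psiU psi gam (invmx u) * f (star tor *m invmx u).

Lemma jac_invariant f u k :
  (forall h x, iwahori_plus h -> SO x -> f (h *m x) = chi h * f x) ->
  U u -> Uint k -> jac_integrand f (u *m k) = jac_integrand f u.
Proof.
move=> fI Uu Ik; have Uk := Ik.1; have IVk := mxg_V Uint_group Ik.
have UVu := mxg_V U_group Uu.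
rewrite /jac_integrand invmxM ?(mxg_unit U_group) // psiUM //; last exact: IVk.1.
have -> : star tor *m (invmx k *m invmx u) =
    (star tor *m invmx k *m tor) *m (star tor *m invmx u).
  by rewrite !mulmxA -[_ *m tor *m star tor]mulmxA tor_star // mulmx1.
rewrite fI; first last.
- apply: (mxg_M (SO_group F l)) (UVu.1); rewrite -(SO_inv (tor_SO hl p2)).
  exact/(mxg_V (SO_group F l))/(tor_SO hl p2).
- by apply: iwahori_tor => //; apply: Uint_iwahori.
rewrite chi_tor //; last exact: IVk.1.
by rewrite mulrACA divff ?mul1r ?psiU_neq0.
Qed.

(** Bounded support of f confines u to finitely many cosets of [Uint], so the Jacquet integral is a
    finite sum. *)
Lemma jac_exists f k :
  (forall h x, iwahori_plus h -> SO x -> f (h *m x) = chi h * f x) ->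
  (forall x, f x != 0 -> mx_inp k x) ->
  exists S, is_haar_int U Uint (jac_integrand f) S.
Proof.
move=> fI fk; apply: (haar_fin U_group Uint_group (k := k) (M := - k)) => [g h Gg Kh|g Gg|g h Gg Gh hg hh].
- exact: jac_invariant.
- rewrite /jac_integrand mulf_eq0 negb_or => /andP[_ /fk] /mx_inp_tor.
  by rewrite (SO_inv Gg.1) => /mx_inp_star; rewrite starK.
move=> hgh; split; first exact: (mxg_M U_group (mxg_V U_group Gg) Gh).
have -> : invmx g *m h = 1%:M - invmx g *m (g - h).
  by rewrite mulmxBr mulVmx ?(mxg_unit U_group) // opprB addrC subrK.
apply: mx_inpB; first exact: mx_inp1.
rewrite -(subrr k); apply: mx_inpM => //.
by rewrite (SO_inv Gg.1); apply: mx_inp_star.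
Qed.

(** Left invariance of the Haar measure on U; this is the source of the Whittaker equivariance. *)
Lemma jac_translate f u0 S : U u0 -> is_haar_int U Uint (jac_integrand f) S ->
  is_haar_int U Uint (jac_integrand (fun h => f (h *m u0))) ((psiU psi gam u0)^-1 * S).
Proof.
move=> Uu0 hS; have UV := mxg_V U_group Uu0.
apply: haar_ext (haarZ _ (haar_translate U_group UV hS)); [exact: U_group|exact: Uint_sub|].
move=> u Uu; have UVu := mxg_V U_group Uu.
have nu := mxg_unit U_group Uu; have n0 := mxg_unit U_group Uu0.
rewrite /jac_integrand invmxM ?unitmx_inv // invmxK psiUM // mulmxA.
by rewrite [psiU _ _ (invmx u) * _]mulrC -!mulrA mulKf ?psiU_neq0.
Qed.

End Unipotent.

(** * The group R^(l,1) *)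

Section LowerUnipotent.
Variables (F : padic_field) (l : nat).
Hypotheses (hl : (2 <= l)%N) (p2 : pf_p F != 2%N).
Local Notation M := 'M[F]_(2 * l).
Implicit Type r : 'cV[F]_(l - 2).

(** The nilpotent part: skew for [star] and of square zero, which is why 1 + N is orthogonal. *)
Definition Rl1_N r : M := Rl1 r - 1%:M.

Lemma Rl1_NE r (i j : 'I_(2 * l)) : Rl1_N r i j =
  if (j == 0%N :> nat) && (0 < i < l.-1)%N then ent r i 1
  else if (i == (2 * l).-1 :> nat) && (l < j < (2 * l).-1)%N
  then - ent r ((2 * l).-1 - j)%N 1 else 0.
Proof.
have hi := ltn_ord i; have hj := ltn_ord j.
rewrite /Rl1_N /Rl1 /mx1 !mxE -val_eqE eqSS; case: eqP => ij.
  rewrite subrr; case: ifP => [|_]; first by lia.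
  by case: ifP => //; lia.
rewrite subr0; repeat (case: ifP => ?); try (exfalso; lia); rewrite // ?subn1 //.
by congr (- ent r _ 1); lia.
Qed.

Lemma star_Rl1_N r : star (Rl1_N r) = - Rl1_N r.
Proof.
apply/matrixP => i j; have hi := ltn_ord i; have hj := ltn_ord j.
rewrite mxE [RHS]mxE !Rl1_NE /=.
repeat (case: ifP => ?); try (exfalso; lia); rewrite ?opprK ?oppr0 //.
  by congr ent; lia.
by congr (- ent r _ 1); lia.
Qed.

Lemma Rl1_N_sq r : Rl1_N r *m Rl1_N r = 0.
Proof.
apply/matrixP => i j; rewrite mxE [RHS]mxE big1 // => k _.
have hk := ltn_ord k; rewrite !Rl1_NE.
by repeat (case: ifP => ?); rewrite ?mulr0 ?mul0r //; exfalso; lia.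
Qed.

Lemma Rl1_split r : Rl1 r = 1%:M + Rl1_N r.
Proof. by rewrite /Rl1_N addrC subrK. Qed.

Lemma Rl1_SO r : SOeven (Rl1 r).
Proof.
apply/SOE; split; last first.
  rewrite Rl1_split starD star1 star_Rl1_N mulmxDl mul1mx mulmxDr mulmx1 mulNmx Rl1_N_sq.
  by rewrite oppr0 addr0 -addrA subrr addr0.
rewrite det_trig; last first.
  apply/is_trig_mxP => i j ij; have hi := ltn_ord i; have hj := ltn_ord j.
  rewrite Rl1_split mxE Rl1_NE mxE -val_eqE (ltn_eqF ij) add0r.
  do 2 (case: ifP => ?; first by exfalso; lia).
  by [].
rewrite big1 // => i _; rewrite Rl1_split mxE Rl1_NE mxE eqxx.
have hi := ltn_ord i.
do 2 (case: ifP => ?; first by exfalso; lia).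
by rewrite addr0.
Qed.

(** The heights involved differ by at most l - 2, whereas an entry in p contributes 2l - 2. *)
Lemma Rl1_filt r : mx_inp 1 r -> filt 2 (Rl1 r - 1%:M).
Proof.
move=> hr; have er i j : ent r i j = 0 \/ 1 <= pf_val (ent r i j).
  rewrite /ent; case: insub => [x|]; last by left.
  by case: insub => [y|]; [exact: hr|left].
move=> i j; have hi := ltn_ord i; have hj := ltn_ord j.
rewrite -/(Rl1_N r) Rl1_NE; case: ifP => h1.
  have [->|h] := er i 1%N; first by left.
  by right; rewrite /hgt; case: ltnP => a; case: ltnP => b; nia.
case: ifP => h2; last by left.
have [->|h] := er ((2 * l).-1 - j)%N 1%N; first by left; rewrite oppr0.
by right; rewrite valN /hgt; case: ltnP => a; case: ltnP => b; nia.
Qed.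

Lemma Rl1_0 : Rl1 (0 : 'cV[F]_(l - 2)) = 1%:M.
Proof.
rewrite Rl1_split; apply/matrixP => i j; rewrite mxE Rl1_NE.
have e0 k : ent (0 : 'cV[F]_(l - 2)) k 1 = 0.
  by rewrite /ent; case: insub => // x; case: insub => // y; rewrite mxE.
by rewrite !e0 oppr0 !if_same addr0.
Qed.

End LowerUnipotent.

(** * The function supported on Z <g_chi> I^+ *)

Section TestVector.
Variables (F : padic_field) (R : realType) (l : nat).
Hypotheses (hl : (2 <= l)%N) (p2 : pf_p F != 2%N) (l3 : (3 <= l)%N).
Variables (w a : F) (psi : F -> R[i]) (om sg : R[i]).
Hypotheses (w0 : w != 0) (vw : pf_val w = 1) (a0 : a != 0) (va : pf_val a = 0).
Hypotheses (psi1 : level1_character psi) (om2 : om ^+ 2 = 1) (sg2 : sg ^+ 2 = 1).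
Local Notation C := R[i].
Local Notation SO := (@SOeven F l).
Local Notation I := (@iwahori_plus F l).
Local Notation M := 'M[F]_(2 * l).
Local Notation gam := (- (4%:R * a)).
Local Notation chi := (affine_generic w a psi).
Local Notation g := (g_chi l w a).

Let gam0 : gam != 0. Proof. by rewrite oppr_eq0 mulf_neq0 // pf_char0. Qed.
Let vgam : pf_val gam = 0. Proof. by rewrite valN pf_valM // ?pf_char0 // val4 // va. Qed.
Let IG : mx_group I. Proof. exact: iwahori_group. Qed.
Let SG : mx_group SO. Proof. exact: SO_group. Qed.

Lemma SO3_gchi : SO3 gam (t3 (- w^-1) *m w1 F).
Proof.
apply: (mxg_M (SO3_group gam)); last exact: (w1_SO gam).
by apply: t3_SO; rewrite oppr_eq0 invr_eq0.
Qed.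

Lemma gchi_tor : g = star (tor F l) *m emb l gam (t3 (- w^-1) *m w1 F) *m tor F l.
Proof.
rewrite -(tor_conj_gchi hl p2 w0 vw a0 va) !mulmxA star_tor_tor // mul1mx.
by rewrite -mulmxA star_tor_tor // mulmx1.
Qed.

Lemma gchi_SO : SO g.
Proof.
have St := tor_SO hl p2; rewrite gchi_tor; apply: (mxg_M SG) => //.
apply: (mxg_M SG); last by apply: emb_SO => //; exact: SO3_gchi.
by rewrite -(SO_inv St); apply: (mxg_V SG).
Qed.

Lemma gchiK (x : M) : g *m (g *m x) = x.
Proof. by rewrite mulmxA (gchi_sq hl p2 w0 vw a0 va) mul1mx. Qed.

Lemma iwahori_mull h x : I h -> (I (h *m x) <-> I x).
Proof.
move=> Ih; split=> Ix; last exact: (mxg_M IG).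
by rewrite -[x](mulKmx (mxg_unit IG Ih)); apply: (mxg_M IG) => //; apply: (mxg_V IG).
Qed.

Lemma iwahori_mulr h x : I h -> (I (x *m h) <-> I x).
Proof.
move=> Ih; split=> Ix; last exact: (mxg_M IG).
by rewrite -[x](mulmxK (mxg_unit IG Ih)); apply: (mxg_M IG) => //; apply: (mxg_V IG).
Qed.

Lemma iwahori_conj x : I (g *m x *m g) <-> I x.
Proof.
split=> Ix; last by apply: iwahori_gchi => //; exact: gchi_SO.
have := iwahori_gchi hl p2 w0 vw a0 va gchi_SO Ix.
by rewrite !mulmxA (gchi_sq hl p2 w0 vw a0 va) mul1mx -mulmxA (gchi_sq hl p2 w0 vw a0 va) mulmx1.
Qed.

Definition chi0 (x : M) : C := indic R I x * chi x.
Definition chi_pm (x : M) : C := chi0 x + om * chi0 (- x).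
(** Symmetrisation of chi, extended by 0, over {1, -1} and over <g_chi>. As conjugation by [g_chi]
    preserves chi, the function is equivariant on both sides. *)
Definition test_fun (x : M) : C := chi_pm x + sg * chi_pm (g *m x).

Lemma chi0_l h x : I h -> chi0 (h *m x) = chi h * chi0 x.
Proof.
move=> Ih; rewrite /chi0 (indic_eq R (iwahori_mull x Ih)).
have [Ix|nI] := pselect (I x); last by rewrite indicF // !mul0r mulr0.
by rewrite affine_genericM // mulrCA.
Qed.

Lemma chi0_r h x : I h -> chi0 (x *m h) = chi0 x * chi h.
Proof.
move=> Ih; rewrite /chi0 (indic_eq R (iwahori_mulr x Ih)).
have [Ix|nI] := pselect (I x); last by rewrite indicF // !mul0r.
by rewrite affine_genericM // mulrA.
Qed.

Lemma chi0_conj x : chi0 (g *m x *m g) = chi0 x.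
Proof.
rewrite /chi0 (indic_eq R (iwahori_conj x)).
have [Ix|nI] := pselect (I x); last by rewrite indicF // !mul0r.
by rewrite affine_generic_gchi.
Qed.

Lemma chi_pm_l h x : I h -> chi_pm (h *m x) = chi h * chi_pm x.
Proof. by move=> Ih; rewrite /chi_pm -mulmxN !chi0_l //; ring. Qed.

Lemma chi_pm_r h x : I h -> chi_pm (x *m h) = chi_pm x * chi h.
Proof. by move=> Ih; rewrite /chi_pm -mulNmx !chi0_r //; ring. Qed.

Lemma chi_pm_conj x : chi_pm (g *m x *m g) = chi_pm x.
Proof. by rewrite /chi_pm -mulNmx -mulmxN !chi0_conj. Qed.

Lemma chi_pmN x : chi_pm (- x) = om * chi_pm x.
Proof. by rewrite /chi_pm opprK mulrDr mulrA -expr2 om2 mul1r addrC. Qed.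

Lemma test_fun_l h x : I h -> test_fun (h *m x) = chi h * test_fun x.
Proof.
move=> Ih; rewrite /test_fun chi_pm_l //.
have -> : g *m (h *m x) = (g *m h *m g) *m (g *m x).
  by rewrite -[RHS]mulmxA gchiK mulmxA.
rewrite chi_pm_l; last exact/iwahori_conj.
by rewrite affine_generic_gchi //; ring.
Qed.

Lemma test_fun_r h x : I h -> test_fun (x *m h) = test_fun x * chi h.
Proof. by move=> Ih; rewrite /test_fun mulmxA (chi_pm_r _ Ih) (chi_pm_r _ Ih); ring. Qed.

Lemma test_fun_gl x : test_fun (g *m x) = sg * test_fun x.
Proof. by rewrite /test_fun gchiK [RHS]mulrDr [sg * (sg * _)]mulrA -(expr2 sg) sg2 mul1r addrC. Qed.

Lemma test_fun_gr x : test_fun (x *m g) = sg * test_fun x.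
Proof.
rewrite /test_fun mulmxA chi_pm_conj -[in chi_pm (x *m g)](gchiK x) chi_pm_conj.
by rewrite [RHS]mulrDr [sg * (sg * _)]mulrA -(expr2 sg) sg2 mul1r addrC.
Qed.

Lemma test_funN x : test_fun (- x) = om * test_fun x.
Proof. by rewrite /test_fun mulmxN !chi_pmN; ring. Qed.

Lemma test_fun_supp x : test_fun x != 0 ->
  (I x \/ I (- x)) \/ (I (g *m x) \/ I (- (g *m x))).
Proof.
have n0 y : ~ I y -> chi0 y = 0 by move=> nI; rewrite /chi0 indicF // mul0r.
move=> h; have [?|n1] := pselect (I x); first by left; left.
have [?|n2] := pselect (I (- x)); first by left; right.
have [?|n3] := pselect (I (g *m x)); first by right; left.
have [?|n4] := pselect (I (- (g *m x))); first by right; right.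
by move: h; rewrite /test_fun /chi_pm !n0 // !(mulr0, addr0) eqxx.
Qed.

Lemma iwahori_diag x (i : 'I_(2 * l)) : I x -> inp 1 (x i i - 1).
Proof. by case=> _ /(_ i i); rewrite leqnn eqxx. Qed.

Lemma iwahori_sign (x : M) (i : 'I_(2 * l)) : x i i = 1 -> ~ I (- x).
Proof.
move=> e /(iwahori_diag i); rewrite mxE e => h.
have /inpN : inp 1 (-1 - 1 : F) := h.
have -> : - (-1 - 1) = 2%:R :> F by ring.
by case=> [/eqP|]; rewrite ?(negbTE (pf_char0 F (n := 2) isT)) // val2.
Qed.

Lemma iwahori_corner (x : M) (i : 'I_(2 * l)) : x i i = 0 -> ~ (I x \/ I (- x)).
Proof.
move=> e h; apply: (@inp_not1 F); case: h => /(iwahori_diag i).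
  by rewrite e sub0r => /inpN; rewrite opprK.
by rewrite mxE e oppr0 sub0r => /inpN; rewrite opprK.
Qed.

Let h0 : (0 < 2 * l)%N. Proof. lia. Qed.
Let i0 := Ordinal h0.

Lemma test_fun1 : test_fun 1%:M = 1.
Proof.
have c0 y : ~ (I y \/ I (- y)) -> chi_pm y = 0.
  move=> nI; rewrite /chi_pm /chi0 !indicF ?mul0r ?mulr0 ?addr0 //; move=> ?; apply: nI.
    by right.
  by left.
have I1 := mxg_1 IG.
rewrite /test_fun (c0 (g *m 1%:M)); last first.
  apply: (iwahori_corner (i := i0)); rewrite mulmx1 (g_chiE hl p2 w0 vw a0 va).
  by rewrite ifF // -val_eqE /= /gc_s eqxx; lia.
rewrite mulr0 addr0 /chi_pm /chi0 indicT // mul1r affine_generic_filt2 ?subrr //; last first.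
  exact: filt0.
by rewrite indicF ?mul0r ?mulr0 ?addr0 //; apply: (iwahori_sign (i := i0)); rewrite mxE eqxx.
Qed.

Lemma SO_opp (x : M) : SO x -> SO (- x).
Proof.
move=> [d e]; split; last first.
  have -> : (- x)^T = - x^T by apply/matrixP => i j; rewrite !mxE.
  by rewrite mulmxN !mulNmx opprK.
by rewrite -scaleN1r detZ d mulr1 -signr_odd oddM.
Qed.

Lemma iwahori_filt2 k : SO k -> filt 2 (k - 1%:M) -> I k.
Proof. by move=> Sk hk; apply/iwahori_filt => //; split=> //; apply: filt_le hk. Qed.

Lemma test_fun_filt2 x k : SO k -> filt 2 (k - 1%:M) -> test_fun (x *m k) = test_fun x.
Proof.
move=> Sk hk; rewrite test_fun_r; last exact: iwahori_filt2.
by rewrite affine_generic_filt2 ?mulr1.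
Qed.

Lemma test_fun_cind : cind_space w a psi om sg test_fun.
Proof.
split.
- move=> x nS; apply: contra_notP nS => /eqP /test_fun_supp h.
  have Ig : SO (g *m x) -> SO x by move=> Sg; rewrite -(gchiK x); apply: (mxg_M SG) gchi_SO Sg.
  case: h => -[[h _]|[h _]] => //; last apply: Ig => //.
  + by rewrite -[x]opprK; apply: SO_opp.
  + exact: Ig.
  + by rewrite -[_ *m x]opprK; apply: SO_opp.
- by move=> h x Ih _; apply: test_fun_l.
- by move=> x _; split; [exact: test_fun_gl|exact: test_funN].
(* Level 2 suffices: 2 (2l - 2) exceeds the largest difference of heights, 2l - 2, by at least 2, so
   this congruence subgroup lies in the second step of the filtration. *)
- exists 1%N => x k Sx Sk [_ hk]; apply: test_fun_filt2 => // i j.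
  have [->|h] := hk i j; first by left.
  right; have hi := ltn_ord i; have hj := ltn_ord j.
  by move: (pf_val _) h => n h; rewrite /hgt; case: ltnP => b; case: ltnP => c; nia.
(* The bound comes from the entry - w^-1 of [g_chi]. *)
exists (-1) => x /test_fun_supp h.
have Ii y : I y \/ I (- y) -> mx_inp 0 y.
  have Io z : I z -> mx_inp 0 z.
    move=> [_ h'] i j; rewrite -[z i j](subrK (i == j)%:R); apply: inpD; last first.
      by case: eqP => _; [exact: inp01|exact: inp0].
    by apply: inp_le (h' i j); lia.
  by case=> /Io // /mx_inpN; rewrite opprK.
have gi : mx_inp (-1) g.
  move=> i j; rewrite (g_chiE hl p2 w0 vw a0 va); case: ifP => _; last exact: inp0.
  right; have [|[|[|[|]]]] := gc_cases l w a i => -[_ [_ ->]];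
  by rewrite ?valN ?valV // ?vw ?va ?val_one.
case: h => [/Ii h|/Ii h] i j; first by apply: inp_le (h i j).
rewrite -(gchiK x); have := mx_inpM gi h; rewrite addr0; exact.
Qed.

End TestVector.

(** * The Whittaker function and its restriction to SO_3 *)

Section Whittaker.
Variables (F : padic_field) (R : realType) (l : nat).
Hypotheses (l3 : (3 <= l)%N) (p2 : pf_p F != 2%N).
Variables (w a : F) (psi : F -> R[i]) (om sg : R[i]).
Hypotheses (w0 : w != 0) (vw : pf_val w = 1) (a0 : a != 0) (va : pf_val a = 0).
Hypotheses (psi1 : level1_character psi) (om2 : om ^+ 2 = 1) (sg2 : sg ^+ 2 = 1).
Variable pi : grep F R (2 * l).
Hypothesis ssc : simple_supercuspidal_SO w a psi om sg pi.
Local Notation C := R[i].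
Local Notation SO := (@SOeven F l).
Local Notation I := (@iwahori_plus F l).
Local Notation U := (@Ueven F l).
Local Notation M := 'M[F]_(2 * l).
Local Notation gam := (- (4%:R * a)).
Local Notation tor := (tor F l).
Local Notation f0 := (test_fun w a psi om sg).
Local Notation Phi := (jac_integrand a psi).
Local Notation g3 := (t3 (- w^-1) *m w1 F).

Let hl : (2 <= l)%N. Proof. exact: ltnW. Qed.
Let gam0 : gam != 0. Proof. by rewrite oppr_eq0 mulf_neq0 // pf_char0. Qed.
Let vgam : pf_val gam = 0. Proof. by rewrite valN pf_valM // ?pf_char0 // val4 // va. Qed.
Let SG : mx_group SO. Proof. exact: SO_group. Qed.
Let UG : mx_group U. Proof. exact: U_group. Qed.
Let St : SO tor. Proof. exact: tor_SO. Qed.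

Let h0 : (0 < 2 * l)%N. Proof. lia. Qed.
Let hm : (l < 2 * l)%N. Proof. lia. Qed.
Let hz : ((2 * l).-1 < 2 * l)%N. Proof. lia. Qed.
Let i0 := Ordinal h0.
Let im := Ordinal hm.
Let iz := Ordinal hz.

Lemma tor_conj_diag (x : M) i : (star tor *m x *m tor) i i = x i i.
Proof. by rewrite tor_conjE mulrAC tor_dV // mul1r. Qed.

Lemma inp_tor_conj k (x : M) i j : inp k ((star tor *m x *m tor) i j) <-> inp k (x i j).
Proof.
rewrite tor_conjE; have n0 i' := tor_d_neq0 hl p2 i'.
have [->|x0] := eqVneq (x i j) 0; first by rewrite mulr0 mul0r.
have e : pf_val (tor_d F l (rev_ord i) * x i j * tor_d F l j) = pf_val (x i j).
  by rewrite !pf_valM ?mulf_neq0 ?n0 // !val_tor // add0r addr0.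
split=> -[/eqP|h]; try by right; rewrite e in h *.
  by rewrite !mulf_eq0 (negbTE (n0 (rev_ord i))) (negbTE (n0 j)) orbF /= (negbTE x0).
by rewrite (negbTE x0).
Qed.

(* The last row of u r t and its (l+1, l+1) entry do not depend on u: they exclude
   the cosets of -1 and of g_chi. *)
Lemma test_fun_cell u (r : 'cV[F]_(l - 2)) s : U u -> s != 0 ->
  f0 (star tor *m (u *m (Rl1 r *m emb l gam (t3 s))) *m tor) != 0 ->
  [/\ I (star tor *m (u *m (Rl1 r *m emb l gam (t3 s))) *m tor), inp 1 (s - 1) & mx_inp 1 r].
Proof.
move=> Uu s0; set x := u *m _; set y := star tor *m x *m tor => fy.
have em := emb_t3 hl p2 gam0 vgam s.
have B (i j : 'I_(2 * l)) : (Rl1 r *m emb l gam (t3 s)) i j = Rl1 r i j *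
    (if j == 0%N :> nat then s else if j == (2 * l).-1 :> nat then s^-1 else 1).
  rewrite mxE (bigD1 j) //= em mxE eqxx big1 ?addr0 // => k kj.
  by rewrite mxE (negbTE kj) mulr0.
have xz j : x iz j = (Rl1 r *m emb l gam (t3 s)) iz j.
  rewrite /x mxE (bigD1 iz) //= (U_diag _ Uu) mul1r big1 ?addr0 // => k kz.
  rewrite (U_below Uu) ?mul0r //=; have := ltn_ord k.
  by move: kz; rewrite -val_eqE /=; lia.
have xz0 : x iz i0 = 0.
  rewrite xz B Rl1_split mxE Rl1_NE // mxE -val_eqE /=.
  rewrite !ifF ?addr0; try lia.
  have -> : ((2 * l).-1 == 0%N) = false by lia.
  by rewrite mul0r.
have xzz : x iz iz = s^-1.
  rewrite xz B Rl1_split mxE Rl1_NE // mxE eqxx /=.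
  by repeat (case: ifP => ?); try (exfalso; lia); rewrite addr0 mul1r.
have xmm : x im im = 1.
  rewrite /x mxE (bigD1 im) //= (U_diag _ Uu) mul1r big1 ?addr0.
    rewrite B Rl1_split mxE Rl1_NE // mxE eqxx /=.
    by rewrite !ifF ?addr0 ?mulr1 //; lia.
  move=> k km; rewrite B Rl1_split mxE Rl1_NE // mxE (negbTE km) /= add0r.
  by rewrite ifF ?ifF ?mul0r ?mulr0 //; lia.
have Iy : I y.
  have [[//|h]|h] := test_fun_supp fy.
    by case: (iwahori_sign p2 (i := im) _ h); rewrite tor_conj_diag.
  case: (iwahori_corner (i := i0) _ h).
  have -> : (g_chi l w a *m y) i0 i0 = gc_c l w a 0 * y iz i0.
    rewrite (mul_gchi hl p2 w0 vw a0 va); congr (_ * y _ _).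
    by apply: val_inj; rewrite /= /gc_s eqxx.
  by rewrite tor_conjE xz0 mulr0 mul0r mulr0.
split=> //.
  have := iwahori_diag iz Iy; rewrite tor_conj_diag xzz => h.
  have [_ vs] := val_1p h.
  have -> : s - 1 = - (s * (s^-1 - 1)) by rewrite mulrBr divff // mulr1 opprB.
  apply: inpN; apply: inp_pM => //; right.
  by rewrite -[s]invrK valV ?invr_eq0 // vs.
move=> i j; have hi := ltn_ord i.
have hj : ((2 * l).-2 - i < 2 * l)%N by lia.
have -> : r i j = ent r i.+1 1 by rewrite (ord1 j) -(ent_ordinal r i ord0).
have := Iy.2 iz (Ordinal hj); rewrite (_ : (_ <= _)%N); last by rewrite /=; lia.
have -> : (iz == Ordinal hj) = false by rewrite -val_eqE /=; lia.
rewrite subr0 inp_tor_conj xz B Rl1_split mxE Rl1_NE // mxE -val_eqE /=.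
have -> : ((2 * l).-1 == (2 * l).-2 - i)%N = false by lia.
repeat (case: ifP => ?); try (exfalso; lia); rewrite add0r mulr1 => /inpN; rewrite opprK.
by have -> : ((2 * l).-1 - ((2 * l).-2 - i) = i.+1)%N by lia.
Qed.

(** Chosen by [xget] to be total; on functions of the induced space the integral exists by
    [jac_exists], and the default value never intervenes. *)
Definition jac_value (f : M -> C) : C := xget 0 [set S | is_haar_int U (@Uint F l) (Phi f) S]%classic.

Lemma jac_valueE f S : is_haar_int U (@Uint F l) (Phi f) S -> jac_value f = S.
Proof.
move=> h; apply: (haar_unique UG (Uint_group hl p2) _ h).
by rewrite /jac_value; case: xgetP => [x _ //|n]; case: (n S).
Qed.

Lemma jac_value_prop f S : is_haar_int U (@Uint F l) (Phi f) S ->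
  is_haar_int U (@Uint F l) (Phi f) (jac_value f).
Proof. by move=> h; rewrite (jac_valueE h). Qed.

Lemma star_tor_U u : U u -> SO (star tor *m invmx u).
Proof.
move=> Uu; apply: (mxg_M SG); last by apply: (mxg_V SG); exact: Uu.1.
by rewrite -(SO_inv St); apply: (mxg_V SG).
Qed.

Lemma rep_haar_ext f f' S : (forall x, SO x -> f x = f' x) ->
  is_haar_int U (@Uint F l) (Phi f) S -> is_haar_int U (@Uint F l) (Phi f') S.
Proof.
move=> e; apply: (haar_ext UG (@Uint_sub F l)).
by move=> u Uu; rewrite /jac_integrand e //; apply: star_tor_U.
Qed.

(** The invariance under [I3p] holds because its image lies in the second step of the filtration,
    where chi is trivial; the eigenvalue sg because [g3] corresponds to [g_chi]; the vanishing on
    the torus because of [test_fun_cell]. At h = 1 the dependence on r is an indicator function,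
    since r in p again lies in the second step. *)
Lemma whittaker_exists : exists W : M -> C,
  [/\ whittaker psi gam pi W,
      forall r h k, SO3 gam h -> I3p gam k ->
        W (Rl1 r *m wl1 F l *m embed l gam (h *m k)) = W (Rl1 r *m wl1 F l *m embed l gam h),
      forall r h, SO3 gam h ->
        W (Rl1 r *m wl1 F l *m embed l gam (h *m g3)) =
        sg * W (Rl1 r *m wl1 F l *m embed l gam h),
      forall r s, s != 0 -> ~ inp 1 (s - 1) ->
        W (Rl1 r *m wl1 F l *m embed l gam (t3 s)) = 0
    & exists2 c, c != 0 & forall r, W (Rl1 r *m wl1 F l *m embed l gam 1%:M) =
        c * indic R (mx_inp 1) r].
Proof.
have [[gL g1 gM gS] [T [Tlin Tinj Timg Tact]]] := ssc.
have [x Tx] : exists x, T x = f0.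
  by apply/Timg; apply: test_fun_cind.
pose Q (f : M -> C) S := is_haar_int U (@Uint F l) (Phi f) S.
have Qex y : exists S, Q (T y) S.
  have [_ T1 _ _ [k T2]] := (Timg (T y)).2 (ex_intro _ y erefl).
  exact: (jac_exists hl p2 w0 vw a0 va psi1 T1 T2).
have Qv y : Q (T y) (jac_value (T y)) by have [S /jac_value_prop] := Qex y.
pose Lam (y : grep_space pi) : C^o := jac_value (T y).
have Swl : SO (wl1 F l) by exact: (wl1_SO hl p2 gam0 vgam).
have Sb : SO ((wl1 F l)^T *m tor).
  apply: (mxg_M SG) => //; rewrite -(wl1_inv hl p2 gam0 vgam).
  exact: (mxg_V SG).
(* The vector is translated by (w^(l,1))^-1 tor: the first factor undoes the w^(l,1) in the
   integrand of Psi, the second completes the conjugation by [tor]. *)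
pose W g := jac_value (T (gact g (gact ((wl1 F l)^T *m tor) x))).
have SX r h : SO3 gam h -> SO (Rl1 r *m emb l gam h).
  by move=> Sh; apply: (mxg_M SG); [exact: Rl1_SO|exact: emb_SO].
have Sg r h : SO3 gam h -> SO (Rl1 r *m wl1 F l *m embed l gam h).
  move=> Sh; rewrite -mulmxA (wl1_embed hl p2 gam0 vgam) mulmxA.
  by apply: (mxg_M SG) => //; apply: SX.
have E r h y : SO3 gam h -> SO y ->
    T (gact (Rl1 r *m wl1 F l *m embed l gam h) (gact ((wl1 F l)^T *m tor) x)) y =
    f0 (y *m (Rl1 r *m emb l gam h *m tor)).
  move=> Sh Sy; have S1 := Sg r h Sh; rewrite !Tact ?Tx //; last exact: (mxg_M SG).
  congr f0; rewrite -mulmxA; congr (_ *m _).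
  rewrite -[Rl1 r *m _ *m _]mulmxA (wl1_embed hl p2 gam0 vgam) !mulmxA.
  by rewrite -[_ *m wl1 F l *m _]mulmxA (wl1_orth hl p2 gam0 vgam) mulmx1.
have Wscale g z c : (forall y, SO y -> T (gact g (gact ((wl1 F l)^T *m tor) x)) y =
    c * T z y) -> W g = c * jac_value (T z).
  move=> e; apply: jac_valueE; apply: (rep_haar_ext (f := fun y => c * T z y)).
    by move=> y Sy; rewrite e.
  apply: haar_ext (haarZ c (Qv z)); [exact: UG|exact: Uint_sub|].
  by move=> u _; rewrite /jac_integrand mulrCA.
have emT h k : SO3 gam h -> SO3 gam k ->
    emb l gam (h *m k) *m tor = emb l gam h *m tor *m (star tor *m emb l gam k *m tor).
  move=> Sh Sk; rewrite embM // !mulmxA -[_ *m tor *m star tor]mulmxA.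
  by rewrite (tor_star hl p2) mulmx1.
have W0 r h : SO3 gam h -> (forall u, U u ->
    f0 (star tor *m (u *m (Rl1 r *m emb l gam h)) *m tor) = 0) ->
    W (Rl1 r *m wl1 F l *m embed l gam h) = 0.
  move=> Sh e; set g := _ *m embed _ _ _.
  rewrite /W; have := Qv (gact g (gact ((wl1 F l)^T *m tor) x)).
  set J := jac_value _ => hJ; have := haarZ 0 hJ; rewrite mul0r => h0'.
  apply: (haar_unique UG (Uint_group hl p2) hJ); apply: (haar_ext UG (@Uint_sub F l)) h0'.
  move=> u Uu; rewrite mul0r /jac_integrand E //; last exact: star_tor_U.
  have Uv := mxg_V UG Uu; have := e _ Uv; rewrite !mulmxA => ->.
  by rewrite mulr0.
exists W; split.
- exists Lam, (gact ((wl1 F l)^T *m tor) x); split=> // [c y z|u y Uu].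
    rewrite /Lam; apply: jac_valueE.
    have h := haarD UG (Uint_group hl p2) (haarZ c (Qv y)) (Qv z).
    suff : Q (T (c *: y + z)) (c * jac_value (T y) + jac_value (T z)) by [].
    apply: (haar_ext UG (@Uint_sub F l)) h.
    by move=> u _; rewrite /jac_integrand Tlin; ring.
  rewrite /Lam; apply: jac_valueE.
  apply: (rep_haar_ext (f := fun h => T y (h *m u))).
    by move=> h Sh; rewrite Tact //; exact: Uu.1.
  exact: (jac_translate hl p2 w0 vw a0 va psi1 Uu (Qv y)).
- move=> r h k Sh Ik; have Sk := Ik.1; have Shk := mxg_M (SO3_group gam) Sh Sk.
  rewrite -[RHS]mul1r; apply: Wscale => y Sy; rewrite !E // mul1r.
  rewrite -[Rl1 r *m _ *m tor]mulmxA emT // !mulmxA -[_ *m emb l gam k *m tor]mulmxA.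
  rewrite -[_ *m star tor *m _]mulmxA [star tor *m _]mulmxA test_fun_filt2 //.
    by apply: (mxg_M SG) => //; apply: (mxg_M SG); [rewrite -(SO_inv St); apply: (mxg_V SG)|exact: emb_SO].
  rewrite tor_conj_sub1 //; apply: filt_tor => //; exact: emb_I3p.
- move=> r h Sh; have Sk : SO3 gam g3 by exact: SO3_gchi.
  have Shk := mxg_M (SO3_group gam) Sh Sk.
  apply: Wscale => y Sy; rewrite !E // -[Rl1 r *m _ *m tor]mulmxA emT //.
  by rewrite -gchi_tor // !mulmxA test_fun_gr.
- move=> r s s0 hs; apply: W0 => [|u Uu]; first exact: t3_SO.
  apply: contrapT => /eqP /(test_fun_cell Uu s0)[_ h _]; exact: hs.
have e1 : t3 (1 : F) = 1%:M by exact: t3_1.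
have S1 : SO3 gam (1%:M : 'M[F]_3) by exact: mxg_1 (SO3_group gam).
have em1 : emb l gam 1%:M = 1%:M by rewrite /emb subrr mulmx0 mul0mx addr0.
exists (W (Rl1 0 *m wl1 F l *m embed l gam 1%:M)); last first.
  move=> r; have [hr|nr] := pselect (mx_inp 1 r); last first.
    rewrite indicF // mulr0; apply: W0 => // u Uu; rewrite -e1.
    apply: contrapT => /eqP /(test_fun_cell Uu (oner_neq0 _))[_ _ h]; exact: nr.
  rewrite indicT // mulr1 -[RHS]mul1r; apply: Wscale => y Sy; rewrite !E // mul1r em1 !mulmx1.
  rewrite Rl1_0 // mul1mx.
  have -> : y *m (Rl1 r *m tor) = y *m tor *m (star tor *m Rl1 r *m tor).
    by rewrite !mulmxA -[_ *m tor *m star tor]mulmxA (tor_star hl p2) mulmx1.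
  rewrite test_fun_filt2 //.
    apply: (mxg_M SG) => //; apply: (mxg_M SG); last exact: Rl1_SO.
    by rewrite -(SO_inv St); apply: (mxg_V SG).
  by rewrite tor_conj_sub1 //; apply: filt_tor => //; apply: Rl1_filt.
(* At the identity the integrand on U is the indicator function of [Uint]: the support condition
   puts u into [Uint], where the two characters cancel. Its integral is therefore a nonzero
   volume. *)
rewrite /W; set z := gact _ _; have hz' := Qv z.
have ez y : SO y -> T z y = f0 (y *m tor).
  by move=> Sy; rewrite /z E // em1 mulmx1 Rl1_0 // mul1mx.
have [_ T1 _ _ _] := (Timg (T z)).2 (ex_intro _ z erefl).
have I1 : Uint (1%:M : M) := mxg_1 (Uint_group hl p2).
have P1 : Phi (T z) 1%:M = 1.
  rewrite /jac_integrand invmx1 ez ?mulmx1.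
    by rewrite star_tor_tor // test_fun1 // mulr1 (psiU1 hl p2 w0 vw a0 va psi1).
  by rewrite -(SO_inv St); apply: (mxg_V SG).
apply: (haar_ind_neq0 UG hz' _ I1.1 P1) => u Uu.
have [Iu|nI] := pselect (Uint u).
  right; rewrite -P1 -[in LHS](mul1mx u).
  exact: (jac_invariant hl p2 w0 vw a0 va psi1 T1 I1.1 Iu).
left; apply: contrapT => /eqP n0; apply: nI; split=> //.
have Uv := mxg_V UG Uu; move: n0; rewrite /jac_integrand mulf_eq0 negb_or => /andP[_].
rewrite ez; last exact: star_tor_U.
have -> : star tor *m invmx u *m tor =
    star tor *m (invmx u *m (Rl1 0 *m emb l gam (t3 1))) *m tor.
  by rewrite e1 em1 Rl1_0 // !mulmx1.
move=> /(test_fun_cell Uv (oner_neq0 _))[[_ h] _ _].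
have hi : mx_inp 0 (invmx u).
  move=> i j; rewrite -(inp_tor_conj 0); rewrite e1 em1 Rl1_0 // !mulmx1 in h.
  rewrite -[_ i j](subrK (i == j)%:R); apply: inpD; first by apply: inp_le (h i j); lia.
  by case: eqP => _; [exact: inp01|exact: inp0].
by rewrite -[u]invmxK (SO_inv Uv.1); apply: mx_inp_star.
Qed.

Lemma central_char c0 : (forall x : grep_space pi, gact (- 1%:M) x = c0 *: x) -> c0 = om.
Proof.
move=> hc; have [[gL g1 gM gS] [T [Tlin Tinj Timg Tact]]] := ssc.
have [x Tx] : exists x, T x = f0.
  by apply/Timg; apply: test_fun_cind.
have S1 : SO 1%:M := mxg_1 SG.
have T0 h : T 0 h = 0.
  by have := Tlin (-1) 0 0 h; rewrite scaler0 addr0 mulN1r addNr.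
have := Tact (- 1%:M) x 1%:M (SO_opp S1) S1.
rewrite hc -[c0 *: x]addr0 Tlin T0 addr0 mul1mx Tx test_funN //.
by rewrite test_fun1 // !mulr1.
Qed.

End Whittaker.

(** * The integrals Psi *)

Lemma has_sum_slice (R : realType) (I T : eqType) (D : set T) (f : T -> R[i]) S (n : I) :
  has_sum D f S ->
  has_sum [set x : I * T | D x.2]%classic (fun x => if x.1 == n then f x.2 else 0) S.
Proof.
move=> h e e0; have [s0 [D0 h0]] := h e e0.
exists [seq (n, x) | x <- s0]; split=> [x /mapP[y ys ->]|s us ss sD]; first exact: D0.
have -> : \sum_(x <- s) (if x.1 == n then f x.2 else 0) =
    \sum_(y <- [seq x.2 | x <- [seq x <- s | x.1 == n]]) f y.
  by rewrite big_map big_filter -big_mkcond.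
apply: h0 => [|x xs|y /mapP[x]]; last by rewrite mem_filter => /andP[_ /sD xD] ->.
  rewrite map_inj_in_uniq ?filter_uniq // => -[a x] [b y].
  by rewrite !mem_filter /= => /andP[/eqP-> _] /andP[/eqP-> _] ->.
apply/mapP; exists (n, x) => //; rewrite mem_filter /= eqxx /=.
by apply: ss; apply/mapP; exists x.
Qed.

(** * Evaluation of the integral over U \ SO_3 *)

Section PsiSum.
Variables (F : padic_field) (R : realType) (gam w : F).
Hypotheses (gam0 : gam != 0) (vgam : pf_val gam = 0) (p2 : pf_p F != 2%N).
Hypotheses (w0 : w != 0) (vw : pf_val w = 1).
Local Notation C := R[i].
Local Notation v := (@pf_val F).
Local Notation q := (pf_q F).
Local Notation SO := (SO3 gam).
Local Notation SOo := (SO3o gam).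
Local Notation I := (I3p gam).
Local Notation u := (u3 gam).
Local Notation w1 := (w1 F).
Local Notation ht := (ht gam).
Local Notation g3 := (t3 (- w^-1) *m w1).

Let gS : mx_group SO := SO3_group gam.
Let gI : mx_group I := I3p_group gam0 vgam p2.
Let gO : mx_group SOo := SO3o_group gam.

Section BigCell.
Variable y0 : F.
Hypotheses (y00 : y0 != 0) (vy0 : v y0 = 0).

(** The part of the big cell of SO_3(o) where the torus coordinate is congruent to y0. For y0 = - t
    / w it is the second piece of the support of the integrand. *)
Definition cell (k : 'M[F]_3) := exists x y i, [/\ inp 0 x, y != 0, v y = 0,
  inp 1 (y / y0 - 1) & I i /\ k = u x *m t3 y *m w1 *m i].

Definition cell_rep (d : F) := u d *m t3 y0 *m w1.

Lemma cell_rep_SO d : SO (cell_rep d).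
Proof.
apply: (mxg_M gS); last exact: w1_SO.
by apply: (mxg_M gS); [exact: u3_SO|exact: t3_SO].
Qed.

Lemma cell_rep_shift d x : u x *m t3 y0 *m w1 = cell_rep d *m lo3 gam ((x - d) / y0).
Proof.
rewrite /cell_rep /lo3 !mulmxA -[_ *m w1 *m w1]mulmxA w1w1 mulmx1.
rewrite -[_ *m t3 y0 *m u _]mulmxA t3u3 // mulmxA u3D //; congr (u _ *m _ *m _).
by rewrite mulrCA divff // mulr1 addrC subrK.
Qed.

(** The cell is the disjoint union of q cosets of the Iwahori radical, indexed by x modulo p:
    changes of x by p and of y by 1 + p are absorbed to the right of w1. Hence its volume is q times
    that of the radical. *)
Lemma cell_sum (d : 'I_q -> F) k :
  (forall x, inp 0 x -> exists! i, inp 1 (x - d i)) -> (forall i, inp 0 (d i)) ->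
  SO k ->
  \sum_(i < q) indic R I (invmx (cell_rep (d i)) *m k) = indic R cell k.
Proof.
move=> dr d0 Sk; have ur i := mxg_unit gS (cell_rep_SO (d i)).
have [[x [y [i [hx yn vy hy [Ii ek]]]]]|nP] := pselect (cell k); last first.
  rewrite indicF // big1 // => j _; apply: indicF => Ij; apply: nP.
  exists (d j), y0, (invmx (cell_rep (d j)) *m k); split=> //.
    by rewrite divff // subrr; apply: inp0.
  by split=> //; rewrite -/(cell_rep (d j)) mulKVmx.
rewrite [RHS]indicT; last by exists x, y, i.
have [j [hj ju]] := dr x hx.
have ty0 : y / y0 != 0 by rewrite mulf_neq0 ?invr_eq0.
have It : I (t3 (y / y0)^-1).
  apply/(t3_I3p gam); rewrite ?invr_eq0 //.
  have -> : (y / y0)^-1 - 1 = - ((y / y0)^-1 * (y / y0 - 1)).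
    by rewrite mulrBr mulVf // mulr1 opprB.
  apply: inpN; apply: inp_pM => //; right.
  by rewrite valV // val_div // vy vy0.
have Il z : inp 1 z -> I (lo3 gam (z / y0)).
  move=> hz; apply: lo3_I3p => //; apply: inp_Mp => //; right.
  by rewrite valV // vy0.
have ek' : k = cell_rep (d j) *m (lo3 gam ((x - d j) / y0) *m (t3 (y / y0)^-1 *m i)).
  rewrite mulmxA -cell_rep_shift ek !mulmxA -[_ *m w1 *m t3 _]mulmxA w1t3 ?invr_eq0 //.
  rewrite invrK mulmxA -[_ *m t3 y0 *m t3 _]mulmxA t3M //.
  by rewrite mulrCA divff // mulr1.
have Ij : I (lo3 gam ((x - d j) / y0) *m (t3 (y / y0)^-1 *m i)).
  by apply: (mxg_M gI); [exact: Il|exact: (mxg_M gI)].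
move: ek' Ij; move: (_ *m (t3 _ *m i)) => i2 ek' Ij.
rewrite (bigD1 j) //= ek' mulKmx // indicT // big1 ?addr0 // => j' jj'.
apply: indicF => Ij'; case/eqP: jj'; apply: esym; apply: ju.
have := mxg_M gI Ij' (mxg_V gI Ij); rewrite [invmx _ *m (_ *m i2)]mulmxA mulmxK ?(mxg_unit gI) //.
rewrite [cell_rep (d j)](cell_rep_shift (d j')) mulKmx // => -[_ /(_ o2 o1)].
rewrite lo3E !mxE /= subr0 => /inpN; rewrite opprK => h.
rewrite (_ : x - d j' = (x - d j) + (d j - d j')); last by ring.
apply: inpD => //; rewrite -[d j - _](divfK y00); apply: inp_Mp => //.
by right; rewrite vy0.
Qed.

Lemma cell_corner k : cell k -> ~ inp 1 (k o2 o0).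
Proof.
move=> [x [y [i [hx yn vy hy [Ii ->]]]]].
have -> : (u x *m t3 y *m w1 *m i) o2 o0 = y^-1 * i o0 o0.
  by rewrite !mul3E !mxE /=; ring.
have h00 := Ii.2 o0 o0; rewrite eqxx in h00; have [i0 vi] := val_1p h00.
by move/inpE; rewrite mulf_neq0 ?invr_eq0 // pf_valM ?invr_eq0 // valV // vy vi => /(_ isT).
Qed.

End BigCell.

(** On the small cell J reduces to its value at a torus element, supported on 1 + p, which forces n
    = 0. On the big cell w1 is completed to [g3] at the cost of a factor - w, which forces n = -1
    and fixes y modulo 1 + p; the eigenvalue sg appears there. The uniformizer t is that of the
    integral, w that of chi. *)
Lemma psi_term (J : 'M[F]_3 -> C) sg (t : F) n k (t0 : t != 0) (vt : v t = 1) :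
  (forall x h, SO h -> J (u x *m h) = J h) ->
  (forall h k, SO h -> I k -> J (h *m k) = J h) ->
  (forall h, SO h -> J (h *m g3) = sg * J h) ->
  (forall s, s != 0 -> ~ inp 1 (s - 1) -> J (t3 s) = 0) ->
  SOo k ->
  J (t3 (t ^ n) *m k) = J 1%:M * ((if n == 0 then indic R I k else 0) +
    sg * (if n == -1 then indic R (cell (- t / w)) k else 0)).
Proof.
move=> JU JI Jg Jt Ok; have m0 : t ^ n != 0 by rewrite expfz_neq0.
have vm : v (t ^ n) = n by rewrite valXz // vt mul1r.
have J1 s : s != 0 -> J (t3 s) = J 1%:M * indic R (fun s => inp 1 (s - 1)) s.
  move=> s0; have [h|h] := pselect (inp 1 (s - 1)); last by rewrite indicF // mulr0 Jt.
  rewrite indicT // mulr1 -[t3 s]mul1mx JI //; first exact: mxg_1 gS.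
  exact/(t3_I3p gam).
have nyw : - t / w != 0 by rewrite mulf_neq0 ?oppr_eq0 ?invr_eq0.
have JA x y i : y != 0 -> I i -> J (t3 (t ^ n) *m (u x *m t3 y *m i)) =
    J 1%:M * indic R (fun s => inp 1 (s - 1)) (t ^ n * y).
  move=> yn Ii; rewrite !mulmxA t3u3 // -[_ *m t3 y]mulmxA t3M // JI //; last first.
    by apply: (mxg_M gS); [exact: u3_SO|apply: t3_SO; rewrite mulf_neq0].
  by rewrite JU ?J1 ?mulf_neq0 //; apply: t3_SO; rewrite mulf_neq0.
have JB x y i : y != 0 -> I i -> J (t3 (t ^ n) *m (u x *m t3 y *m w1 *m i)) =
    J 1%:M * (sg * indic R (fun s => inp 1 (s - 1)) (t ^ n * y * - w)).
  move=> yn Ii; have my : t ^ n * y != 0 by rewrite mulf_neq0.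
  have mw : t ^ n * y * - w != 0 by rewrite mulf_neq0 ?oppr_eq0.
  rewrite !mulmxA t3u3 // -[_ *m t3 y]mulmxA t3M // JI //; last first.
    apply: (mxg_M gS); last exact: w1_SO.
    by apply: (mxg_M gS); [exact: u3_SO|exact: t3_SO].
  rewrite -mulmxA JU; last by apply: (mxg_M gS); [exact: t3_SO|exact: w1_SO].
  have -> : t3 (t ^ n * y) *m w1 = t3 (t ^ n * y * - w) *m g3.
    rewrite mulmxA t3M ?oppr_eq0 ?invr_eq0 //.
    by rewrite -[_ * - w * _]mulrA mulrNN divff // mulr1.
  by rewrite Jg ?(J1 _ mw) 1?mulrCA //; exact: t3_SO.
have unitn y : y != 0 -> v y = 0 -> inp 1 (t ^ n * y - 1) -> n = 0.
  by move=> yn vy /val_1p[_]; rewrite pf_valM // vm vy addr0.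
have cellP y : y != 0 -> v y = 0 -> inp 1 (t ^ n * y * - w - 1) <-> n = -1 /\ inp 1 (y / (- t / w) - 1).
  move=> yn vy; have e : n = -1 -> t ^ n * y * - w = y / (- t / w).
    move=> ->; rewrite exprN1 invfM invrN invrK; ring.
  split=> [h|[n1 h]]; last by rewrite e.
  have n1 : n = -1.
    have [_] := val_1p h; rewrite !pf_valM ?mulf_neq0 ?oppr_eq0 // valN vm vy vw; lia.
  by split=> //; rewrite -e.
have [[x' [y' [i' [hx' yn' vy' hy' [Ii' ek']]]]]|nP] := pselect (cell (- t / w) k).
  have nI : ~ I k.
    move=> Ik; apply: (cell_corner (y0 := - t / w) (k := k)); first by exists x', y', i'.
    by have := Ik.2 o2 o0; rewrite subr0.
  rewrite [indic R I k]indicF // if_same add0r [indic R (cell _) k]indicT; last by exists x', y', i'.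
  rewrite ek' JB //; congr (_ * (_ * _)); case: eqP => n1.
    by rewrite indicT //; apply/cellP.
  by rewrite indicF // => /(cellP _ yn' vy')[].
rewrite [indic R (cell _) k]indicF // if_same mulr0 addr0.
have [x [y [i [hx yn vy Ii [[ek hc]|[ek hc]]]]]] := SO3o_decomp gam0 vgam p2 Ok.
  rewrite {1}ek JA //; congr (_ * _).
  have Ik : I k <-> inp 1 (y - 1).
    rewrite -(t3_I3p gam yn) ek; have Iu := u3_I3p gam0 vgam hx; split=> h; last first.
      by apply: (mxg_M gI) => //; apply: (mxg_M gI).
    have := mxg_M gI (mxg_V gI Iu) (mxg_M gI h (mxg_V gI Ii)).
    by rewrite mulmxK ?(mxg_unit gI) // mulKmx // (mxg_unit gI).
  case: eqP => [->|n0]; last by rewrite indicF // => /(unitn _ yn vy).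
  by apply: indic_eq; rewrite expr0z mul1r; split=> /Ik.
rewrite [indic R I k]indicF ?if_same; last first.
  by move=> Ik; apply: hc; have := Ik.2 o2 o0; rewrite subr0.
rewrite mulr0 {1}ek JB // indicF ?mulr0 // => /(cellP _ yn vy)[_ h].
by apply: nP; exists x, y, i.
Qed.

Definition Kc (m : nat) : set 'M[F]_3 := (SO `&` @congr_subgroup F 3 m.+1)%classic.

Lemma Kc_group m : mx_group (Kc m).
Proof. exact: mx_groupI gS (congr_group F 3 m). Qed.

Lemma haar_I3p m : exists2 N : C, N != 0 & is_haar_int SOo (Kc m) (indic R I) N.
Proof.
have KI k : Kc m k -> I k by case=> Sk hk; apply: I3p_congr hk.
have [|||N hN] := @haar_fin F R 3 SOo gO (Kc m) (Kc_group m) (indic R I) 0 m.+1%:Z.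
- move=> g k Og /KI Ik; apply: indic_eq; split=> h; last exact: (mxg_M gI).
  by rewrite -[g](mulmxK (mxg_unit gI Ik)); apply: (mxg_M gI) => //; apply: (mxg_V gI).
- by move=> g [].
- move=> g h Og Oh hg hh hgh; have Vg := mxg_V gO Og.
  split; first exact: (mxg_M gS Vg.1 Oh.1).
  split; first by apply: (mxg_unit gO); apply: (mxg_M gO).
  have -> : invmx g *m h - 1%:M = - (invmx g *m (g - h)).
    by rewrite mulmxBr mulVmx ?(mxg_unit gO) // opprB.
  apply: mx_inpN; rewrite -[m.+1%:Z]add0r; apply: mx_inpM => //; exact: Vg.2.
exists N => //; have O1 := mxg_1 gO.
apply: (haar_ind_neq0 gO hN _ O1); last by rewrite indicT //; exact: mxg_1 gI.
by move=> g _; exact: indic_cases.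
Qed.

Lemma psi_sum m : exists2 N : C, N != 0 &
  forall (J phi : 'M[F]_3 -> C) (sg rho zeta S : C), zeta != 0 -> rho != 0 ->
    (forall h k, SO h -> I k -> J (h *m k) = J h) ->
    (forall h, SO h -> J (h *m g3) = sg * J h) ->
    (forall s, s != 0 -> ~ inp 1 (s - 1) -> J (t3 s) = 0) ->
    (forall h, SO h -> phi h = J h * (rho * zeta ^ ht h)) ->
    is_int_quot gam m.+1 phi S -> S = N * J 1%:M * rho * (1 + sg / zeta).
Proof.
have [N N0 hN] := haar_I3p m; exists N => // J phi sg rho zeta S z0 r0 JI Jg Jt ephi.
move=> [phiU _ [t [D [[t0 vt] tD hS]]]].
(* Left invariance of J is extracted from that of phi, which is part of [is_int_quot]; heights are
   invariant and the section factor is nonzero. *)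
have JU x h : SO h -> J (u x *m h) = J h.
  move=> Sh; have := phiU x h Sh; rewrite !ephi // ?ht_u3 //; last exact: (mxg_M gS (u3_SO gam0 x) Sh).
  by apply: mulIf; rewrite mulf_neq0 // expfz_neq0.
pose y0 := - t / w.
have y00 : y0 != 0 by rewrite mulf_neq0 ?oppr_eq0 ?invr_eq0.
have vy0 : v y0 = 0 by rewrite val_div ?oppr_eq0 // valN vt vw subrr.
have [d [d0 dr]] := pf_residue F.
have hA := haar_indep gO (Kc_group m) hN tD.
have hB : has_sum D (indic R (cell y0)) (q%:R * N).
  have rO i : SOo (cell_rep y0 (d i)).
    apply: (mxg_M gO); last exact: w1_int.
    apply: (mxg_M gO); last exact: (t3_int gam y00 vy0).
    exact: (u3_int gam0 vgam (d0 i)).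
  have hr (r : seq 'I_q) : has_sum D (fun k => \sum_(i <- r) indic R I (invmx (cell_rep y0 (d i)) *m k))
      (\sum_(i <- r) N).
    elim: r => [|i r IH].
      by rewrite big_nil; apply: has_sum_ext (@has_sum0 R _ D) => k _; rewrite big_nil.
    rewrite big_cons; apply: has_sum_ext (has_sumD _ IH) => [k _|].
      by rewrite big_cons.
    apply: (haar_indep gO (Kc_group m) _ tD).
    by apply: haar_translate => //; apply: (mxg_V gO).
  have hr1 := hr (index_enum 'I_q); rewrite sumr_const cardT size_enum_ord in hr1.
  rewrite mulr_natl; apply: has_sum_ext hr1 => k /tD.1[Sk _]; rewrite -(cell_sum y00 vy0 dr d0 Sk).
  by [].
have hT := has_sumZ (J 1%:M * rho) (has_sumD (has_sum_slice (0 : int) hA)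
  (has_sumZ (sg / zeta / q%:R) (has_sum_slice (-1 : int) hB))).
rewrite (_ : J 1%:M * rho * (N + sg / zeta / q%:R * (q%:R * N)) = N * J 1%:M * rho * (1 + sg / zeta)) in hT; last first.
  have q0 : (q%:R : C) != 0 by exact: q_neq0.
  by rewrite [_ / q%:R * _]mulrA divfK //; ring.
apply: has_sum_unique hT; apply: has_sum_ext hS => -[n k] /= /tD.1 Ok.
have m0 : t ^ n != 0 by rewrite expfz_neq0.
have Sk : SO k := Ok.1.
rewrite ephi; last by apply: (mxg_M gS (t3_SO gam m0) Sk).
rewrite ht_t3 // ht_SOo // addr0 valXz // vt mul1r.
rewrite (psi_term n t0 vt JU JI Jg Jt Ok).
case: eqP => [->|n0]; first by rewrite !expr0z !mulr1 !(mulr0, addr0); ring.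
case: eqP => [->|n1]; last by rewrite !(mulr0, add0r, mul0r).
by rewrite !exprN1 !add0r; ring.
Qed.

End PsiSum.

Lemma field_gamma (K : fieldType) (N g A o M B D E : K) : N != 0 ->
  g * (N * A) = o * (N * M * B) -> M * D = E -> g * A * D = o * E * B.
Proof.
move=> N0 e <-; apply: (mulfI N0).
have -> : N * (g * A * D) = g * (N * A) * D by ring.
by rewrite e; ring.
Qed.

(** * The gamma factor for the trivial character *)

Section GammaTrivial.
Variables (F : padic_field) (R : realType) (l : nat).
Hypotheses (l3 : (3 <= l)%N) (p2 : pf_p F != 2%N).
Variables (w a : F) (psi : F -> R[i]) (om sg : R[i]).
Hypotheses (w0 : w != 0) (vw : pf_val w = 1) (a0 : a != 0) (va : pf_val a = 0).
Hypotheses (psi1 : level1_character psi) (om2 : om ^+ 2 = 1) (sg2 : sg ^+ 2 = 1).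
Variable pi : grep F R (2 * l).
Hypothesis ssc : simple_supercuspidal_SO w a psi om sg pi.
Local Notation C := R[i].
Local Notation gam := (- (4%:R * a)).
Local Notation ht := (ht gam).
Local Notation q := (pf_q F).
Local Notation X := (@Xs R).

Let gam0 : gam != 0. Proof. by rewrite oppr_eq0 mulf_neq0 // pf_char0. Qed.
Let vgam : pf_val gam = 0. Proof. by rewrite valN pf_valM // ?pf_char0 // val4 // va. Qed.

(** The constant N does not depend on the section, so it cancels from the functional equation. It
    combines the volume of [I3p], the value of W and the volume of the lattice of columns r in p at
    h = 1. *)
Lemma whittaker_psi : exists2 W : 'M[F]_(2 * l) -> C, whittaker psi gam pi W &
  forall m, exists2 N : C, N != 0 & forall (f : sec F R) z S rho zeta,
    zeta != 0 -> rho != 0 ->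
    (forall h, SO3 gam h -> rval (f h 1) z = rho * zeta ^ ht h) ->
    is_Psi gam m.+1 W f z S -> S = N * rho * (1 + sg / zeta).
Proof.
have [W [hW WI Wg Wt [c c0 W1]]] := whittaker_exists l3 p2 w0 vw a0 va psi1 om2 sg2 ssc.
exists W => // m; have [N N0 hN] := psi_sum R gam0 vgam p2 w0 vw m.
exists (N * (c * vol F R (l - 2) 1 1)).
  by rewrite mulf_neq0 // mulf_neq0 // vol_neq0.
move=> f z S rho zeta z0 r0 ef [J hJ hS].
have S1 : SO3 gam (1%:M : 'M[F]_3) := mxg_1 (SO3_group gam).
have J1 : J 1%:M = c * vol F R (l - 2) 1 1.
  apply: is_int_unique (hJ _ S1) _.
  apply: is_int_ext (is_intZ c (is_int_lattice F R (l - 2) 1 1)) => r.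
  by rewrite W1 /indic.
have Jz s : s != 0 -> ~ inp 1 (s - 1) -> J (t3 s) = 0.
  move=> s0 hs; have h := hJ _ (t3_SO gam s0).
  rewrite -(mul0r (J (t3 s))); apply: (is_int_unique h).
  by apply: is_int_ext (is_intZ 0 h) => r; rewrite Wt // mulr0.
rewrite -J1; apply: (hN J _ sg rho zeta S z0 r0 _ _ Jz _ hS).
- move=> h k Sh Ik; have Shk := mxg_M (SO3_group gam) Sh Ik.1.
  by apply: is_int_unique (hJ _ Shk) _; apply: is_int_ext (hJ _ Sh) => r; rewrite WI.
- move=> h Sh; have Shk := mxg_M (SO3_group gam) Sh (SO3_gchi a w0).
  apply: is_int_unique (hJ _ Shk) _.
  by apply: is_int_ext (is_intZ sg (hJ _ Sh)) => r; rewrite Wg.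
by move=> h Sh; rewrite ef.
Qed.

(** Psi(W, f_s) has rho = 1 and zeta = z; for M^* f_s, [is_M_sph_scale] gives rho = M1(z) and zeta =
    (q z)^-1. The unknown M1 is then eliminated through [local_coefficient]. *)
Lemma so_gamma_trivial g : so_gamma psi gam pi (fun=> 1) g ->
  g * (1 + cst sg * X^-1) * (cst q%:R * X - (cst q%:R * X)^-1) =
  cst om * (X^-1 - X) * (1 + cst sg * (cst q%:R * X)).
Proof.
move=> [c0 [c [hc0 hC hPsi]]].
have [W hW hN] := whittaker_psi.
have [Mf [m [P [P' [hM hP hP' eP]]]]] := hPsi _ _ hW (holo_sph R gam0 vgam p2).
have [N N0 {}hN] := hN m; set M1 := c * Mf 1%:M 1.
have eC := local_coefficient gam0 vgam p2 w0 vw psi1 hC hM.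
have X0 : X != 0 := Xs_neq0 R.
have q0 : (q%:R : C) != 0 := q_neq0 F R.
(* Otherwise X^-1 = X, which evaluation at 2 refutes. *)
have M10 : M1 != 0.
  apply/eqP => e0; move: eC; rewrite -/M1 e0 mul0r => /eqP; rewrite eq_sym subr_eq0 => /eqP e1.
  have e2 : X * X = 1 by rewrite -[X in X * _]invrK e1 mulVf // invr_eq0.
  have := rf_atM (rf_at_X 2%:R) (rf_at_X (2%:R : C)); rewrite e2 => a1.
  have /eqP := rf_at_unique a1 (rf_at1 _).
  by rewrite -natrM pnatr_eq1.
have eP1 : P = cst N * (1 + cst sg * X^-1).
  have [r1 _] := rf_near P; apply: ratfun_eq0.
  apply: near0_mono (near0_and hP r1) => z z0 [H a1]; exists (rval P z) => //.
  have -> : rval P z = N * (1 + sg * z^-1).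
    rewrite -[N]mulr1; apply: (hN _ z _ 1 z z0 (oner_neq0 _) _ H) => h Sh.
    by rewrite mul1r rval_Xz.
  by apply: rf_atM; [exact: rf_at_cst|apply: rf_atD; [exact: rf_at1|apply: rf_atM; [exact: rf_at_cst|apply: rf_atV => //; exact: rf_at_X]]].
have eP2 : P' = cst N * M1 * (1 + cst sg * (cst q%:R * X)).
  have [_ r1] := rf_near P'; have [_ r2] := rf_near M1; have [_ r3] := rf_near M1^-1.
  apply: ratfun_eqoo; apply: nearoo_mono (nearoo_and hP' (nearoo_and r1 (nearoo_and r2 r3))).
  move=> z z0 [H [a1 [a2 a3]]]; exists (rval P' z) => //.
  have m0 : rval M1 z != 0.
    have a4 := rf_atM a2 a3; rewrite (divff M10) in a4.
    have e := rf_at_unique a4 (rf_at1 z); apply/eqP => e0.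
    by move/eqP: e; rewrite e0 mul0r eq_sym oner_eq0.
  have qz0 : q%:R * z != 0 by rewrite mulf_neq0.
  have a5 := rf_atM (rf_at_cst q%:R z) (rf_at_X z).
  have -> : rval P' z = N * rval M1 z * (1 + sg * (q%:R * z)).
    rewrite -[q%:R * z in RHS]invrK; apply: (hN _ z _ (rval M1 z) (q%:R * z)^-1 _ m0 _ H).
      by rewrite invr_eq0.
    move=> h Sh; apply: rvalE.
    have b10 : (1 : F) != 0 := oner_neq0 _.
    rewrite (is_M_sph_scale gam0 vgam p2 hM Sh b10) [X in rf_at X](_ : _ = M1 * (cst q%:R * X) ^ (- ht h)).
      apply: rf_atM => //; rewrite exprz_inv; exact: rf_atXz.
    by rewrite mulrCA mulrC.
  apply: rf_atM; first by apply: rf_atM => //; exact: rf_at_cst.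
  by apply: rf_atD; [exact: rf_at1|apply: rf_atM => //; exact: rf_at_cst].
(* For tau = 1, with 2 and gam units, every normalising factor of the functional equation except the
   central character is 1. *)
have v2 : pf_val (2%:R : F) = 0 := val2 p2.
move: eP; rewrite (central_char l3 p2 w0 vw a0 va psi1 om2 sg2 ssc hc0).
have e1 : abs2s1 R (2%:R : F) = 1 by rewrite /abs2s1 v2.
have e2 : abs2s1 R gam = 1 by rewrite /abs2s1 vgam.
have e3 : (cst 1 : ratfun R) ^+ l = 1 by rewrite -cstX expr1n cst1.
rewrite e1 e2 e3 !expr1n invr1 cst1 !mulr1 invr1 mulr1.
by rewrite eP1 eP2 => eP; apply: field_gamma eP eC; exact: cst_neq0.
Qed.

End GammaTrivial.

(** * The case l = 2 *)

(** Valid at poles as well, where [rval] takes its default value 0 on both sides. *)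
Lemma rval_cstM (R : realType) (c : R[i]) g z : c != 0 ->
  rval (cst c * g : ratfun R) z = c * rval g z.
Proof.
move=> c0; have [[w hw]|n] := pselect (exists w, rf_at g z w).
  by rewrite (rvalE hw) (rvalE (rf_atM (rf_at_cst c z) hw)).
have e0 (h : ratfun R) : ~ (exists w, rf_at h z w) -> rval h z = 0.
  by move=> nh; rewrite /rval; case: xgetP => [w _ hw|//]; case: nh; exists w.
rewrite (e0 _ n) mulr0 e0 // => -[w hw]; apply: n; exists (c^-1 * w).
have := rf_atM (rf_at_cst c^-1 z) hw.
by rewrite cstV mulKf ?cst_neq0.
Qed.

Lemma twist_identity (K : comPzRingType) (A B Y D : K) : A * A = 1 -> B * B = 1 ->
  A * (B * Y * (A * B) * D) = Y * 1 * (1 * D).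
Proof.
move=> hA hB; have -> : A * (B * Y * (A * B) * D) = (A * A) * (B * B) * (Y * D) by ring.
by rewrite hA hB !mul1r mulr1.
Qed.

Lemma tofracZ (R : realType) (c : R[i]) (P : {poly R[i]}) :
  FracField.tofrac (c *: P) = cst c * FracField.tofrac P :> ratfun R.
Proof. by rewrite -mul_polyC rmorphM. Qed.

(** * Twisting by an unramified quadratic character *)

Section Twist.
Variables (F : padic_field) (R : realType) (psi : F -> R[i]) (gam : F) (zeta : R[i]).
Hypothesis z2 : zeta ^+ 2 = 1.
Local Notation C := R[i].
Local Notation v := (@pf_val F).
Local Notation tau := (fun x : F => zeta ^ v x).
Local Notation dil := (dilate zeta).

Let z0 : zeta != 0.
Proof. by apply: contra_eq_neq z2 => ->; rewrite expr0n eq_sym oner_neq0. Qed.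

Lemma sign_sq (n : int) : zeta ^ n * zeta ^ n = 1.
Proof. by rewrite -expfzMl -expr2 z2 exp1rz. Qed.

Lemma cstXz (n : int) : cst (zeta ^ n) = cst zeta ^ n :> ratfun R.
Proof. by case: n => n; [exact: cstX|rewrite !NegzE -!exprnN cstV cstX]. Qed.

(* For tau = zeta ^ v, replacing X by zeta X turns V(tau, s) into V(1, s). *)
Definition untwist (f : sec F R) : sec F R := fun h b => cst (zeta ^ v b) * dil (f h b).

Lemma untwist_holo f : holo_section gam tau f -> holo_section gam (fun=> 1) (untwist f).
Proof.
move=> [fe [N fN] fp]; split.
- move=> m b x g m0 b0 Sg; rewrite /untwist fe // !(dilateM z2) (dilateXz z2) (dilate_X z2).
  rewrite (dilate_cst z2) (val_one F) expr0z cst1 expfzMl -cstXz pf_valM // expfzDr // cstM.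
  by apply: twist_identity; rewrite -cstM sign_sq cst1.
- by exists N => g k b b0 Sg Sk hk; rewrite /untwist fN.
move=> k Ok; have [P [n e]] := fp k Ok.
exists (zeta ^- n *: (P \Po (zeta *: 'X))), n.
rewrite /untwist (val_one F) expr0z cst1 mul1r e (dilateM z2) (dilateV z2) (dilateX z2) (dilate_X z2).
rewrite (dilate_poly z2) tofracZ exprMn invfM cstV cstX; by rewrite mulrA [FracField.tofrac _ * _]mulrC.
Qed.

(** A factor for a twisted character requires a local coefficient, and the one at hand belongs to
    the trivial character. The substitution X -> zeta X carries it over, since the integrals of the
    untwisted section at zeta z are those of f at z up to signs. *)
Lemma is_C_twist c : is_C psi gam (fun=> 1) c -> is_C psi gam tau (dil c).
Proof.
move=> hC f /untwist_holo hf; have [Mf [J [J' [hM hJ hJ' eJ]]]] := hC _ hf.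
exists (fun h b => cst (zeta ^ v b) * dil (Mf h b)), (dil J), (dil J'); split.
- apply: near0_mono (near0_dilate z2 hM) => z _ H h b Sh b0.
  have n0 n : zeta ^ n != 0 by rewrite expfz_neq0.
  rewrite rval_cstM // (rval_dilate z2).
  apply: is_int_ext (is_intZ (zeta ^ v b) (H h b Sh b0)) => x.
  rewrite /untwist rval_cstM // (rval_dilate z2) valN valV // mulrA -expfzDr // subrr.
  by rewrite expr0z mul1r mulrA -expr2 z2 mul1r.
- apply: near0_mono (near0_dilate z2 hJ) => z _ H; rewrite (rval_dilate z2).
  apply: is_int_ext H => x; congr (_ * _).
  rewrite /untwist (val_one F) expr0z cst1 mul1r (rval_dilate z2).
  by rewrite mulrA -expr2 z2 mul1r.
- apply: nearoo_mono (nearoo_dilate z2 hJ') => z _ H; rewrite (rval_dilate z2).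
  apply: is_int_ext H => x; congr (_ * _).
  by rewrite (val_one F) expr0z cst1 mul1r (rval_dilate z2).
by rewrite eJ (dilateM z2).
Qed.

Lemma tau_quadratic : quadratic tau.
Proof.
split; last by move=> x _; rewrite expr2 sign_sq.
split; first by rewrite (val_one F) expr0z.
  by move=> x y x0 y0; rewrite pf_valM // expfzDr.
by exists 0%N => x /val_1p[_ ->]; rewrite expr0z.
Qed.

Lemma tau_tame : tamely_ramified tau.
Proof. by move=> x /val_1p[_ ->]; rewrite expr0z. Qed.

End Twist.

Lemma pole_inv (R : realType) (z : R[i]) : has_pole ((Xs - cst z)^-1 : ratfun R) z.
Proof.
move=> [w hw]; have hB := rf_atB (rf_at_X z) (rf_at_cst z z); rewrite subrr in hB.
have n0 : Xs - cst z != 0 :> ratfun R.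
  apply/eqP => e; have := rf_atB (rf_at_X (z + 1)) (rf_at_cst z (z + 1)); rewrite e => h.
  have h0 : rf_at (0 : ratfun R) (z + 1) 0 by have := rf_at_cst 0 (z + 1); rewrite /cst !rmorph0.
  by have /eqP := rf_at_unique h h0; rewrite addrC addKr oner_eq0.
have := rf_atM hB hw; rewrite (divff n0) mul0r => h.
by have /eqP := rf_at_unique h (rf_at1 z); rewrite eq_sym oner_eq0.
Qed.

Section RankTwo.
Variables (F : padic_field) (R : realType) (l : nat).
Hypotheses (l2 : l = 2%N) (p2 : pf_p F != 2%N).
Variables (w a : F) (psi : F -> R[i]) (om sg : R[i]).
Hypotheses (w0 : w != 0) (vw : pf_val w = 1) (a0 : a != 0) (va : pf_val a = 0).
Hypotheses (psi1 : level1_character psi) (sg2 : sg ^+ 2 = 1).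
Local Notation C := R[i].
Local Notation M := 'M[F]_(2 * l).
Local Notation SO := (@SOeven F l).
Local Notation I := (@iwahori_plus F l).
Local Notation chi := (affine_generic w a psi).
Local Notation g := (g_chi l w a).

Let hl : (2 <= l)%N. Proof. by rewrite l2. Qed.

(* For l = 2 the element g_chi does not stabilise chi: it exchanges the affine
   root group of the entry (2, 1), on which chi is trivial, with that of (1, 2). *)
Definition low_N (y : F) : M := \matrix_(i, j)
  (if (i == 1%N :> nat) && (j == 0%N :> nat) then w * y
   else if (i == 3%N :> nat) && (j == 2%N :> nat) then - (w * y) else 0).
Definition low (y : F) : M := 1%:M + low_N y.

Lemma low_iwahori y : inp 0 y -> I (low y).
Proof.
move=> hy; have sN : star (low_N y) = - low_N y.
  apply/matrixP => i j; have hi := ltn_ord i; have hj := ltn_ord j.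
  by rewrite !mxE /=; repeat (case: ifP => ?); rewrite ?opprK ?oppr0 //; exfalso; lia.
have NN : low_N y *m low_N y = 0.
  apply/matrixP => i j; rewrite mxE [RHS]mxE big1 // => k _; rewrite !mxE.
  by repeat (case: ifP => ?); rewrite ?mulr0 ?mul0r //; exfalso; lia.
split.
  apply/SOE; split; last first.
    rewrite starD star1 sN mulmxDl mul1mx mulmxDr mulmx1 mulNmx NN.
    by rewrite oppr0 addr0 -addrA subrr addr0.
  rewrite det_trig; last first.
    apply/is_trig_mxP => i j ij; rewrite !mxE -val_eqE (ltn_eqF ij) add0r.
    by repeat (case: ifP => ?); rewrite //; exfalso; lia.
  rewrite big1 // => i _; rewrite !mxE eqxx.
  by repeat (case: ifP => ?); rewrite ?addr0 //; exfalso; lia.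
move=> i j; have -> : low y i j - (i == j)%:R = low_N y i j by rewrite mxE mxE addrAC subrr add0r.
have wy : inp 1 (w * y) by apply: inp_Mp => //; right; rewrite vw.
have k1 (b : bool) (x : F) : inp 1 x -> inp b%:Z x by move=> h; apply: inp_le h; case: b.
rewrite mxE; case: ifP => _; first exact: k1.
by case: ifP => _; [apply: k1; apply: inpN|apply: inp0].
Qed.

Let b0 : (0 < 2 * l)%N. Proof. by rewrite l2. Qed.
Let b1 : (1 < 2 * l)%N. Proof. by rewrite l2. Qed.
Let b2 : (2 < 2 * l)%N. Proof. by rewrite l2. Qed.

Lemma aff_form_low h : aff_form w a (1%:M + h : M) = h (Ordinal b0) (Ordinal b1) +
  a * h (Ordinal b0) (Ordinal b2) + w^-1 * h (Ordinal b2) (Ordinal b0).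
Proof.
have e1 (G : nat -> F) : \sum_(1 <= i < l) G i = G 1%N by rewrite l2 big_nat1.
rewrite aff_formD aff_form1 // add0r /aff_form e1 -!ent_ord.
have -> : l.-1 = 1%N by rewrite l2.
have -> : (2 * l).-1 = 3%N by rewrite l2.
by have -> : l.+1 = 3%N by rewrite l2.
Qed.

Lemma chi_low y : chi (low y) = 1.
Proof.
rewrite /affine_generic -/(aff_form w a _) aff_form_low !mxE /= !mulr0 !addr0.
exact: (psi0 psi1).
Qed.

Lemma chi_gchi_low y : chi (g *m low y *m g) = psi (a * y).
Proof.
have -> : g *m low y *m g = 1%:M + g *m low_N y *m g.
  by rewrite mulmxDr mulmx1 mulmxDl gchi_sq.
rewrite /affine_generic -/(aff_form w a _) aff_form_low !(gchi_conj hl p2 w0 vw a0 va).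
rewrite ![low_N y _ _]mxE /= /gc_s /gc_c /= l2 /=; congr psi.
rewrite !(mulr0, mul0r, addr0) mulrNN mulKf //; exact: mulrC.
Qed.

(** Evaluation at [g_chi * low y * x] in two ways: [low y] acts by chi(low y) = 1, but moved across
    [g_chi] it acts by psi(a y), and y is chosen so that this is not 1. *)
Lemma cind_trivial (f : M -> C) : SO g -> cind_space w a psi om sg f -> forall x, f x = 0.
Proof.
move=> Sg [f0 fI fg _ _] x; have [Sx|nS] := pselect (SO x); last exact: f0.
have SG := SO_group F l.
have [_ _ [y0 hy ny]] := psi1; pose y := y0 / a.
have hy' : inp 0 y by apply: inp_Mp => //; right; rewrite valV // va.
have Il := low_iwahori hy'; have Igl := iwahori_gchi hl p2 w0 vw a0 va Sg Il.
have Sgx : SO (g *m x) by apply: (mxg_M SG).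
have Sl : SO (low y) := iwahori_sub Il.
have Slx : SO (low y *m x) by apply: (mxg_M SG).
have e1 : f (g *m (low y *m x)) = sg * f x.
  by have [-> _] := fg _ Slx; rewrite fI // chi_low mul1r.
have e2 : f (g *m (low y *m x)) = psi y0 * (sg * f x).
  have -> : g *m (low y *m x) = (g *m low y *m g) *m (g *m x).
    by rewrite -[RHS]mulmxA [g *m (g *m x)]mulmxA gchi_sq // mul1mx mulmxA.
  by rewrite fI // chi_gchi_low mulrCA divff // mulr1; have [-> _] := fg _ Sx.
have s0 : sg != 0 by apply: contra_eq_neq sg2 => ->; rewrite expr0n eq_sym oner_neq0.
have /eqP : (psi y0 - 1) * (sg * f x) = 0 by rewrite mulrBl mul1r -e2 -e1 subrr.
by rewrite !mulf_eq0 subr_eq0 (negbTE ny) (negbTE s0) => /eqP.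
Qed.

Lemma rank_two_rep (pi : grep F R (2 * l)) : simple_supercuspidal_SO w a psi om sg pi ->
  forall x y : grep_space pi, x = y.
Proof.
move=> [_ [T [_ Tinj Timg _]]] x y; apply: Tinj.
have Sg : SO g by exact: gchi_SO.
have T0 z h : T z h = 0.
  by apply: (cind_trivial Sg); apply/Timg; exists z.
by apply/funext => h; rewrite !T0.
Qed.

End RankTwo.

Lemma so_gamma_zero_rep (F : padic_field) (R : realType) (l : nat) (psi tau : F -> R[i])
    (gam w : F) (pi : grep F R (2 * l)) c g :
  w != 0 -> pf_val w = 1 -> (forall x y : grep_space pi, x = y) ->
  is_C psi gam tau c -> so_gamma psi gam pi tau g.
Proof.
move=> w0 vw e hC; exists 0, c; split=> // W f [Lam [x [Llin _ eW]]] hf.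
have [Mf [_ [_ [hM _ _ _]]]] := hC f hf.
have L0 : Lam 0 = 0.
  have := Llin (-1) 0 0; rewrite scaler0 addr0 => {1}->.
  by rewrite scaleN1r addNr.
have W0 h : W h = 0 by rewrite eW (e (gact h x) 0).
have hPsi f' z : is_Psi gam 1 W f' z (rval 0 z).
  rewrite rval0; exists (fun=> 0) => [h _|].
    rewrite -(mul0r (vol F R (l - 2) 1 0)).
    by apply: is_int_ext (is_intZ 0 (is_int_lattice F R (l - 2) 1 0)) => r; rewrite mul0r W0.
  split=> [? ? _|? ? _ _ _|]; rewrite ?mul0r //.
  have [D tD] := ltrans_exists (SO3o_group gam) (mx_groupI (SO3_group gam) (congr_group F 3 0)).
  exists w, D; split=> //.
  by apply: has_sum_ext (@has_sum0 R _ _) => y _; rewrite !mul0r.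
exists Mf, 0%N, 0, 0; split=> //; last by rewrite !mulr0.
- by exists 1 => // z _; apply: hPsi.
- by exists 1 => // z _; apply: hPsi.
Qed.

(** * Comparison with the Langlands parameter *)

Lemma laurent_neq0 (R : realType) (q : R[i]) : q != 0 ->
  (1 - Xs * Xs != 0 :> ratfun R) /\ (cst q * Xs - (cst q * Xs)^-1 != 0 :> ratfun R).
Proof.
move=> q0; have zero z : rf_at (0 : ratfun R) z 0.
  by have := rf_at_cst 0 z; rewrite /cst !rmorph0.
have n4 : (2%:R * 2%:R : R[i]) != 1 by rewrite -natrM pnatr_eq1.
split; apply/eqP => e.
  have := rf_atB (rf_at1 2%:R) (rf_atM (rf_at_X 2%:R) (rf_at_X (2%:R : R[i]))); rewrite e.
  by move/rf_at_unique/(_ (zero _))/eqP; rewrite subr_eq0 eq_sym (negbTE n4).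
have h := rf_atM (rf_at_cst q (2%:R / q)) (rf_at_X (2%:R / q)).
have e2 : q * (2%:R / q) = 2%:R by rewrite mulrCA divff ?mulr1.
rewrite e2 in h; have n2 : (2%:R : R[i]) != 0 by rewrite pnatr_eq0.
have := rf_atB h (rf_atV n2 h); rewrite e.
move/rf_at_unique/(_ (zero _))/eqP; rewrite subr_eq0 => /eqP e3.
by case/eqP: n4; rewrite {2}e3 divff.
Qed.

(** * The summands of the parameter as representations of the Weil group *)

Section WeilRepresentations.
Variables (F : padic_field) (R : realType) (Fb : closedFieldType) (iota : {rmorphism F -> Fb}).
Local Notation C := R[i].

Lemma weil_groupM s t : weil_group iota s -> weil_group iota t -> weil_group iota (s \o t).
Proof.
move=> [sb sD sM si [a [b hs]]] [tb tD tM ti [c [d ht]]]; split.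
- exact: bij_comp.
- by move=> x y; rewrite /= tD sD.
- by move=> x y; rewrite /= tM sM.
- by move=> x; rewrite /= ti si.
have t1 : t 1 = 1 by rewrite -(rmorph1 iota) ti.
have s1 : s 1 = 1 by rewrite -(rmorph1 iota) si.
have sX x n : s (x ^+ n) = s x ^+ n by elim: n => [|n IH]; rewrite ?s1 // !exprS sM IH.
exists (a + c)%N, (b + d)%N => m x m0 mp xm; rewrite /= addnC expnD exprM.
rewrite -sX (ht m x m0 mp xm) (hs m) -?exprM -?expnD // ?[(d + b)%N]addnC //.
by rewrite mulnC exprM xm expr1n.
Qed.

Lemma weil_group_id : weil_group iota id.
Proof. by split=> //; [exists id|exists 0%N, 0%N]. Qed.

Lemma quadratic_weil_rep (tau : F -> C) (eta : wrep R Fb 1) :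
  quadratic_cft iota tau eta -> weil_rep iota eta.
Proof.
move=> [d [e [d0 ed _ he]]].
have e0 : e != 0.
  by apply: contra_eq_neq ed => ->; rewrite expr0n /= eq_sym fmorph_eq0.
have ne : - e != e.
  rewrite -subr_eq0 -opprD oppr_eq0 -mulr2n -mulr_natr mulf_neq0 //.
  by rewrite -(rmorph_nat iota) fmorph_eq0 pf_char0.
have pm s : weil_group iota s -> s e = e \/ s e = - e.
  move=> [_ _ sM si _]; have : s e ^+ 2 = e ^+ 2 by rewrite ed -si -ed !expr2 sM.
  by move/eqP; rewrite eqf_sqr => /orP[]/eqP; [left|right].
split.
- by rewrite (he _ weil_group_id) eqxx.
- move=> s t hs ht; rewrite (he _ (weil_groupM hs ht)) (he _ hs) (he _ ht) -scalar_mxM /=.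
  have sN : s (- e) = - s e.
    have [_ sD sM si _] := hs; apply/eqP; rewrite -addr_eq0 -sD addrC subrr.
    by rewrite -(rmorph0 iota) si.
  congr _%:M; have [->|->] := pm _ ht; have [se|se] := pm _ hs;
  by rewrite ?sN ?se ?opprK ?eqxx ?(negbTE ne) ?mulr1 ?mul1r ?mulrNN ?mulr1.
exists [:: e] => s hs _ hse; rewrite he // hse ?eqxx //.
by rewrite inE.
Qed.

Lemma wrep_sum_weil_rep m n (r1 : wrep R Fb m) (r2 : wrep R Fb n) :
  weil_rep iota r1 -> weil_rep iota r2 -> weil_rep iota (wrep_sum r1 r2).
Proof.
move=> [i1 M1 [e1 h1]] [i2 M2 [e2 h2]]; split.
- by rewrite /wrep_sum i1 i2 -scalar_mx_block.
- move=> s t hs ht; rewrite /wrep_sum M1 // M2 // mulmx_block.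
  by rewrite !mulmx0 !mul0mx !addr0 add0r.
exists (e1 ++ e2) => s hs h0 h; rewrite /wrep_sum h1 ?h2 // -?scalar_mx_block //.
  by move=> x xe; apply: h; rewrite mem_cat xe orbT.
by move=> x xe; apply: h; rewrite mem_cat xe.
Qed.

End WeilRepresentations.

(** X stands for q^(-s), r for the square root of q, s for sg, o for om, e for eps and d for delta.
    Multiplying the second relation by q X (1 - s / (q X)) allows the first to be substituted; by
    s^2 = 1 both sides acquire the factor q (1 - X^2) (q X - 1/(q X)), which is cancelled. *)
Lemma root_number_identity (K : fieldType) (X q s g e d o r : K) :
  X != 0 -> q != 0 -> r * r = q -> s * s = 1 -> 1 - X * X != 0 ->
  q * X - (q * X)^-1 != 0 ->
  g * (q * X) * (1 - s * (q * X)^-1) = r * s * (1 - s * X) ->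
  g * e * (d * r * X) * (1 + s * X^-1) * (q * X - (q * X)^-1) =
    o * (X^-1 - X) * (1 + s * (q * X)) ->
  e * d = o * s.
Proof.
move=> X0 q0 rr ss nX nD h1 h2.
set D := q * X - (q * X)^-1 in nD h2; set Q := (q * X)^-1 in D nD h1 h2.
set Y := X^-1 in h2.
have XY : X * Y = 1 by rewrite divff.
have XQ : q * X * Q = 1 by rewrite divff // mulf_neq0.
have l1 : (Y - X) * X = 1 - X * X by rewrite mulrBl [Y * X]mulrC XY.
have l2 : (1 + s * (q * X)) * (1 - s * Q) = s * D.
  have -> : (1 + s * (q * X)) * (1 - s * Q) =
    1 - s * s * (q * X * Q) + s * (q * X - Q) by ring.
  by rewrite ss XQ mulr1 subrr add0r.
have l3 : (1 - s * X) * X * (1 + s * Y) = s * (1 - X * X).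
  have -> : (1 - s * X) * X * (1 + s * Y) =
    X + s * (X * Y) - s * X * X - s * s * X * (X * Y) by ring.
  by rewrite XY ss; ring.
have e1 : g * e * (d * r * X) * (1 + s * Y) * D * (q * X * (1 - s * Q)) =
    (g * (q * X) * (1 - s * Q)) * (e * d * r * X * (1 + s * Y) * D) by ring.
rewrite h1 h2 in e1.
have e2 : o * (Y - X) * (1 + s * (q * X)) * (q * X * (1 - s * Q)) =
    q * (1 - X * X) * D * (o * s).
  have -> : o * (Y - X) * (1 + s * (q * X)) * (q * X * (1 - s * Q)) =
    o * q * ((Y - X) * X) * ((1 + s * (q * X)) * (1 - s * Q)) by ring.
  by rewrite l1 l2; ring.
have e3 : r * s * (1 - s * X) * (e * d * r * X * (1 + s * Y) * D) =
    q * (1 - X * X) * D * (e * d).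
  have -> : r * s * (1 - s * X) * (e * d * r * X * (1 + s * Y) * D) =
    (r * r) * (s * ((1 - s * X) * X * (1 + s * Y))) * D * (e * d) by ring.
  by rewrite rr l3 [s * (s * _)]mulrA ss mul1r; ring.
have n0 : q * (1 - X * X) * D != 0 by rewrite !mulf_neq0.
by apply: (mulfI n0); rewrite -e2 -e3 e1.
Qed.

Theorem proposition5p1 (F : padic_field) (R : realType) (psi : F -> R[i])
    (Fb : closedFieldType) (iota : {rmorphism F -> Fb})
    (L : local_langlands iota psi)
    (l : nat) (w a : F) (om sg : R[i]) (pi : grep F R (2 * l))
    (tau1 tau2 : F -> R[i])
    (phi : wrep R Fb (2 * l)) (phi1 phi2 : wrep R Fb 1)
    (phi3 : wrep R Fb (2 * l - 2)) (Pi' : grep F R (2 * l - 2))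
    (eps delta : R[i]) :
  let gam : F := - (4%:R * a) in
  let pole_at_1 (tau : F -> R[i]) := exists2 g : ratfun R,
    so_gamma psi gam pi tau g & has_pole g (pf_q F)%:R^-1 in
  level1_character psi ->
  (forall x : Fb, algebraicOver iota x) ->
  pf_p F != 2%N -> (2 <= l)%N ->
  w != 0 -> pf_val w = 1 ->
  a != 0 -> pf_val a = 0 ->
  om ^+ 2 = 1 -> sg ^+ 2 = 1 ->
  simple_supercuspidal_SO w a psi om sg pi ->
  quadratic tau1 -> unramified tau1 ->
  quadratic tau2 -> tamely_ramified tau2 -> ~ unramified tau2 ->
  (forall tau : F -> R[i], quadratic tau -> tamely_ramified tau ->
     (pole_at_1 tau <->
      (forall x, x != 0 -> tau x = tau1 x) \/
      (forall x, x != 0 -> tau x = tau2 x))) ->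
  tau1 w = sg -> tau2 w = sg * tau2 gam ->
  llc_SO L pi phi ->
  quadratic_cft iota tau1 phi1 -> quadratic_cft iota tau2 phi2 ->
  llc_GL L phi3 Pi' -> simple_supercuspidal_GL Pi' ->
  wrep_iso iota phi (wrep_sum (wrep_sum phi1 phi2) phi3) ->
  gj_gamma psi Pi' (cst (delta * sqrtC (pf_q F)%:R) * Xs) ->
  tate_epsilon psi tau2 (cst eps) ->
  delta = om * sg * eps^-1.

Proof.
move=> gam pole psi1 _ p2 hl w0 vw a0 va om2 sg2 ssc q1 u1 q2 t2 nu2 hpole e1 _ hphi cft1 cft2.
move=> llc3 sc3 hiso hg3 [gt [Lt [Lt' [hgt hLt egt]]]].
have gam0 : gam != 0 by rewrite oppr_eq0 mulf_neq0 // pf_char0.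
have q0 : ((pf_q F)%:R : R[i]) != 0 := q_neq0 F R.
have hgam := llc_SO_gamma p2 hl w0 vw a0 va om2 sg2 ssc hphi.
have sg0 : sg != 0 by apply: contra_eq_neq sg2 => ->; rewrite expr0n eq_sym oner_neq0.
have [l3|l2] := leqP 3 l; last first.
  have {}l2 : l = 2%N by lia.
  have zeta2 : (- sg) ^+ 2 = 1 by rewrite sqrrN.
  have [c0 [c [_ hC _]]] := hgam.
  (* This character differs from [tau1] at w because 2 sg is nonzero, and from [tau2] because it is
     unramified. *)
  have [hp _] := hpole (fun x => (- sg) ^ pf_val x) (@tau_quadratic F R _ zeta2) (@tau_tame F R (- sg)).
  case: hp => [|h|h].
  - exists ((Xs - cst (pf_q F)%:R^-1)^-1); last exact: pole_inv.
    have triv := rank_two_rep l2 p2 w0 vw a0 va psi1 sg2 ssc.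
    exact: (so_gamma_zero_rep _ w0 vw triv (is_C_twist zeta2 hC)).
  - have := h w w0; rewrite vw expr1z e1 => /eqP.
    by rewrite -subr_eq0 -opprD oppr_eq0 -mulr2n mulrn_eq0 /= (negbTE sg0).
  by case: nu2 => x x0 vx; rewrite -h // vx expr0z.
have w1 := quadratic_weil_rep cft1; have w2 := quadratic_weil_rep cft2.
have [w3 _ _] := llc_GL_dom llc3; have [wphi _] := llc_SO_orthogonal hphi.
have w12 := wrep_sum_weil_rep w1 w2.
have eg := galois_gamma_iso L wphi (wrep_sum_weil_rep w12 w3) hiso.
rewrite !galois_gamma_sum // in eg.
(* [tau2] is ramified, so both L-factors are 1 and the gamma factor is epsilon. Tameness makes
   [tau2] equal to 1 on the first congruence subgroup, as [gj_unique] requires. *)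
have eg2 : galois_gamma L phi2 = cst eps.
  have h2 := galois_gamma_cft L q2 cft2.
  have -> : galois_gamma L phi2 = gt.
    apply: (gj_unique (f := fun x : 'M[F]_1 => tau2 (x 0 0)) (M := 0%N) h2 hgt).
    by move=> k [_ /(_ 0 0)]; rewrite !mxE eqxx => /t2.
  have [_ /(_ nu2)[eL eL']] := hLt.
  by rewrite egt eL eL' invr1 !mulr1.
(* Both sides are Godement-Jacquet factors of [Pi']: the left one by the correspondence, the right
   one by hypothesis. *)
have eg3 : galois_gamma L phi3 = cst (delta * sqrtC (pf_q F)%:R) * Xs.
  exact: (gj_gamma_unique sc3.1 (llc_GL_gamma llc3) hg3).
have h1 := tate_gamma_unramified psi1 q1.1 u1 w0 vw (galois_gamma_cft L q1 cft1).
have h2 := so_gamma_trivial l3 p2 w0 vw a0 va psi1 om2 sg2 ssc hgam.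
have sgV : sg^-1 = sg by apply: (mulfI sg0); rewrite divff -?expr2 ?sg2.
rewrite e1 sgV cstM in h1.
rewrite eg eg2 eg3 cstM in h2.
have ed : eps * delta = om * sg.
  apply: (@cst_inj R); rewrite !cstM.
  have [nX nD] := laurent_neq0 q0.
  apply: (root_number_identity (Xs_neq0 R) (cst_neq0 q0) _ _ nX nD h1 h2).
    by rewrite -cstM -expr2 sqrtCK.
  by rewrite -cstM -expr2 sg2 cst1.
have eps0 : eps != 0.
  apply: contra_eq_neq ed => ->; rewrite mul0r eq_sym mulf_neq0 //.
  by apply: contra_eq_neq om2 => ->; rewrite expr0n eq_sym oner_neq0.
by rewrite -ed mulrC mulKf.
Qed.
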